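(* Let $0\le p\le 2$ and let $f(z)=z+a_2z^2+a_3z^3+\cdots\in\mathcal{K}(p)$. Then $$|a_3-a_2|\le\frac{(2p+1)(2-p)}{6},$$ and $$|a_4-a_3|\le\begin{cases}\dfrac{p^3+50p^2-64p+64}{192}, & 0\le p<\dfrac87,\\[2mm] \dfrac{-3p^3+4p^2+6p-4}{12}, & \dfrac87\le p\le 2.\end{cases}$$ Both inequalities are sharp: for each $p\in[0,2]$ there is a function in $\mathcal{K}(p)$ attaining equality. Furthermore, $$\sup_{f\in\mathcal{K}^+}|a_3(f)-a_2(f)|=\frac{25}{48},$$ attained by $L_\phi$ with $\phi=\arccos(3/8)$, and $$\sup_{f\in\mathcal{K}^+}|a_4(f)-a_3(f)|=\frac{35\sqrt{70}-49}{729},$$ attained by $L_\phi$ with $\phi=\arccos\big((4+\sqrt{70})/18\big)$.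
   Context: $\mathbb{D}$ is the open unit disk. $\mathcal{K}$ is the class of analytic univalent functions $f(z)=z+\sum_{n\ge2}a_n(f)z^n$ on $\mathbb{D}$ with $f(\mathbb{D})$ convex. For $0\le p\le2$, $\mathcal{K}(p)=\{f\in\mathcal{K}: f''(0)=p\}$, and $\mathcal{K}^+=\bigcup_{0\le p\le 2}\mathcal{K}(p)$. For $\phi\in\mathbb{R}$, $L_\phi(z)=\frac{1}{e^{i\phi}-e^{-i\phi}}\log\frac{1-e^{-i\phi}z}{1-e^{i\phi}z}=\sum_{n\ge1}\frac{\sin n\phi}{n\sin\phi}z^n$ (interpreted by continuity when $\sin\phi=0$). *)

(* Defs.v *)
From Stdlib Require Import Reals.
Open Scope R_scope.

Definition C : Type := (R * R)%type.
Definition C0 : C := (0, 0).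
Definition C1 : C := (1, 0).
Definition RtoC (x : R) : C := (x, 0).
Definition Cadd (u v : C) : C := (fst u + fst v, snd u + snd v).
Definition Csub (u v : C) : C := (fst u - fst v, snd u - snd v).
Definition Cmul (u v : C) : C :=
  (fst u * fst v - snd u * snd v, fst u * snd v + snd u * fst v).
Definition Cscale (t : R) (u : C) : C := (t * fst u, t * snd u).
Fixpoint Cpow (z : C) (n : nat) : C :=
  match n with O => C1 | S m => Cmul z (Cpow z m) end.
Definition Cmod (u : C) : R := sqrt (fst u ^ 2 + snd u ^ 2).

Definition in_disk (z : C) : Prop := Cmod z < 1.

Fixpoint psum (a : nat -> C) (z : C) (N : nat) : C :=
  match N with
  | O => Cmul (a O) (Cpow z O)
  | S M => Cadd (psum a z M) (Cmul (a (S M)) (Cpow z (S M)))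
  end.

Definition series_sum (a : nat -> C) (z : C) (s : C) : Prop :=
  Un_cv (fun N => fst (psum a z N)) (fst s) /\
  Un_cv (fun N => snd (psum a z N)) (snd s).

(* A function analytic on D is identified with its Taylor coefficient sequence
   a, whose power series converges on all of D; f(z) = sum a_n z^n. *)
Definition analytic_on_disk (a : nat -> C) : Prop :=
  forall z, in_disk z -> exists s, series_sum a z s.

Definition univalent_on_disk (a : nat -> C) : Prop :=
  forall z1 z2 s1 s2, in_disk z1 -> in_disk z2 ->
    series_sum a z1 s1 -> series_sum a z2 s2 -> s1 = s2 -> z1 = z2.

Definition convex_image (a : nat -> C) : Prop :=
  forall z1 z2 s1 s2 t, in_disk z1 -> in_disk z2 ->
    series_sum a z1 s1 -> series_sum a z2 s2 -> 0 <= t <= 1 ->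
    exists w s, in_disk w /\ series_sum a w s /\
      s = Cadd (Cscale t s1) (Cscale (1 - t) s2).

Definition classK (a : nat -> C) : Prop :=
  a O = C0 /\ a 1%nat = C1 /\ analytic_on_disk a /\
  univalent_on_disk a /\ convex_image a.

(* K(p) : f''(0) = p, i.e. 2 a_2 = p *)
Definition classKp (p : R) (a : nat -> C) : Prop :=
  classK a /\ Cscale 2 (a 2%nat) = RtoC p.

Definition classKplus (a : nat -> C) : Prop :=
  exists p, 0 <= p <= 2 /\ classKp p a.

(* coefficients of L_phi: sin(n phi)/(n sin phi) for n >= 1 (sin phi <> 0 is
   assumed wherever this is used), 0 for n = 0 *)
Definition Lcoef (phi : R) (n : nat) : C :=
  match n with
  | O => C0
  | S _ => RtoC (sin (INR n * phi) / (INR n * sin phi))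
  end.

Definition bound3 (p : R) : R := (2 * p + 1) * (2 - p) / 6.
Definition bound4 (p : R) : R :=
  if Rlt_dec p (8 / 7) then (p ^ 3 + 50 * p ^ 2 - 64 * p + 64) / 192
  else (- 3 * p ^ 3 + 4 * p ^ 2 + 6 * p - 4) / 12.

(* Main.v *)
(** Upper bounds.  If f is convex univalent, then for every x = cos th the mean
    (f(e^{i th} z) + f(e^{-i th} z)) / 2 lies in f(D), so it equals f(h(z)) with h : D -> D.  As f is
    univalent, f' has no zero and h is holomorphic; comparing means over circles in |q h| <= |q|
    for polynomials q gives quadratic inequalities for the Taylor coefficients of h.  To first order
    at th = 0 these say that the Toeplitz form of 1 + z f''/f' is positive, i.e. that
    w = c + w1 z + w2 z^2 + ... with 1 + z f''/f' = (1 + z w) / (1 - z w) is a Schur function, where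
    c = p / 2.  Since 3 a_3 = w1 + 3 c^2 and 6 a_4 = w2 + 5 c w1 + 6 c^3, both estimates follow from
    the Schur inequalities |w1| <= 1 - c^2 and |w2 + c w1^2 / s| <= s - |w1|^2 / s, s = 1 - c^2.

    Sharpness.  Conversely, let Re (1 + z f''/f') > 0.  The tangent to the image of |z| = r turns
    monotonically through exactly 2 pi, so among the points f(z), |z| <= r, the one closest to the
    tangent line at f(w), |w| = r, is f(w) itself.  Hence f(|z| <= r) has a supporting line at each
    boundary point, which yields univalence and convexity.  The extremal functions come from positive
    measures supported at -1 and at two conjugate points. *)
From Pilot Require Import Defs.
From Stdlib Require Import Reals Lra Lia Classical ClassicalEpsilon List Wf_nat
  FunctionalExtensionality.
From Coquelicot Require Import Coquelicot.
Open Scope R_scope.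

(** * Complex differentiability and curves *)

(** Apart from power series, no holomorphic function is ever expanded in a Taylor series. The lift h
    is known only pointwise, as a solution of f(h(z)) = g(z); its coefficients up to z^4 come from a
    polynomial solving this equation up to O(z^5). Bessel's inequality is arranged to need no more:
    if H = s + O(z^N) with deg s < N, then on |z| = r the conjugate of s is a polynomial in r^2 / z,
    so (H - s) times it extends holomorphically off 0, tends to 0 there and has mean zero. The
    function theory thus rests on the mean value property, which for a continuous derivative follows
    by differentiating under the integral sign.

    At th = 0 the contraction degenerates to h(z) = z. Its defect is of first order in 1 - cos th,
    and the Toeplitz form is what remains after division by that factor.

    The a_3 estimate, and the a_4 estimate for p >= 8/7, are extremal when |w1| = 1 - c^2. This is
    realised by two conjugate atoms, that is by L_phi with cos phi = p / 2, which explains why the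
    suprema over p belong to such maps. *)

Lemma C_eq (u v : C) : fst u = fst v -> snd u = snd v -> u = v.
Proof. destruct u, v; simpl; congruence. Qed.

Lemma im_le_Cmod (z : C) : Rabs (snd z) <= Cmod z.
Proof.
  eapply Rle_trans; [|apply Rmax_Cmod]. apply Rmax_r.
Qed.

Lemma Cmod_le_abs (z : C) : Cmod z <= Rabs (fst z) + Rabs (snd z).
Proof.
  replace z with ((RtoC (fst z) + RtoC (snd z) * Ci)%C) at 1.
  - eapply Rle_trans; [apply Cmod_triangle|].
    rewrite Cmod_mult, !Cmod_R, Cmod_Ci. lra.
  - apply C_eq; simpl; ring.
Qed.

Lemma Cmod_minus_sym (u v : C) : Cmod (u - v) = Cmod (v - u).
Proof. rewrite <- Cmod_opp. f_equal. ring. Qed.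

Lemma Cmod_triangle_minus (u v : C) : Cmod (u - v) <= Cmod u + Cmod v.
Proof.
  eapply Rle_trans; [apply Cmod_triangle|]. rewrite Cmod_opp. lra.
Qed.

Lemma Cmod_reverse_triangle (u v : C) : Cmod u - Cmod v <= Cmod (u - v).
Proof.
  assert (H := Cmod_triangle (u - v) v).
  replace (u - v + v)%C with u in H by ring. lra.
Qed.

Lemma Cmod_sqr (z : C) : Cmod z ^ 2 = fst z ^ 2 + snd z ^ 2.
Proof. apply Cmod2_alt. Qed.

Lemma Cmod_lt_sqr (z : C) (r : R) : Cmod z < r -> fst z ^ 2 + snd z ^ 2 < r ^ 2.
Proof.
  intros H. rewrite <- Cmod_sqr. assert (H0 := Cmod_ge_0 z). nra.
Qed.

(** The increment form has no quotient, so t = 0 needs no exception, and the same estimates serve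
    for curves ([rderiv_eps]). *)
Definition cdiff (F : C -> C) (z d : C) : Prop :=
  forall eps, 0 < eps -> exists del, 0 < del /\
    forall t, Cmod t < del -> Cmod (F (z + t) - F z - d * t)%C <= eps * Cmod t.

Definition ccont (F : C -> C) (z : C) : Prop :=
  forall eps, 0 < eps -> exists del, 0 < del /\
    forall t, Cmod t < del -> Cmod (F (z + t) - F z)%C < eps.

Lemma cdiff_ccont F z d : cdiff F z d -> ccont F z.
Proof.
  intros H eps He.
  destruct (H 1 Rlt_0_1) as [del [Hd Ht]].
  assert (Hd0 := Cmod_ge_0 d).
  exists (Rmin del (eps / (2 + Cmod d))). split.
  - apply Rmin_pos; auto. apply Rdiv_lt_0_compat; lra.
  - intros t Hlt.
    assert (H1 : Cmod t < del) by (eapply Rlt_le_trans; [exact Hlt|apply Rmin_l]).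
    assert (H2 : Cmod t < eps / (2 + Cmod d)) by (eapply Rlt_le_trans; [exact Hlt|apply Rmin_r]).
    specialize (Ht t H1).
    assert (H3 := Cmod_triangle (F (z + t) - F z - d * t)%C (d * t)%C).
    replace (F (z + t) - F z - d * t + d * t)%C with (F (z + t) - F z)%C in H3 by ring.
    rewrite Cmod_mult in H3.
    apply Rlt_div_r in H2; [|lra].
    assert (H4 := Cmod_ge_0 t). nra.
Qed.

Lemma ccont_const c z : ccont (fun _ => c) z.
Proof.
  intros eps He. exists 1. split; [lra|]. intros t _.
  replace (c - c)%C with (RtoC 0) by ring. rewrite Cmod_0. exact He.
Qed.

Lemma cdiff_const c z : cdiff (fun _ => c) z 0.
Proof.
  intros eps He. exists 1. split; [lra|]. intros t _.
  replace (c - c - 0 * t)%C with (RtoC 0) by ring. rewrite Cmod_0.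
  assert (H := Cmod_ge_0 t). nra.
Qed.

Lemma cdiff_id z : cdiff (fun w => w) z 1.
Proof.
  intros eps He. exists 1. split; [lra|]. intros t _.
  replace (z + t - z - 1 * t)%C with (RtoC 0) by ring. rewrite Cmod_0.
  assert (H := Cmod_ge_0 t). nra.
Qed.

Lemma cdiff_plus F G z d e : cdiff F z d -> cdiff G z e ->
  cdiff (fun w => F w + G w)%C z (d + e)%C.
Proof.
  intros HF HG eps He.
  destruct (HF (eps / 2)) as [d1 [Hd1 H1]]; [lra|].
  destruct (HG (eps / 2)) as [d2 [Hd2 H2]]; [lra|].
  exists (Rmin d1 d2). split; [apply Rmin_pos; auto|].
  intros t Ht.
  specialize (H1 t (Rlt_le_trans _ _ _ Ht (Rmin_l _ _))).
  specialize (H2 t (Rlt_le_trans _ _ _ Ht (Rmin_r _ _))).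
  replace (F (z + t) + G (z + t) - (F z + G z) - (d + e) * t)%C
    with ((F (z + t) - F z - d * t) + (G (z + t) - G z - e * t))%C by ring.
  eapply Rle_trans; [apply Cmod_triangle|]. lra.
Qed.

Lemma ccont_plus F G z : ccont F z -> ccont G z -> ccont (fun w => F w + G w)%C z.
Proof.
  intros HF HG eps He.
  destruct (HF (eps / 2)) as [d1 [Hd1 H1]]; [lra|].
  destruct (HG (eps / 2)) as [d2 [Hd2 H2]]; [lra|].
  exists (Rmin d1 d2). split; [apply Rmin_pos; auto|].
  intros t Ht.
  specialize (H1 t (Rlt_le_trans _ _ _ Ht (Rmin_l _ _))).
  specialize (H2 t (Rlt_le_trans _ _ _ Ht (Rmin_r _ _))).
  replace (F (z + t) + G (z + t) - (F z + G z))%C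
    with ((F (z + t) - F z) + (G (z + t) - G z))%C by ring.
  eapply Rle_lt_trans; [apply Cmod_triangle|]. lra.
Qed.

Lemma ccont_mult F G z : ccont F z -> ccont G z -> ccont (fun w => F w * G w)%C z.
Proof.
  intros HF HG eps He.
  assert (Fz := Cmod_ge_0 (F z)). assert (Gz := Cmod_ge_0 (G z)).
  set (M := 1 + Cmod (F z) + Cmod (G z)).
  assert (HM : 1 <= M) by (unfold M; lra).
  set (e := Rmin 1 (eps / (2 * M))).
  assert (He0 : 0 < e).
  { apply Rmin_pos; [lra|]. apply Rdiv_lt_0_compat; lra. }
  destruct (HF e He0) as [d1 [Hd1 H1]].
  destruct (HG e He0) as [d2 [Hd2 H2]].
  exists (Rmin d1 d2). split; [apply Rmin_pos; auto|].
  intros t Ht.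
  specialize (H1 t (Rlt_le_trans _ _ _ Ht (Rmin_l _ _))).
  specialize (H2 t (Rlt_le_trans _ _ _ Ht (Rmin_r _ _))).
  replace (F (z + t) * G (z + t) - F z * G z)%C
    with ((F (z + t) - F z) * (G (z + t) - G z) + F z * (G (z + t) - G z)
          + G z * (F (z + t) - F z))%C by ring.
  eapply Rle_lt_trans; [apply Cmod_triangle|].
  eapply Rle_lt_trans; [apply Rplus_le_compat_r; apply Cmod_triangle|].
  rewrite !Cmod_mult.
  set (A := Cmod (F (z + t) - F z)%C) in *. set (B := Cmod (G (z + t) - G z)%C) in *.
  assert (HA : 0 <= A) by apply Cmod_ge_0. assert (HB : 0 <= B) by apply Cmod_ge_0.
  assert (E1 : e <= 1) by apply Rmin_l.
  assert (E2 : e <= eps / (2 * M)) by apply Rmin_r.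
  apply Rle_div_r in E2; [|lra].
  assert (A * B <= e * 1) by nra.
  assert (Cmod (F z) * B <= Cmod (F z) * e) by nra.
  assert (Cmod (G z) * A <= Cmod (G z) * e) by nra.
  assert (e * M = e + e * Cmod (F z) + e * Cmod (G z)) by (unfold M; ring).
  nra.
Qed.

Lemma ccont_ext F G z : (exists r, 0 < r /\ forall t, Cmod t < r -> F (z + t)%C = G (z + t)%C) ->
  ccont F z -> ccont G z.
Proof.
  intros [r [Hr HE]] HF eps He. destruct (HF eps He) as [d [Hd H]].
  exists (Rmin d r). split; [apply Rmin_pos; auto|].
  intros t Ht.
  assert (H0 : F z = G z).
  { rewrite <- (Cplus_0_r z). apply HE. rewrite Cmod_0. exact Hr. }
  rewrite <- H0, <- (HE t (Rlt_le_trans _ _ _ Ht (Rmin_r _ _))).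
  apply H. exact (Rlt_le_trans _ _ _ Ht (Rmin_l _ _)).
Qed.

Lemma cdiff_ext F G z d : (exists r, 0 < r /\ forall t, Cmod t < r -> F (z + t)%C = G (z + t)%C) ->
  cdiff F z d -> cdiff G z d.
Proof.
  intros [r [Hr HE]] HF eps He. destruct (HF eps He) as [dl [Hd H]].
  exists (Rmin dl r). split; [apply Rmin_pos; auto|].
  intros t Ht.
  assert (H0 : F z = G z).
  { rewrite <- (Cplus_0_r z). apply HE. rewrite Cmod_0. exact Hr. }
  rewrite <- H0, <- (HE t (Rlt_le_trans _ _ _ Ht (Rmin_r _ _))).
  apply H. exact (Rlt_le_trans _ _ _ Ht (Rmin_l _ _)).
Qed.

Lemma ccont_comp F G z : ccont G z -> ccont F (G z) -> ccont (fun w => F (G w)) z.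
Proof.
  intros HG HF eps He.
  destruct (HF eps He) as [d1 [Hd1 H1]].
  destruct (HG d1 Hd1) as [d2 [Hd2 H2]].
  exists d2. split; auto. intros t Ht.
  specialize (H1 (G (z + t) - G z)%C (H2 t Ht)).
  replace (G z + (G (z + t) - G z))%C with (G (z + t)%C) in H1 by ring.
  exact H1.
Qed.

Lemma cdiff_bound F z d : cdiff F z d -> exists del, 0 < del /\
  forall t, Cmod t < del -> Cmod (F (z + t) - F z)%C <= (1 + Cmod d) * Cmod t.
Proof.
  intros H. destruct (H 1 Rlt_0_1) as [del [Hd Ht]]. exists del. split; auto.
  intros t Hlt. specialize (Ht t Hlt).
  assert (H3 := Cmod_triangle (F (z + t) - F z - d * t)%C (d * t)%C).
  replace (F (z + t) - F z - d * t + d * t)%C with (F (z + t) - F z)%C in H3 by ring.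
  rewrite Cmod_mult in H3. lra.
Qed.

Lemma cdiff_comp F G z d e : cdiff G z e -> cdiff F (G z) d ->
  cdiff (fun w => F (G w)) z (d * e)%C.
Proof.
  intros HG HF eps He.
  assert (Hd0 := Cmod_ge_0 d). assert (He0 := Cmod_ge_0 e).
  destruct (cdiff_bound _ _ _ HG) as [b [Hb Bd]].
  destruct (HF (eps / (2 * (1 + Cmod e)))) as [d1 [Hd1 H1]].
  { apply Rdiv_lt_0_compat; lra. }
  destruct (HG (eps / (2 * (1 + Cmod d)))) as [d2 [Hd2 H2]].
  { apply Rdiv_lt_0_compat; lra. }
  exists (Rmin b (Rmin d2 (d1 / (1 + Cmod e)))). split.
  { repeat apply Rmin_pos; auto. apply Rdiv_lt_0_compat; lra. }
  intros t Ht.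
  assert (T1 := Rlt_le_trans _ _ _ Ht (Rmin_l _ _)).
  assert (T2 := Rlt_le_trans _ _ _ (Rlt_le_trans _ _ _ Ht (Rmin_r _ _)) (Rmin_l _ _)).
  assert (T3 := Rlt_le_trans _ _ _ (Rlt_le_trans _ _ _ Ht (Rmin_r _ _)) (Rmin_r _ _)).
  specialize (Bd t T1). specialize (H2 t T2).
  apply Rlt_div_r in T3; [|lra].
  assert (L : Cmod (G (z + t) - G z)%C < d1) by lra.
  specialize (H1 _ L).
  replace (G z + (G (z + t) - G z))%C with (G (z + t)%C) in H1 by ring.
  replace (F (G (z + t)) - F (G z) - d * e * t)%C with
    ((F (G (z + t)) - F (G z) - d * (G (z + t) - G z)) + d * (G (z + t) - G z - e * t))%C by ring.
  eapply Rle_trans; [apply Cmod_triangle|]. rewrite Cmod_mult.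
  assert (Tp := Cmod_ge_0 t).
  assert (X1 : eps / (2 * (1 + Cmod e)) * Cmod (G (z + t) - G z)%C <= eps / 2 * Cmod t).
  { replace (eps / 2 * Cmod t) with (eps / (2 * (1 + Cmod e)) * ((1 + Cmod e) * Cmod t)) by (field; lra).
    apply Rmult_le_compat_l; auto. apply Rlt_le, Rdiv_lt_0_compat; lra. }
  assert (X2 : Cmod d * Cmod (G (z + t) - G z - e * t)%C <= eps / 2 * Cmod t).
  { apply Rle_trans with ((1 + Cmod d) * (eps / (2 * (1 + Cmod d)) * Cmod t)).
    - apply Rmult_le_compat; auto; try lra. apply Cmod_ge_0.
    - right. field. lra. }
  lra.
Qed.

Lemma cdiff_mult F G z d e : cdiff F z d -> cdiff G z e ->
  cdiff (fun w => F w * G w)%C z (d * G z + F z * e)%C.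
Proof.
  intros HF HG eps He.
  assert (HGc := cdiff_ccont _ _ _ HG).
  destruct (cdiff_bound _ _ _ HF) as [b [Hb Bd]].
  assert (Hd0 := Cmod_ge_0 d). assert (Fz := Cmod_ge_0 (F z)). assert (Gz := Cmod_ge_0 (G z)).
  destruct (HF (eps / (3 * (1 + Cmod (G z))))) as [d1 [Hd1 H1]].
  { apply Rdiv_lt_0_compat; lra. }
  destruct (HG (eps / (3 * (1 + Cmod (F z))))) as [d2 [Hd2 H2]].
  { apply Rdiv_lt_0_compat; lra. }
  destruct (HGc (eps / (3 * (1 + Cmod d)))) as [d3 [Hd3 H3]].
  { apply Rdiv_lt_0_compat; lra. }
  exists (Rmin (Rmin b d1) (Rmin d2 d3)). split.
  { repeat apply Rmin_pos; auto. }
  intros t Ht.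
  assert (T1 := Rlt_le_trans _ _ _ (Rlt_le_trans _ _ _ Ht (Rmin_l _ _)) (Rmin_l _ _)).
  assert (T2 := Rlt_le_trans _ _ _ (Rlt_le_trans _ _ _ Ht (Rmin_l _ _)) (Rmin_r _ _)).
  assert (T3 := Rlt_le_trans _ _ _ (Rlt_le_trans _ _ _ Ht (Rmin_r _ _)) (Rmin_l _ _)).
  assert (T4 := Rlt_le_trans _ _ _ (Rlt_le_trans _ _ _ Ht (Rmin_r _ _)) (Rmin_r _ _)).
  specialize (Bd t T1). specialize (H1 t T2). specialize (H2 t T3). specialize (H3 t T4).
  replace (F (z + t) * G (z + t) - F z * G z - (d * G z + F z * e) * t)%C with
    ((F (z + t) - F z) * (G (z + t) - G z) + G z * (F (z + t) - F z - d * t)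
     + F z * (G (z + t) - G z - e * t))%C by ring.
  eapply Rle_trans; [apply Cmod_triangle|].
  eapply Rle_trans; [apply Rplus_le_compat_r; apply Cmod_triangle|].
  rewrite !Cmod_mult.
  assert (Tp := Cmod_ge_0 t).
  assert (X1 : Cmod (F (z + t) - F z)%C * Cmod (G (z + t) - G z)%C <= eps / 3 * Cmod t).
  { apply Rle_trans with (((1 + Cmod d) * Cmod t) * (eps / (3 * (1 + Cmod d)))).
    - apply Rmult_le_compat; auto using Cmod_ge_0. lra.
    - right. field. lra. }
  assert (X2 : Cmod (G z) * Cmod (F (z + t) - F z - d * t)%C <= eps / 3 * Cmod t).
  { apply Rle_trans with ((1 + Cmod (G z)) * (eps / (3 * (1 + Cmod (G z))) * Cmod t)).
    - apply Rmult_le_compat; auto using Cmod_ge_0; lra.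
    - right. field. lra. }
  assert (X3 : Cmod (F z) * Cmod (G (z + t) - G z - e * t)%C <= eps / 3 * Cmod t).
  { apply Rle_trans with ((1 + Cmod (F z)) * (eps / (3 * (1 + Cmod (F z))) * Cmod t)).
    - apply Rmult_le_compat; auto using Cmod_ge_0; lra.
    - right. field. lra. }
  lra.
Qed.

Lemma Cmod_near_nonzero (z t : C) : Cmod t <= Cmod z / 2 -> Cmod z / 2 <= Cmod (z + t).
Proof.
  intros H. assert (H1 := Cmod_reverse_triangle z (- t)). rewrite Cmod_opp in H1.
  replace (z - - t)%C with (z + t)%C in H1 by ring. lra.
Qed.

Lemma cdiff_inv (z : C) : z <> 0 -> cdiff (fun w => / w)%C z (- / (z * z))%C.
Proof.
  intros Hz eps He.
  assert (Hm := proj1 (Cmod_gt_0 z) Hz).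
  (* The remainder is exactly t^2 / ((z + t) z^2), at most 2 |t|^2 / |z|^3 once |t| <= |z| / 2. *)
  exists (Rmin (Cmod z / 2) (eps * Cmod z ^ 3 / 2)). split.
  { apply Rmin_pos; [lra|]. assert (0 < Cmod z ^ 3) by (apply pow_lt; auto). nra. }
  intros t Ht.
  assert (T1 := Rlt_le_trans _ _ _ Ht (Rmin_l _ _)).
  assert (T2 := Rlt_le_trans _ _ _ Ht (Rmin_r _ _)).
  assert (N := Cmod_near_nonzero z t (Rlt_le _ _ T1)).
  assert (Hzt : (z + t)%C <> 0).
  { intros E. rewrite E, Cmod_0 in N. lra. }
  replace (/ (z + t) - / z - - / (z * z) * t)%C with (t * t / ((z + t) * (z * z)))%C
    by (field; auto).
  rewrite Cmod_div, !Cmod_mult.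
  2: { apply Cmult_neq_0; auto. apply Cmult_neq_0; auto. }
  assert (Tp := Cmod_ge_0 t).
  apply Rle_div_l. { apply Rmult_lt_0_compat; nra. }
  apply Rle_trans with ((eps * Cmod z ^ 3 / 2) * Cmod t); [nra|].
  replace (eps * Cmod z ^ 3 / 2 * Cmod t) with (eps * Cmod t * ((Cmod z / 2) * (Cmod z * Cmod z))) by (simpl; field).
  apply Rmult_le_compat_l; [nra|]. apply Rmult_le_compat_r; nra.
Qed.

(** Continuity of the derivative is part of the notion: it lets circle means be differentiated under
    the integral sign and F' be integrated along a circle. *)
Definition holo (U : C -> Prop) (F : C -> C) : Prop :=
  exists F' : C -> C, forall z, U z -> cdiff F z (F' z) /\ ccont F' z.

Lemma holo_const U c : holo U (fun _ => c).
Proof. exists (fun _ => RtoC 0). intros z _. split; [apply cdiff_const|apply ccont_const]. Qed.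

Lemma holo_id U : holo U (fun z => z).
Proof. exists (fun _ => RtoC 1). intros z _. split; [apply cdiff_id|apply ccont_const]. Qed.

Lemma holo_plus U F G : holo U F -> holo U G -> holo U (fun z => F z + G z)%C.
Proof.
  intros [F' HF] [G' HG]. exists (fun z => F' z + G' z)%C. intros z Hz.
  destruct (HF z Hz), (HG z Hz). split; [apply cdiff_plus|apply ccont_plus]; auto.
Qed.

Lemma holo_mult U F G : holo U F -> holo U G -> holo U (fun z => F z * G z)%C.
Proof.
  intros [F' HF] [G' HG]. exists (fun z => F' z * G z + F z * G' z)%C. intros z Hz.
  destruct (HF z Hz), (HG z Hz). split; [apply cdiff_mult; auto|].
  apply ccont_plus; apply ccont_mult; eauto using cdiff_ccont.
Qed.

Lemma holo_comp (U V : C -> Prop) F G : holo U G -> holo V F -> (forall z, U z -> V (G z)) ->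
  holo U (fun z => F (G z)).
Proof.
  intros [G' HG] [F' HF] HUV. exists (fun z => F' (G z) * G' z)%C. intros z Hz.
  destruct (HG z Hz), (HF _ (HUV z Hz)). split; [apply cdiff_comp; auto|].
  apply ccont_mult; auto. apply ccont_comp; eauto using cdiff_ccont.
Qed.

Lemma ccont_inv F z : ccont F z -> F z <> 0 -> ccont (fun w => / F w)%C z.
Proof.
  intros H Hz. apply ccont_comp; auto.
  eapply cdiff_ccont, cdiff_inv; auto.
Qed.

Lemma holo_inv U F : holo U F -> (forall z, U z -> F z <> 0) -> holo U (fun z => / F z)%C.
Proof.
  intros [F' HF] Hn. exists (fun z => - / (F z * F z) * F' z)%C. intros z Hz.
  destruct (HF z Hz) as [H1 H2]. split.
  - apply (cdiff_comp (fun w => / w)%C); auto. apply cdiff_inv; auto.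
  - apply ccont_mult; auto.
    apply ccont_ext with (fun w => (RtoC (-1)) * / (F w * F w))%C.
    { exists 1. split; [lra|]. intros. ring. }
    apply ccont_mult; [apply ccont_const|]. apply ccont_inv.
    + apply ccont_mult; eapply cdiff_ccont; eauto.
    + apply Cmult_neq_0; auto.
Qed.

Lemma holo_minus U F G : holo U F -> holo U G -> holo U (fun z => F z - G z)%C.
Proof.
  intros HF HG. assert (H := holo_plus _ _ _ HF (holo_mult _ _ _ (holo_const U (RtoC (-1))) HG)).
  destruct H as [F' H]. exists F'. intros z Hz. destruct (H z Hz). split; auto.
  eapply cdiff_ext; eauto. exists 1. split; [lra|]. intros. ring.
Qed.

Lemma holo_sub (U V : C -> Prop) F : (forall z, U z -> V z) -> holo V F -> holo U F.
Proof. intros H [F' HF]. exists F'. auto. Qed.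

Lemma holo_ccont U F z : holo U F -> U z -> ccont F z.
Proof. intros [F' HF] Hz. destruct (HF z Hz). eapply cdiff_ccont; eauto. Qed.

(** Components are differentiated separately so that the real mean value theorem and real integrals
    apply. *)
Definition rderiv (g : R -> C) (t : R) (d : C) : Prop :=
  is_derive (fun s => fst (g s)) t (fst d) /\ is_derive (fun s => snd (g s)) t (snd d).

Lemma is_derive_eps (f : R -> R) (x l : R) : is_derive f x l <->
  (forall eps, 0 < eps -> exists del, 0 < del /\
     forall s, Rabs s < del -> Rabs (f (x + s) - f x - l * s) <= eps * Rabs s).
Proof.
  rewrite is_derive_Reals. split.
  - intros H eps He. destruct (H eps He) as [del Hd]. exists del. split; [apply cond_pos|].
    intros s Hs. destruct (Req_dec s 0) as [->|Hn].
    + rewrite Rplus_0_r. replace (f x - f x - l * 0) with 0 by ring. rewrite Rabs_R0. lra.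
    + specialize (Hd s Hn Hs).
      replace (f (x + s) - f x - l * s) with (((f (x + s) - f x) / s - l) * s) by (field; auto).
      rewrite Rabs_mult. apply Rmult_le_compat_r; [apply Rabs_pos|lra].
  - intros H eps He. destruct (H (eps / 2)) as [del [Hd Hs]]; [lra|].
    exists (mkposreal del Hd). simpl. intros h Hh Hlt. specialize (Hs h Hlt).
    replace ((f (x + h) - f x) / h - l) with ((f (x + h) - f x - l * h) / h) by (field; auto).
    unfold Rdiv. rewrite Rabs_mult, Rabs_inv.
    assert (0 < Rabs h) by (apply Rabs_pos_lt; auto).
    apply Rle_lt_trans with (eps / 2); [|lra].
    apply Rle_div_l; auto.
Qed.

Lemma rderiv_eps g t d : rderiv g t d <->
  (forall eps, 0 < eps -> exists del, 0 < del /\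
     forall s, Rabs s < del -> Cmod (g (t + s)%R - g t - d * s)%C <= eps * Rabs s).
Proof.
  unfold rderiv. rewrite !is_derive_eps. split.
  - intros [H1 H2] eps He.
    destruct (H1 (eps / 2)) as [d1 [Hd1 K1]]; [lra|].
    destruct (H2 (eps / 2)) as [d2 [Hd2 K2]]; [lra|].
    exists (Rmin d1 d2). split; [apply Rmin_pos; auto|]. intros s Hs.
    specialize (K1 s (Rlt_le_trans _ _ _ Hs (Rmin_l _ _))).
    specialize (K2 s (Rlt_le_trans _ _ _ Hs (Rmin_r _ _))).
    eapply Rle_trans; [apply Cmod_le_abs|].
    simpl in *.
    match goal with |- Rabs ?a + Rabs ?b <= _ =>
      replace a with (fst (g (t + s)) - fst (g t) - fst d * s) by ring;
      replace b with (snd (g (t + s)) - snd (g t) - snd d * s) by ring end.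
    lra.
  - intros H. split; intros eps He; destruct (H eps He) as [del [Hd K]]; exists del; split; auto;
      intros s Hs; specialize (K s Hs); eapply Rle_trans; [|exact K| |exact K].
    + eapply Rle_trans; [|apply re_le_Cmod]. right. f_equal. unfold Re. simpl. ring.
    + eapply Rle_trans; [|apply im_le_Cmod]. right. f_equal. simpl. ring.
Qed.

Lemma rderiv_comp F g t d e : rderiv g t e -> cdiff F (g t) d ->
  rderiv (fun s => F (g s)) t (d * e)%C.
Proof.
  rewrite !rderiv_eps. intros HG HF eps He.
  assert (Hd0 := Cmod_ge_0 d). assert (He0 := Cmod_ge_0 e).
  destruct (HG 1 Rlt_0_1) as [b [Hb Bd0]].
  assert (Bd : forall s, Rabs s < b -> Cmod (g (t + s)%R - g t)%C <= (1 + Cmod e) * Rabs s).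
  { intros s Hs. specialize (Bd0 s Hs).
    assert (H3 := Cmod_triangle (g (t + s)%R - g t - e * s) (e * s)).
    replace (g (t + s)%R - g t - e * s + e * s)%C with (g (t + s)%R - g t)%C in H3 by ring.
    rewrite Cmod_mult, Cmod_R in H3. lra. }
  destruct (HF (eps / (2 * (1 + Cmod e)))) as [d1 [Hd1 H1]].
  { apply Rdiv_lt_0_compat; lra. }
  destruct (HG (eps / (2 * (1 + Cmod d)))) as [d2 [Hd2 H2]].
  { apply Rdiv_lt_0_compat; lra. }
  exists (Rmin b (Rmin d2 (d1 / (1 + Cmod e)))). split.
  { repeat apply Rmin_pos; auto. apply Rdiv_lt_0_compat; lra. }
  intros s Ht.
  assert (T1 := Rlt_le_trans _ _ _ Ht (Rmin_l _ _)).
  assert (T2 := Rlt_le_trans _ _ _ (Rlt_le_trans _ _ _ Ht (Rmin_r _ _)) (Rmin_l _ _)).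
  assert (T3 := Rlt_le_trans _ _ _ (Rlt_le_trans _ _ _ Ht (Rmin_r _ _)) (Rmin_r _ _)).
  specialize (Bd s T1). specialize (H2 s T2).
  apply Rlt_div_r in T3; [|lra].
  assert (L : Cmod (g (t + s)%R - g t) < d1) by lra.
  specialize (H1 _ L).
  replace (g t + (g (t + s)%R - g t))%C with (g (t + s)%R) in H1 by ring.
  replace (F (g (t + s)%R) - F (g t) - d * e * s)%C with
    ((F (g (t + s)%R) - F (g t) - d * (g (t + s)%R - g t)) + d * (g (t + s)%R - g t - e * s))%C by ring.
  eapply Rle_trans; [apply Cmod_triangle|]. rewrite Cmod_mult.
  assert (Tp := Rabs_pos s).
  assert (X1 : eps / (2 * (1 + Cmod e)) * Cmod (g (t + s)%R - g t) <= eps / 2 * Rabs s).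
  { replace (eps / 2 * Rabs s) with (eps / (2 * (1 + Cmod e)) * ((1 + Cmod e) * Rabs s)) by (field; lra).
    apply Rmult_le_compat_l; auto. apply Rlt_le, Rdiv_lt_0_compat; lra. }
  assert (X2 : Cmod d * Cmod (g (t + s)%R - g t - e * s) <= eps / 2 * Rabs s).
  { apply Rle_trans with ((1 + Cmod d) * (eps / (2 * (1 + Cmod d)) * Rabs s)).
    - apply Rmult_le_compat; auto; try lra. apply Cmod_ge_0.
    - right. field. lra. }
  lra.
Qed.

Definition cexp (z : C) : C := (exp (fst z) * cos (snd z), exp (fst z) * sin (snd z)).
Definition cis (t : R) : C := (cos t, sin t).

Lemma Cmod_cis t : Cmod (cis t) = 1.
Proof.
  unfold Cmod, cis. simpl. assert (H := sin2_cos2 t). unfold Rsqr in H.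
  replace (cos t * (cos t * 1) + sin t * (sin t * 1)) with 1 by lra. apply sqrt_1.
Qed.

Lemma cis_plus a b : cis (a + b) = (cis a * cis b)%C.
Proof. apply C_eq; simpl; [rewrite cos_plus|rewrite sin_plus]; ring. Qed.

Lemma rderiv_cis t : rderiv cis t (Ci * cis t)%C.
Proof.
  split; simpl.
  - eapply is_derive_ext; [reflexivity|]. replace (0 * cos t - 1 * sin t) with (- sin t) by ring. apply is_derive_cos.
  - replace (0 * sin t + 1 * cos t) with (cos t) by ring. apply is_derive_sin.
Qed.

Lemma rderiv_cexp g t d : rderiv g t d -> rderiv (fun s => cexp (g s)) t (d * cexp (g t))%C.
Proof.
  intros [H1 H2].
  assert (K1 : is_derive (fun s => exp (fst (g s))) t (fst d * exp (fst (g t)))).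
  { apply (is_derive_comp exp (fun s => fst (g s))); auto. apply is_derive_exp. }
  assert (K2 : is_derive (fun s => cos (snd (g s))) t (snd d * - sin (snd (g t)))).
  { apply (is_derive_comp cos (fun s => snd (g s))); auto. apply is_derive_cos. }
  assert (K3 : is_derive (fun s => sin (snd (g s))) t (snd d * cos (snd (g t)))).
  { apply (is_derive_comp sin (fun s => snd (g s))); auto. apply is_derive_sin. }
  split; unfold cexp; simpl.
  - replace (fst d * (exp (fst (g t)) * cos (snd (g t))) - snd d * (exp (fst (g t)) * sin (snd (g t))))
      with (fst d * exp (fst (g t)) * cos (snd (g t)) + exp (fst (g t)) * (snd d * - sin (snd (g t)))) by ring.
    apply (is_derive_mult (fun s => exp (fst (g s))) (fun s => cos (snd (g s)))); auto. intros; apply Rmult_comm.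
  - replace (fst d * (exp (fst (g t)) * sin (snd (g t))) + snd d * (exp (fst (g t)) * cos (snd (g t))))
      with (fst d * exp (fst (g t)) * sin (snd (g t)) + exp (fst (g t)) * (snd d * cos (snd (g t)))) by ring.
    apply (is_derive_mult (fun s => exp (fst (g s))) (fun s => sin (snd (g s)))); auto. intros; apply Rmult_comm.
Qed.

Lemma rderiv_mult g h t d e : rderiv g t d -> rderiv h t e ->
  rderiv (fun s => g s * h s)%C t (d * h t + g t * e)%C.
Proof.
  intros [H1 H2] [K1 K2]. split; simpl.
  - replace (fst d * fst (h t) - snd d * snd (h t) + (fst (g t) * fst e - snd (g t) * snd e)) with
      ((fst d * fst (h t) + fst (g t) * fst e) - (snd d * snd (h t) + snd (g t) * snd e)) by ring.
    apply (is_derive_minus (fun s => fst (g s) * fst (h s)) (fun s => snd (g s) * snd (h s)));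
    [apply (is_derive_mult (fun s => fst (g s)) (fun s => fst (h s)))
    |apply (is_derive_mult (fun s => snd (g s)) (fun s => snd (h s)))]; auto; intros; apply Rmult_comm.
  - replace (fst d * snd (h t) + snd d * fst (h t) + (fst (g t) * snd e + snd (g t) * fst e)) with
      ((fst d * snd (h t) + fst (g t) * snd e) + (snd d * fst (h t) + snd (g t) * fst e)) by ring.
    apply (is_derive_plus (fun s => fst (g s) * snd (h s)) (fun s => snd (g s) * fst (h s)));
    [apply (is_derive_mult (fun s => fst (g s)) (fun s => snd (h s)))
    |apply (is_derive_mult (fun s => snd (g s)) (fun s => fst (h s)))]; auto; intros; apply Rmult_comm.
Qed.

Lemma rderiv_plus g h t d e : rderiv g t d -> rderiv h t e ->
  rderiv (fun s => g s + h s)%C t (d + e)%C.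
Proof.
  intros [H1 H2] [K1 K2]. split; simpl.
  - apply (is_derive_plus (fun s => fst (g s)) (fun s => fst (h s))); auto.
  - apply (is_derive_plus (fun s => snd (g s)) (fun s => snd (h s))); auto.
Qed.

Lemma rderiv_const c t : rderiv (fun _ => c) t 0.
Proof. split; simpl; apply @is_derive_const. Qed.

Lemma rderiv_line w t : rderiv (fun s => RtoC s * w)%C t w.
Proof.
  split; simpl; auto_derive; auto; ring.
Qed.

Lemma is_derive_zero_const (f : R -> R) a b : a <= b ->
  (forall t, a <= t <= b -> is_derive f t 0) -> f a = f b.
Proof.
  intros Hab Hf. destruct (MVT_gen f a b (fun _ => 0)) as [c [_ Hc]].
  - intros x. rewrite Rmin_left, Rmax_right by auto. intros. apply Hf. lra.
  - intros x. rewrite Rmin_left, Rmax_right by auto. intros Hx.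
    apply derivable_continuous_pt. exists 0. apply is_derive_Reals, Hf; auto.
  - lra.
Qed.

Lemma rderiv_zero_const g a b : a <= b -> (forall t, a <= t <= b -> rderiv g t 0) -> g a = g b.
Proof.
  intros Hab H.
  apply C_eq; apply (is_derive_zero_const (fun t => _ (g t))); auto; intros t Ht; apply H; auto.
Qed.

(** * Complex power series on the unit disk *)

Definition summable (s : nat -> C) : Prop := ex_series (fun n => Cmod (s n)).
Definition Csum (s : nat -> C) : C :=
  (Series (fun n => fst (s n)), Series (fun n => snd (s n))).

Lemma summable_fst s : summable s -> ex_series (fun n => Rabs (fst (s n))).
Proof.
  intros H. apply (@ex_series_le R_AbsRing R_CompleteNormedModule _ (fun n => Cmod (s n))); auto.
  intros n. unfold norm; simpl. unfold abs; simpl. rewrite Rabs_Rabsolu. apply (re_le_Cmod (s n)).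
Qed.

Lemma summable_snd s : summable s -> ex_series (fun n => Rabs (snd (s n))).
Proof.
  intros H. apply (@ex_series_le R_AbsRing R_CompleteNormedModule _ (fun n => Cmod (s n))); auto.
  intros n. unfold norm; simpl. unfold abs; simpl. rewrite Rabs_Rabsolu. apply (im_le_Cmod (s n)).
Qed.

Lemma summable_re s : summable s -> ex_series (fun n => fst (s n)).
Proof. intros H. apply ex_series_Rabs, summable_fst, H. Qed.

Lemma summable_im s : summable s -> ex_series (fun n => snd (s n)).
Proof. intros H. apply ex_series_Rabs, summable_snd, H. Qed.

Lemma summable_le s (u : nat -> R) : (forall n, Cmod (s n) <= u n) -> ex_series u -> summable s.
Proof.
  intros H Hu. apply (@ex_series_le R_AbsRing R_CompleteNormedModule _ u); auto.
  intros n. unfold norm; simpl. unfold abs; simpl. rewrite Rabs_pos_eq; auto. apply Cmod_ge_0.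
Qed.

Lemma Csum_ext s t : (forall n, s n = t n) -> Csum s = Csum t.
Proof. intros H. apply C_eq; simpl; apply Series_ext; intros n; rewrite H; auto. Qed.

Lemma summable_ext s t : (forall n, s n = t n) -> summable s -> summable t.
Proof. intros H. apply ex_series_ext. intros n. rewrite H. reflexivity. Qed.

Lemma summable_plus s t : summable s -> summable t -> summable (fun n => s n + t n)%C.
Proof.
  intros Hs Ht. apply summable_le with (fun n => Cmod (s n) + Cmod (t n)).
  - intros n. apply Cmod_triangle.
  - apply (@ex_series_plus R_AbsRing R_NormedModule); auto.
Qed.

Lemma summable_scal c s : summable s -> summable (fun n => c * s n)%C.
Proof.
  intros Hs. apply summable_le with (fun n => Cmod c * Cmod (s n)).
  - intros n. rewrite Cmod_mult. lra.
  - apply (@ex_series_scal R_AbsRing R_NormedModule); auto.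
Qed.

Lemma Csum_plus s t : summable s -> summable t ->
  Csum (fun n => s n + t n)%C = (Csum s + Csum t)%C.
Proof.
  intros Hs Ht. apply C_eq; simpl.
  - apply Series_plus; apply summable_re; auto.
  - apply Series_plus; apply summable_im; auto.
Qed.

Lemma Csum_scal c s : summable s -> Csum (fun n => c * s n)%C = (c * Csum s)%C.
Proof.
  intros Hs. apply C_eq; simpl.
  - rewrite <- !Series_scal_l, <- Series_minus; auto.
    + apply (@ex_series_scal R_AbsRing R_NormedModule (fst c)), summable_re, Hs.
    + apply (@ex_series_scal R_AbsRing R_NormedModule (snd c)), summable_im, Hs.
  - rewrite <- !Series_scal_l, <- Series_plus; auto.
    + apply (@ex_series_scal R_AbsRing R_NormedModule (fst c)), summable_im, Hs.
    + apply (@ex_series_scal R_AbsRing R_NormedModule (snd c)), summable_re, Hs.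
Qed.

Lemma Csum_minus s t : summable s -> summable t ->
  Csum (fun n => s n - t n)%C = (Csum s - Csum t)%C.
Proof.
  intros Hs Ht.
  rewrite (Csum_ext _ (fun n => s n + (RtoC (-1)) * t n)%C) by (intros; ring).
  rewrite Csum_plus, Csum_scal; auto using summable_scal. ring.
Qed.

Lemma Csum_incr s : summable s -> Csum s = (s O + Csum (fun n => s (S n)))%C.
Proof.
  intros Hs. apply C_eq; simpl.
  - apply Series_incr_1, summable_re, Hs.
  - apply Series_incr_1, summable_im, Hs.
Qed.

Lemma summable_incr s : summable s -> summable (fun n => s (S n)).
Proof. intros H. apply (ex_series_incr_1 (fun n => Cmod (s n))). exact H. Qed.

(** With S the sum, |S|^2 = Re (conj S S) is the sum of the reals Re (conj S s_n), each at most |S|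
    |s_n|; division by |S| leaves the claim. *)
Lemma Cmod_Csum_le s : summable s -> Cmod (Csum s) <= Series (fun n => Cmod (s n)).
Proof.
  intros Hs.
  assert (S0 : 0 <= Series (fun n => Cmod (s n))).
  { rewrite <- (Rmult_0_l (Series (fun n => Cmod (s n)))), <- Series_scal_l.
    apply Series_le; [|exact Hs]. intros n. assert (H := Cmod_ge_0 (s n)). lra. }
  destruct (Req_dec (Cmod (Csum s)) 0) as [->|Hn]; [exact S0|].
  assert (P : 0 < Cmod (Csum s)) by (assert (H := Cmod_ge_0 (Csum s)); lra).
  apply Rmult_le_reg_l with (Cmod (Csum s)); auto.
  replace (Cmod (Csum s) * Cmod (Csum s)) with (fst (Cconj (Csum s) * Csum s)%C).
  2: { rewrite <- (Rmult_1_r (Cmod (Csum s) * Cmod (Csum s))).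
       replace (Cmod (Csum s) * Cmod (Csum s) * 1) with (Cmod (Csum s) ^ 2) by ring.
       rewrite Cmod_sqr. simpl. ring. }
  rewrite <- Csum_scal by auto. simpl fst.
  rewrite <- Series_scal_l.
  eapply Rle_trans; [apply Rle_abs|].
  assert (Hc : summable (fun n => Cconj (Csum s) * s n)%C) by (apply summable_scal; auto).
  eapply Rle_trans; [apply Series_Rabs, (summable_fst _ Hc)|].
  apply Series_le.
  - intros n. split; [apply Rabs_pos|].
    eapply Rle_trans; [apply (re_le_Cmod (Cconj (Csum s) * s n)%C)|].
    rewrite Cmod_mult, Cmod_conj. lra.
  - apply (@ex_series_scal R_AbsRing R_NormedModule). exact Hs.
Qed.

Lemma Cmod_Csum_le' s (u : nat -> R) : (forall n, Cmod (s n) <= u n) -> ex_series u ->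
  Cmod (Csum s) <= Series u.
Proof.
  intros H Hu. eapply Rle_trans; [apply Cmod_Csum_le; eapply summable_le; eauto|].
  apply Series_le; auto. intros n. split; [apply Cmod_ge_0|apply H].
Qed.

Definition csumf (s : nat -> C) (n : nat) : C :=
  (sum_f_R0 (fun k => fst (s k)) n, sum_f_R0 (fun k => snd (s k)) n).

Lemma csumf_0 s : csumf s 0 = s O.
Proof. apply C_eq; reflexivity. Qed.

Lemma csumf_S s n : csumf s (S n) = (csumf s n + s (S n))%C.
Proof. apply C_eq; reflexivity. Qed.

Lemma csumf_ext s t n : (forall k, (k <= n)%nat -> s k = t k) -> csumf s n = csumf t n.
Proof.
  intros H. apply C_eq; simpl; apply sum_eq; intros k Hk; rewrite H; auto.
Qed.

Lemma csumf_scal c s n : csumf (fun k => c * s k)%C n = (c * csumf s n)%C.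
Proof.
  induction n as [|n IH]; [rewrite !csumf_0; auto|]. rewrite !csumf_S, IH. ring.
Qed.

Lemma Cmod_csumf_le s (u : nat -> R) n : (forall k, (k <= n)%nat -> Cmod (s k) <= u k) ->
  Cmod (csumf s n) <= sum_f_R0 u n.
Proof.
  induction n as [|n IH]; intros H.
  - rewrite csumf_0. simpl. auto.
  - rewrite csumf_S. eapply Rle_trans; [apply Cmod_triangle|]. simpl.
    apply Rplus_le_compat; auto.
Qed.

(** Four real Cauchy products of absolutely convergent series, one for each pair of components. *)
Lemma Csum_Cauchy_product s t : summable s -> summable t ->
  Csum (fun n => csumf (fun k => s k * t (n - k)%nat)%C n) = (Csum s * Csum t)%C.
Proof.
  intros Hs Ht.
  assert (M : forall f g : C -> R,
    (forall s, summable s -> ex_series (fun n => Rabs (f (s n)))) ->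
    (forall s, summable s -> ex_series (fun n => Rabs (g (s n)))) ->
    is_series (fun n => sum_f_R0 (fun k => f (s k) * g (t (n - k)%nat)) n)
      (Series (fun n => f (s n)) * Series (fun n => g (t n)))).
  { intros f g Hf Hg. apply (is_series_mult (fun n => f (s n)) (fun n => g (t n))); auto.
    - apply Series_correct, ex_series_Rabs; auto.
    - apply Series_correct, ex_series_Rabs; auto. }
  assert (M11 := M fst fst summable_fst summable_fst).
  assert (M12 := M fst snd summable_fst summable_snd).
  assert (M21 := M snd fst summable_snd summable_fst).
  assert (M22 := M snd snd summable_snd summable_snd).
  apply C_eq; simpl.
  - apply is_series_unique.
    apply (is_series_ext (fun n => sum_f_R0 (fun k => fst (s k) * fst (t (n - k)%nat)) n -
       sum_f_R0 (fun k => snd (s k) * snd (t (n - k)%nat)) n)).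
    + intros n. symmetry. apply minus_sum.
    + apply (@is_series_minus R_AbsRing R_NormedModule _ _ _ _ M11 M22).
  - apply is_series_unique.
    apply (is_series_ext (fun n => sum_f_R0 (fun k => fst (s k) * snd (t (n - k)%nat)) n +
       sum_f_R0 (fun k => snd (s k) * fst (t (n - k)%nat)) n)).
    + intros n. symmetry. apply plus_sum.
    + apply (@is_series_plus R_AbsRing R_NormedModule _ _ _ _ M12 M21).
Qed.

(** Radius of convergence at least 1, stated as boundedness of the terms for each r < 1. This passes
    through derivatives, primitives, shifts and divisions more easily than summability. *)
Definition rad1 (a : nat -> C) : Prop :=
  forall r, 0 <= r < 1 -> exists M, forall n, Cmod (a n) * r ^ n <= M.

Lemma rad1_ex_series a r : rad1 a -> 0 <= r < 1 -> ex_series (fun n => Cmod (a n) * r ^ n).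
Proof.
  intros Ha Hr. set (q := (1 + r) / 2).
  assert (Hq : 0 < q < 1 /\ r < q) by (unfold q; lra). destruct Hq as [Hq Hrq].
  destruct (Ha q) as [M HM]; [lra|].
  assert (HM0 : 0 <= M).
  { eapply Rle_trans; [|apply (HM O)]. simpl. assert (H := Cmod_ge_0 (a O)). lra. }
  apply (@ex_series_le R_AbsRing R_CompleteNormedModule _ (fun n => M * (r / q) ^ n)).
  - intros n. unfold norm; simpl. unfold abs; simpl. rewrite Rabs_pos_eq.
    + replace (r ^ n) with (q ^ n * (r / q) ^ n).
      2: { rewrite <- Rpow_mult_distr. f_equal. field. lra. }
      rewrite <- Rmult_assoc. apply Rmult_le_compat_r; auto.
      apply pow_le, Rdiv_le_0_compat; lra.
    + apply Rmult_le_pos; [apply Cmod_ge_0|apply pow_le; lra].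
  - apply (@ex_series_scal R_AbsRing R_NormedModule M), ex_series_geom.
    rewrite Rabs_pos_eq; [|apply Rdiv_le_0_compat; lra]. apply Rlt_div_l; lra.
Qed.

Definition PS (a : nat -> C) (z : C) : C := Csum (fun n => a n * z ^ n)%C.

Lemma PS_summable a z : rad1 a -> Cmod z < 1 -> summable (fun n => a n * z ^ n)%C.
Proof.
  intros Ha Hz. apply summable_le with (fun n => Cmod (a n) * Cmod z ^ n).
  - intros n. rewrite Cmod_mult, Cmod_pow. lra.
  - apply rad1_ex_series; auto. split; [apply Cmod_ge_0|auto].
Qed.

Lemma psum_comp a z N :
  psum a z N = (sum_n (fun n => fst (a n * z ^ n)%C) N, sum_n (fun n => snd (a n * z ^ n)%C) N).
Proof.
  assert (P : forall n, Defs.Cpow z n = (z ^ n)%C).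
  { induction n as [|n IH]; simpl; rewrite ?IH; reflexivity. }
  induction N as [|N IH].
  - rewrite !sum_O. reflexivity.
  - rewrite !sum_Sn.
    change (psum a z (S N)) with (Cadd (psum a z N) (Cmul (a (S N)) (Defs.Cpow z (S N)))).
    rewrite (P (S N)), IH. reflexivity.
Qed.

Lemma series_sum_iff a z s : series_sum a z s <->
  is_series (fun n => fst (a n * z ^ n)%C) (fst s) /\
  is_series (fun n => snd (a n * z ^ n)%C) (snd s).
Proof.
  unfold series_sum. rewrite <- !is_lim_seq_Reals.
  assert (E : forall u (l : R), is_series u l <-> is_lim_seq (sum_n u) l) by (intros; reflexivity).
  rewrite !E.
  split; intros [H1 H2]; (split; [eapply is_lim_seq_ext; [|exact H1]|eapply is_lim_seq_ext; [|exact H2]]);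
    intros n; simpl; rewrite psum_comp; reflexivity.
Qed.

Lemma series_sum_PS a z : rad1 a -> Cmod z < 1 -> series_sum a z (PS a z).
Proof.
  intros Ha Hz. apply series_sum_iff. assert (H := PS_summable a z Ha Hz).
  split; apply Series_correct; [apply summable_re|apply summable_im]; auto.
Qed.

Lemma series_sum_unique a z s : series_sum a z s -> s = PS a z.
Proof.
  intros H. apply series_sum_iff in H. destruct H as [H1 H2].
  apply C_eq; simpl; symmetry; apply is_series_unique; auto.
Qed.

(** Convergence at the single real point r already makes the terms of the series bounded there. *)
Lemma analytic_rad1 a : analytic_on_disk a -> rad1 a.
Proof.
  intros H r Hr.
  destruct (H (RtoC r)) as [s Hs].
  { red. change (Cmod (RtoC r) < 1). rewrite Cmod_R, Rabs_pos_eq; lra. }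
  apply series_sum_iff in Hs. destruct Hs as [H1 H2].
  assert (B : forall u : nat -> R, ex_series u -> exists M, forall n, Rabs (u n) <= M).
  { intros u Hu. apply ex_series_lim_0, is_lim_seq_Reals in Hu.
    destruct (maj_by_pos u) as [M [_ HM]]; eauto. }
  destruct (B _ (ex_intro _ _ H1)) as [M1 B1].
  destruct (B _ (ex_intro _ _ H2)) as [M2 B2].
  exists (M1 + M2). intros n.
  replace (Cmod (a n) * r ^ n) with (Cmod (a n * RtoC r ^ n)).
  - eapply Rle_trans; [apply Cmod_le_abs|]. apply Rplus_le_compat; auto.
  - rewrite Cmod_mult, Cmod_pow, Cmod_R, Rabs_pos_eq; lra.
Qed.

Lemma rad1_analytic a : rad1 a -> analytic_on_disk a.
Proof. intros Ha z Hz. exists (PS a z). apply series_sum_PS; auto. Qed.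

(** * Derivatives and primitives of power series *)

Definition pderiv (a : nat -> C) (n : nat) : C := (RtoC (INR (S n)) * a (S n))%C.
Definition pinteg (a : nat -> C) (n : nat) : C :=
  match n with O => RtoC 0 | S m => (a m / RtoC (INR (S m)))%C end.

Lemma RtoC_INR_neq n : RtoC (INR (S n)) <> 0.
Proof. intros H. apply RtoC_inj in H. revert H. apply not_0_INR. lia. Qed.

Lemma pderiv_pinteg a n : pderiv (pinteg a) n = a n.
Proof. unfold pderiv, pinteg. field. apply RtoC_INR_neq. Qed.

(** Each of the n + 1 terms of 1 + q + ... + q^n is at least q^n. *)
Lemma geom_weight q n : 0 <= q < 1 -> INR (S n) * q ^ n <= / (1 - q).
Proof.
  intros Hq. apply Rle_trans with (sum_f_R0 (fun k => q ^ k) n).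
  - induction n as [|n IH]; [simpl; lra|].
    rewrite tech5, S_INR.
    assert (P : 0 <= q ^ n) by (apply pow_le; lra).
    assert (q ^ S n <= q ^ n) by (simpl; nra).
    assert (INR (S n) * q ^ S n <= INR (S n) * q ^ n).
    { apply Rmult_le_compat_l; auto. apply pos_INR. }
    lra.
  - rewrite tech3 by lra. apply Rmult_le_reg_r with (1 - q); [lra|].
    unfold Rdiv. rewrite Rmult_assoc, Rinv_l by lra.
    assert (0 <= q ^ S n) by (apply pow_le; lra). lra.
Qed.

Lemma rad1_pderiv a : rad1 a -> rad1 (pderiv a).
Proof.
  intros Ha r Hr. set (q := (1 + r) / 2).
  assert (Hq : 0 < q < 1 /\ r < q) by (unfold q; lra). destruct Hq as [Hq Hrq].
  destruct (Ha q) as [M HM]; [lra|].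
  exists (M / q * / (1 - r / q)). intros n.
  unfold pderiv. rewrite Cmod_mult, Cmod_R, Rabs_pos_eq by apply pos_INR.
  replace (INR (S n) * Cmod (a (S n)) * r ^ n) with
    ((Cmod (a (S n)) * q ^ S n / q) * (INR (S n) * (r / q) ^ n)).
  - assert (Hrq' : 0 <= r / q < 1).
    { split; [apply Rdiv_le_0_compat; lra|apply Rlt_div_l; lra]. }
    apply Rmult_le_compat.
    + apply Rdiv_le_0_compat; [|lra]. apply Rmult_le_pos; [apply Cmod_ge_0|apply pow_le; lra].
    + apply Rmult_le_pos; [apply pos_INR|apply pow_le; lra].
    + apply Rmult_le_compat_r; auto. apply Rlt_le, Rinv_0_lt_compat; lra.
    + apply geom_weight; auto.
  - unfold Rdiv. rewrite Rpow_mult_distr, pow_inv. simpl pow. field.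
    split; [apply pow_nonzero|]; lra.
Qed.

Lemma rad1_pinteg a : rad1 a -> rad1 (pinteg a).
Proof.
  intros Ha r Hr. destruct (Ha r Hr) as [M HM]. exists (Rmax 0 M).
  intros [|n].
  - unfold pinteg. rewrite Cmod_0. simpl. rewrite Rmult_0_l. apply Rmax_l.
  - unfold pinteg. rewrite Cmod_div, Cmod_R, Rabs_pos_eq by (apply pos_INR || apply RtoC_INR_neq).
    eapply Rle_trans; [|apply Rmax_r]. eapply Rle_trans; [|apply (HM n)].
    assert (1 <= INR (S n)) by (rewrite S_INR; assert (H := pos_INR n); lra).
    assert (P := pow_le r n (proj1 Hr)). assert (Q := Cmod_ge_0 (a n)).
    apply Rmult_le_compat; auto.
    + apply Rdiv_le_0_compat; lra.
    + apply pow_le; lra.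
    + apply Rle_div_l; [lra|]. nra.
    + simpl. nra.
Qed.

(** Passing to the next power turns the remainder e into (z + t) e + (n + 2) z^(n+1) t^2. The
    constant (n + 2)(n + 1), twice the sharp one, is the factor occurring in the second
    derivative. *)
Lemma pow_expansion_bound (z t : C) rho n : Cmod z <= rho -> Cmod (z + t) <= rho ->
  Cmod ((z + t) ^ S (S n) - z ^ S (S n) - RtoC (INR (S (S n))) * z ^ S n * t)%C
    <= INR (S (S n)) * INR (S n) * rho ^ n * Cmod t ^ 2.
Proof.
  intros Hz Hzt.
  assert (Hr : 0 <= rho) by (eapply Rle_trans; [apply Cmod_ge_0|exact Hz]).
  induction n as [|n IH].
  - replace ((z + t) ^ 2 - z ^ 2 - RtoC (INR 2) * z ^ 1 * t)%C with (t * t)%C.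
    + rewrite Cmod_mult. simpl. assert (H := Cmod_ge_0 t). nra.
    + replace (RtoC (INR 2)) with (1 + 1)%C by (apply C_eq; simpl; ring). simpl. ring.
  - set (e := ((z + t) ^ S (S n) - z ^ S (S n) - RtoC (INR (S (S n))) * z ^ S n * t)%C) in *.
    replace ((z + t) ^ S (S (S n)) - z ^ S (S (S n)) - RtoC (INR (S (S (S n)))) * z ^ S (S n) * t)%C
      with ((z + t) * e + RtoC (INR (S (S n))) * z ^ S n * (t * t))%C.
    + eapply Rle_trans; [apply Cmod_triangle|]. rewrite !Cmod_mult, Cmod_R, Rabs_pos_eq, Cmod_pow by apply pos_INR.
      assert (Tp := Cmod_ge_0 t). assert (Ep := Cmod_ge_0 e).
      assert (Pn : 0 <= rho ^ n) by (apply pow_le; auto).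
      apply Rle_trans with (rho * (INR (S (S n)) * INR (S n) * rho ^ n * Cmod t ^ 2)
         + INR (S (S n)) * rho ^ S n * Cmod t ^ 2).
      * apply Rplus_le_compat.
        -- apply Rmult_le_compat; auto using Cmod_ge_0.
        -- replace (Cmod t * Cmod t) with (Cmod t ^ 2) by ring.
           apply Rmult_le_compat_r; [apply pow2_ge_0|].
           apply Rmult_le_compat_l; [apply pos_INR|]. apply pow_incr. split; auto using Cmod_ge_0.
      * replace (rho * (INR (S (S n)) * INR (S n) * rho ^ n * Cmod t ^ 2) + INR (S (S n)) * rho ^ S n * Cmod t ^ 2)
          with ((INR (S n) + 1) * INR (S (S n)) * rho ^ S n * Cmod t ^ 2) by (simpl pow; ring).
        apply Rmult_le_compat_r; [apply pow2_ge_0|].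
        apply Rmult_le_compat_r; [apply pow_le; auto|].
        apply Rmult_le_compat_r; [apply pos_INR|].
        rewrite !S_INR. lra.
    + unfold e. replace (RtoC (INR (S (S (S n))))) with (RtoC (INR (S (S n))) + 1)%C.
      * simpl Cpow. ring.
      * rewrite (S_INR (S (S n))). apply C_eq; simpl fst; simpl snd; ring.
Qed.

(** A second order estimate uniform on |z| <= rho, with K the series of f'' at rho taken in moduli.
    Differentiability, the Lipschitz bound and the control of difference quotients in
    [univalent_deriv_nonzero] all come from it. *)
Lemma PS_quad a rho : rad1 a -> 0 <= rho < 1 -> exists K, 0 <= K /\
  forall z t, Cmod z <= rho -> Cmod (z + t) <= rho ->
    Cmod (PS a (z + t) - PS a z - PS (pderiv a) z * t)%C <= K * Cmod t ^ 2.
Proof.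
  intros Ha Hr.
  assert (Hd := rad1_pderiv _ Ha). assert (Hdd := rad1_pderiv _ Hd).
  assert (Hs := rad1_ex_series _ _ Hdd Hr).
  exists (Series (fun n => Cmod (pderiv (pderiv a) n) * rho ^ n)). split.
  { rewrite <- (Rmult_0_l (Series (fun n => Cmod (pderiv (pderiv a) n) * rho ^ n))), <- Series_scal_l.
    apply Series_le; auto. intros n.
    assert (0 <= Cmod (pderiv (pderiv a) n) * rho ^ n).
    { apply Rmult_le_pos; [apply Cmod_ge_0|apply pow_le; lra]. }
    lra. }
  intros z t Hz Hzt.
  assert (Hz1 : Cmod z < 1) by lra. assert (Hzt1 : Cmod (z + t) < 1) by lra.
  assert (S1 := PS_summable a _ Ha Hzt1). assert (S2 := PS_summable a _ Ha Hz1).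
  assert (S3 := PS_summable _ _ Hd Hz1).
  unfold PS.
  (* The terms of degree 0 and 1 cancel exactly, so two terms of each series for f and one of the
     series for f' are split off. *)
  rewrite (Csum_incr _ S1), (Csum_incr _ S2).
  rewrite (Csum_incr _ (summable_incr _ S1)), (Csum_incr _ (summable_incr _ S2)), (Csum_incr _ S3).
  assert (S1' := summable_incr _ (summable_incr _ S1)).
  assert (S2' := summable_incr _ (summable_incr _ S2)).
  assert (S3' := summable_incr _ S3). simpl in S1', S2', S3'.
  match goal with |- Cmod (?x0 + (?x1 + ?A) - (?y0 + (?y1 + ?B)) - (?d0 + ?D) * t)%C <= _ =>
    replace (x0 + (x1 + A) - (y0 + (y1 + B)) - (d0 + D) * t)%C with (A - B - t * D)%C end.
  2: { unfold pderiv. simpl Cpow. simpl INR. ring. }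
  rewrite <- Csum_scal by auto.
  rewrite <- Csum_minus by auto.
  rewrite <- Csum_minus; auto using summable_scal.
  2: { apply (summable_ext (fun n => a (S (S n)) * (z + t) ^ S (S n) + RtoC (-1) * (a (S (S n)) * z ^ S (S n)))%C).
       - intros. ring.
       - apply summable_plus; auto. apply summable_scal; auto. }
  rewrite (Rmult_comm _ (Cmod t ^ 2)), <- Series_scal_l.
  apply Cmod_Csum_le'.
  - intros n.
    replace (a (S (S n)) * (z + t) ^ S (S n) - a (S (S n)) * z ^ S (S n) - t * (pderiv a (S n) * z ^ S n))%C
      with (a (S (S n)) * ((z + t) ^ S (S n) - z ^ S (S n) - RtoC (INR (S (S n))) * z ^ S n * t))%C
      by (unfold pderiv; ring).
    rewrite Cmod_mult.
    assert (B := pow_expansion_bound z t rho n Hz Hzt).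
    unfold pderiv. rewrite !Cmod_mult, !Cmod_R, !Rabs_pos_eq by apply pos_INR.
    apply Rle_trans with (Cmod (a (S (S n))) * (INR (S (S n)) * INR (S n) * rho ^ n * Cmod t ^ 2)).
    + apply Rmult_le_compat_l; auto using Cmod_ge_0.
    + right. ring.
  - apply (@ex_series_scal R_AbsRing R_NormedModule). exact Hs.
Qed.

Lemma PS_bound a rho : rad1 a -> 0 <= rho < 1 -> exists M, 0 <= M /\
  forall z, Cmod z <= rho -> Cmod (PS a z) <= M.
Proof.
  intros Ha Hr. exists (Series (fun n => Cmod (a n) * rho ^ n)).
  assert (B : forall z, Cmod z <= rho -> Cmod (PS a z) <= Series (fun n => Cmod (a n) * rho ^ n)).
  { intros z Hz. apply Cmod_Csum_le'; [|apply rad1_ex_series; auto].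
    intros n. rewrite Cmod_mult, Cmod_pow. apply Rmult_le_compat_l; [apply Cmod_ge_0|].
    apply pow_incr. split; auto using Cmod_ge_0. }
  split; auto. eapply Rle_trans; [|apply (B 0)]; [apply Cmod_ge_0|]. rewrite Cmod_0. lra.
Qed.

Lemma PS_lip a rho : rad1 a -> 0 <= rho < 1 -> exists L, 0 <= L /\
  forall z w, Cmod z <= rho -> Cmod w <= rho -> Cmod (PS a w - PS a z) <= L * Cmod (w - z).
Proof.
  intros Ha Hr.
  destruct (PS_quad a rho Ha Hr) as [K [HK Q]].
  destruct (PS_bound _ rho (rad1_pderiv a Ha) Hr) as [M [HM B]].
  exists (M + 2 * K). split; [lra|]. intros z w Hz Hw.
  assert (E : w = (z + (w - z))%C) by ring.
  assert (Hw' : Cmod (z + (w - z)) <= rho) by (rewrite <- E; auto).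
  specialize (Q z (w - z)%C Hz Hw'). rewrite <- E in Q.
  assert (T := Cmod_triangle_minus w z).
  assert (T2 := Cmod_triangle (PS a w - PS a z - PS (pderiv a) z * (w - z))%C (PS (pderiv a) z * (w - z))%C).
  replace (PS a w - PS a z - PS (pderiv a) z * (w - z) + PS (pderiv a) z * (w - z))%C
    with (PS a w - PS a z)%C in T2 by ring.
  rewrite Cmod_mult in T2. specialize (B z Hz).
  assert (P := Cmod_ge_0 (w - z)).
  assert (Cmod (PS (pderiv a) z) * Cmod (w - z) <= M * Cmod (w - z)) by nra.
  assert (K * Cmod (w - z) ^ 2 <= 2 * K * Cmod (w - z)).
  { replace (2 * K * Cmod (w - z)) with (K * (2 * Cmod (w - z))) by ring.
    apply Rmult_le_compat_l; auto. simpl. nra. }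
  lra.
Qed.

Lemma PS_cdiff a z : rad1 a -> Cmod z < 1 -> cdiff (PS a) z (PS (pderiv a) z).
Proof.
  intros Ha Hz eps He. assert (Hz0 := Cmod_ge_0 z).
  destruct (PS_quad a ((1 + Cmod z) / 2) Ha) as [K [HK Q]]; [lra|].
  exists (Rmin ((1 - Cmod z) / 2) (eps / (1 + K))). split.
  { apply Rmin_pos; [lra|]. apply Rdiv_lt_0_compat; lra. }
  intros t Ht.
  assert (T1 := Rlt_le_trans _ _ _ Ht (Rmin_l _ _)).
  assert (T2 := Rlt_le_trans _ _ _ Ht (Rmin_r _ _)).
  apply Rlt_div_r in T2; [|lra].
  assert (T3 := Cmod_triangle z t). assert (Tp := Cmod_ge_0 t).
  eapply Rle_trans; [apply Q; lra|]. simpl. nra.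
Qed.

Lemma PS_ccont a z : rad1 a -> Cmod z < 1 -> ccont (PS a) z.
Proof. intros. eapply cdiff_ccont, PS_cdiff; auto. Qed.

Lemma PS_holo a : rad1 a -> holo (fun z => Cmod z < 1) (PS a).
Proof.
  intros Ha. exists (PS (pderiv a)). intros z Hz. split; [apply PS_cdiff; auto|].
  apply PS_ccont; auto. apply rad1_pderiv; auto.
Qed.

Lemma PS_incr a z : rad1 a -> Cmod z < 1 -> PS a z = (a O + z * PS (fun n => a (S n)) z)%C.
Proof.
  intros Ha Hz. assert (S1 := PS_summable a z Ha Hz). unfold PS. rewrite Csum_incr by auto.
  simpl Cpow at 1. rewrite Cmult_1_r. f_equal.
  (* The shifted series is recovered by dividing by z, so z = 0 is treated apart. *)
  destruct (Ceq_dec z 0) as [->|Hn].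
  - rewrite (Csum_ext _ (fun n => RtoC 0 * (RtoC 0 ^ n))%C).
    + rewrite Csum_scal; [ring|]. apply summable_le with (fun n => 0 ^ n).
      * intros n. rewrite Cmod_pow, Cmod_0. lra.
      * apply ex_series_geom. rewrite Rabs_R0; lra.
    + intros n. simpl Cpow. ring.
  - rewrite <- Csum_scal.
    + apply Csum_ext. intros n. simpl Cpow. ring.
    + apply (summable_ext (fun n => / z * (a (S n) * z ^ S n))%C).
      * intros n. simpl Cpow. field. auto.
      * apply summable_scal. apply (summable_incr _ S1).
Qed.

Lemma rad1_incr a : rad1 a -> rad1 (fun n => a (S n)).
Proof.
  intros Ha r Hr. set (q := (1 + r) / 2).
  assert (Hq : 0 < q < 1 /\ r < q) by (unfold q; lra). destruct Hq as [Hq Hrq].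
  destruct (Ha q) as [M HM]; [lra|]. exists (M / q). intros n.
  apply (Rle_div_r _ M q); [lra|]. eapply Rle_trans; [|apply (HM (S n))].
  simpl. rewrite Rmult_assoc. apply Rmult_le_compat_l; [apply Cmod_ge_0|].
  rewrite Rmult_comm. apply Rmult_le_compat_l; [lra|]. apply pow_incr; lra.
Qed.

Lemma PS_0 a : rad1 a -> PS a 0 = a O.
Proof.
  intros Ha. rewrite PS_incr; auto; [ring|]. rewrite Cmod_0; lra.
Qed.

Lemma PS_product a b z : rad1 a -> rad1 b -> Cmod z < 1 ->
  PS (fun n => csumf (fun k => a k * b (n - k)%nat)%C n) z = (PS a z * PS b z)%C.
Proof.
  intros Ha Hb Hz. unfold PS. rewrite <- Csum_Cauchy_product by (apply PS_summable; auto).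
  apply Csum_ext. intros n. rewrite Cmult_comm, <- csumf_scal. apply csumf_ext.
  intros k Hk. replace (z ^ n)%C with (z ^ k * z ^ (n - k))%C.
  - ring.
  - rewrite <- Cpow_add_r. f_equal. lia.
Qed.

Lemma PS_ext a b z : (forall n, a n = b n) -> PS a z = PS b z.
Proof. intros H. apply Csum_ext. intros n. rewrite H. reflexivity. Qed.

Lemma rad1_ext a b : (forall n, a n = b n) -> rad1 a -> rad1 b.
Proof. intros H Ha r Hr. destruct (Ha r Hr) as [M HM]. exists M. intros n. rewrite <- H. auto. Qed.

(** * Means over circles *)

Definition circ (r b : R) : C := (RtoC r * cis b)%C.

Lemma Cmod_circ r b : 0 <= r -> Cmod (circ r b) = r.
Proof. intros H. unfold circ. rewrite Cmod_mult, Cmod_cis, Cmod_R, Rabs_pos_eq; lra. Qed.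

Lemma lip_of_derive (f df : R -> R) : (forall t, is_derive f t (df t)) ->
  (forall t, Rabs (df t) <= 1) -> forall x y, Rabs (f y - f x) <= Rabs (y - x).
Proof.
  intros Hf Hd x y. destruct (MVT_gen f x y df) as [c [_ Hc]].
  - intros t _. apply Hf.
  - intros t _. apply derivable_continuous_pt. exists (df t). apply is_derive_Reals, Hf.
  - rewrite Hc, Rabs_mult. assert (H := Rabs_pos (y - x)). specialize (Hd c). nra.
Qed.

Lemma cis_lip x y : Cmod (cis y - cis x) <= 2 * Rabs (y - x).
Proof.
  eapply Rle_trans; [apply Cmod_le_abs|]. simpl.
  assert (H1 := lip_of_derive cos (fun t => - sin t) is_derive_cos).
  assert (H2 := lip_of_derive sin cos is_derive_sin).
  assert (B1 : forall t, Rabs (- sin t) <= 1).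
  { intros t. apply Rabs_le. assert (H := SIN_bound t). lra. }
  assert (B2 : forall t, Rabs (cos t) <= 1).
  { intros t. apply Rabs_le. assert (H := COS_bound t). lra. }
  specialize (H1 B1 x y). specialize (H2 B2 x y).
  unfold Rminus in *. lra.
Qed.

Lemma circ_cont x y eps : 0 < eps -> exists del, 0 < del /\
  forall u v, Rabs (u - x) < del -> Rabs (v - y) < del -> Cmod (circ u v - circ x y) < eps.
Proof.
  intros He. assert (X := Rabs_pos x).
  exists (eps / (2 + 2 * Rabs x)). split; [apply Rdiv_lt_0_compat; lra|].
  intros u v Hu Hv.
  apply Rlt_div_r in Hu; [|lra]. apply Rlt_div_r in Hv; [|lra].
  replace (circ u v - circ x y)%C with (RtoC (u - x) * cis v + RtoC x * (cis v - cis y))%C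
    by (unfold circ; rewrite RtoC_minus; ring).
  eapply Rle_lt_trans; [apply Cmod_triangle|]. rewrite !Cmod_mult, !Cmod_R, Cmod_cis.
  assert (L := cis_lip y v). assert (P1 := Rabs_pos (u - x)). assert (P2 := Rabs_pos (v - y)).
  nra.
Qed.

Lemma rderiv_circ_angle r b : rderiv (circ r) b (RtoC r * (Ci * cis b))%C.
Proof.
  assert (H := rderiv_mult (fun _ => RtoC r) cis b _ _ (rderiv_const _ _) (rderiv_cis b)).
  replace (RtoC r * (Ci * cis b))%C with (0 * cis b + RtoC r * (Ci * cis b))%C by ring. exact H.
Qed.

Lemma rderiv_circ_radius b r : rderiv (fun s => circ s b) r (cis b).
Proof. apply rderiv_line. Qed.

Lemma ccont_circ F x y eps : ccont F (circ x y) -> 0 < eps -> exists del, 0 < del /\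
  forall u v, Rabs (u - x) < del -> Rabs (v - y) < del -> Cmod (F (circ u v) - F (circ x y))%C < eps.
Proof.
  intros HF He. destruct (HF eps He) as [d [Hd H]].
  destruct (circ_cont x y d Hd) as [d2 [Hd2 H2]].
  exists d2. split; auto. intros u v Hu Hv.
  specialize (H _ (H2 u v Hu Hv)).
  replace (circ x y + (circ u v - circ x y))%C with (circ u v) in H by ring. exact H.
Qed.

Lemma ccont_circ_continuous_re F r b : ccont F (circ r b) ->
  continuous (fun t => fst (F (circ r t))) b.
Proof.
  intros HF. apply filterlim_locally. intros eps.
  destruct (ccont_circ F r b eps HF (cond_pos eps)) as [d [Hd H]].
  exists (mkposreal d Hd). intros y Hy.
  assert (Hy' : Rabs (y - b) < d) by exact Hy.
  assert (H0 : Rabs (r - r) < d) by (rewrite Rminus_diag, Rabs_R0; auto).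
  eapply Rle_lt_trans; [|apply (H r y H0 Hy')]. apply (re_le_Cmod (F (circ r y) - F (circ r b))%C).
Qed.

(** Only the real part is integrated, without dividing by 2 pi; complex information is recovered by
    first multiplying F by a suitable factor. *)
Definition cmean (F : C -> C) (r : R) : R := RInt (fun b => fst (F (circ r b))) 0 (2 * PI).

Lemma cmean_ex F r : (forall b, ccont F (circ r b)) ->
  ex_RInt (fun b => fst (F (circ r b))) 0 (2 * PI).
Proof.
  intros H. apply (@ex_RInt_continuous R_CompleteNormedModule). intros b _. apply ccont_circ_continuous_re; auto.
Qed.

Lemma cis_2PI : cis (2 * PI) = cis 0.
Proof. unfold cis. rewrite cos_2PI, sin_2PI, cos_0, sin_0. reflexivity. Qed.

(* In polar coordinates, dF/dr = (i r)^{-1} dF/db, whose mean over the circle is zero. *)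
Lemma cmean_derive F R0 r : holo (fun z => 0 < Cmod z < R0) F -> 0 < r < R0 ->
  is_derive (cmean F) r 0.
Proof.
  intros [F' HF] Hr.
  assert (Hin : forall u b, 0 < u < R0 -> 0 < Cmod (circ u b) < R0).
  { intros u b Hu. rewrite Cmod_circ; lra. }
  assert (Hder : forall u b, 0 < u < R0 ->
    is_derive (fun z => fst (F (circ z b))) u (fst (F' (circ u b) * cis b)%C)).
  { intros u b Hu. destruct (HF _ (Hin u b Hu)) as [H1 _].
    apply (rderiv_comp F (fun s => circ s b) u _ _ (rderiv_circ_radius b u) H1). }
  assert (Hloc : locally r (fun u => 0 < u < R0)).
  { assert (Hm : 0 < Rmin r (R0 - r)) by (apply Rmin_pos; lra).
    exists (mkposreal _ Hm). intros u Hu.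
    assert (Hu' : Rabs (u - r) < Rmin r (R0 - r)) by exact Hu.
    assert (A1 := Rmin_l r (R0 - r)). assert (A2 := Rmin_r r (R0 - r)).
    apply Rabs_def2 in Hu'. lra. }
  assert (Hint : RInt (fun b => Derive (fun u => fst (F (circ u b))) r) 0 (2 * PI) = 0).
  { rewrite (RInt_ext _ (fun b => fst (F' (circ r b) * cis b)%C)).
    2: { intros b _. apply is_derive_unique, Hder; auto. }
    apply is_RInt_unique.
    replace 0 with (minus (/ r * snd (F (circ r (2 * PI)))) (/ r * snd (F (circ r 0)))) at 2.
    2: { unfold circ. rewrite cis_2PI. apply Rminus_diag. }
    apply (is_RInt_derive (fun b => / r * snd (F (circ r b)))).
    - intros b _. destruct (HF _ (Hin r b Hr)) as [H1 _].
      destruct (rderiv_comp F (circ r) b _ _ (rderiv_circ_angle r b) H1) as [_ H2].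
      evar_last; [apply (is_derive_scal (fun b => snd (F (circ r b))) b (/ r)); exact H2|].
      unfold scal, mult; simpl. field. lra.
    - intros b _. destruct (HF _ (Hin r b Hr)) as [_ H2].
      apply (continuous_ext (fun b => / r * fst ((fun z => F' z * z)%C (circ r b)))).
      { intros t. unfold circ. simpl. field. lra. }
      apply (@continuous_scal_r R_UniformSpace R_AbsRing R_NormedModule).
      apply (ccont_circ_continuous_re (fun z => F' z * z)%C).
      apply ccont_mult; auto. eapply cdiff_ccont, cdiff_id. }
  rewrite <- Hint. unfold cmean. apply is_derive_RInt_param.
  - apply filter_imp with (2 := Hloc). intros u Hu b _. eexists. apply Hder; auto.
  - intros b _. apply continuity_2d_pt_ext_loc with (fun u v => fst (F' (circ u v) * cis v)%C).
    { destruct Hloc as [d Hd]. exists d. intros u v Hu _. symmetry. apply is_derive_unique, Hder, Hd, Hu. }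
    assert (Hc : ccont (fun z => F' z * z)%C (circ r b)).
    { destruct (HF _ (Hin r b Hr)) as [_ H2].
      apply ccont_mult; auto. eapply cdiff_ccont, cdiff_id. }
    apply continuity_2d_pt_ext_loc with (fun u v => / u * fst ((fun z => F' z * z)%C (circ u v))).
    { destruct Hloc as [d Hd]. exists d. intros u v Hu _. specialize (Hd u Hu). unfold circ. simpl. field. lra. }
    apply continuity_2d_pt_mult.
    + apply continuity_1d_2d_pt_comp with (f := Rinv) (g := fun u _ => u).
      * apply continuity_pt_inv; [apply derivable_continuous_pt, derivable_pt_id|lra].
      * apply continuity_2d_pt_id1.
    + intros eps. destruct (ccont_circ _ r b eps Hc (cond_pos eps)) as [d [Hd H]].
      exists (mkposreal d Hd). intros u v Hu Hv.
      eapply Rle_lt_trans; [|apply (H u v Hu Hv)].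
      apply (re_le_Cmod (F' (circ u v) * circ u v - F' (circ r b) * circ r b)%C).
  - apply filter_imp with (2 := Hloc). intros u Hu. apply cmean_ex. intros b.
    eapply holo_ccont; [exists F'; exact HF|]. apply Hin; auto.
Qed.

Lemma cmean_close F r L eps : 0 < r -> (forall b, ccont F (circ r b)) ->
  (forall b, Cmod (F (circ r b) - L)%C <= eps) -> Rabs (cmean F r - 2 * PI * fst L) <= 2 * PI * eps.
Proof.
  intros Hr Hc HB. assert (HPI := PI_RGT_0).
  assert (E := cmean_ex F r Hc).
  replace (cmean F r - 2 * PI * fst L) with (RInt (fun b => fst (F (circ r b)) - fst L) 0 (2 * PI)).
  - replace (2 * PI * eps) with ((2 * PI - 0) * eps) by ring. apply abs_RInt_le_const.
    + lra.
    + apply (@ex_RInt_minus R_NormedModule); auto. apply ex_RInt_const.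
    + intros t _. eapply Rle_trans; [|apply (HB t)]. apply (re_le_Cmod (F (circ r t) - L)%C).
  - unfold cmean. etransitivity.
    + apply (RInt_minus (V := R_CompleteNormedModule)); auto. apply ex_RInt_const.
    + rewrite RInt_const. unfold minus, plus, opp, scal; simpl. unfold mult; simpl. ring.
Qed.

(** The mean does not depend on the radius and tends to 2 pi Re L as the radius shrinks. The disk is
    punctured because the lemma is applied to functions containing 1 / z. *)
Lemma mean_value F R0 L r : holo (fun z => 0 < Cmod z < R0) F ->
  (forall eps, 0 < eps -> exists del, 0 < del /\
     forall z, 0 < Cmod z < del -> Cmod (F z - L)%C < eps) ->
  0 < r < R0 -> cmean F r = 2 * PI * fst L.
Proof.
  intros HF HL Hr. assert (HPI := PI_RGT_0).
  assert (Hc : forall u, 0 < u < R0 -> forall b, ccont F (circ u b)).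
  { intros u Hu b. eapply holo_ccont; [exact HF|]. simpl. rewrite Cmod_circ; lra. }
  apply cond_eq. intros eps He.
  destruct (HL (eps / (4 * PI))) as [del [Hd H]]; [apply Rdiv_lt_0_compat; lra|].
  set (u := Rmin (del / 2) r).
  assert (U : 0 < u /\ u <= r /\ u < del).
  { unfold u. assert (A1 := Rmin_l (del / 2) r). assert (A2 := Rmin_r (del / 2) r).
    repeat split; try lra. apply Rmin_pos; lra. }
  assert (E : cmean F u = cmean F r).
  { apply is_derive_zero_const; [lra|]. intros t Ht. apply (cmean_derive F R0); auto. lra. }
  rewrite <- E. eapply Rle_lt_trans.
  - apply (cmean_close F u L (eps / (4 * PI))); [lra| |].
    + apply Hc. lra.
    + intros b. apply Rlt_le, H. rewrite Cmod_circ; lra.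
  - replace (2 * PI * (eps / (4 * PI))) with (eps / 2) by (field; lra). lra.
Qed.

Lemma mean_value_0 F R0 r : holo (fun z => Cmod z < R0) F -> 0 < r < R0 ->
  cmean F r = 2 * PI * fst (F 0).
Proof.
  intros HF Hr. apply mean_value with R0; auto.
  - apply holo_sub with (2 := HF). intros z Hz; lra.
  - intros eps He. assert (C0' : ccont F 0).
    { eapply holo_ccont; [exact HF|]. simpl. rewrite Cmod_0. lra. }
    destruct (C0' eps He) as [d [Hd H]]. exists d. split; auto. intros z Hz.
    rewrite <- (Cplus_0_l z) at 1. apply H. lra.
Qed.

(** The mean value property for conj (F(0)) F, whose value at 0 is the real number |F(0)|^2. *)
Lemma max_modulus F R0 r M : holo (fun z => Cmod z < R0) F -> 0 < r < R0 ->
  (forall b, Cmod (F (circ r b)) <= M) -> Cmod (F 0) <= M.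
Proof.
  intros HF Hr HB. assert (HPI := PI_RGT_0).
  destruct (Req_dec (Cmod (F 0)) 0) as [E|Hn].
  { rewrite E. eapply Rle_trans; [apply Cmod_ge_0|apply (HB 0)]. }
  assert (P : 0 < Cmod (F 0)) by (assert (H := Cmod_ge_0 (F 0)); lra).
  assert (HG : holo (fun z => Cmod z < R0) (fun z => Cconj (F 0) * F z)%C).
  { apply holo_mult; auto. apply holo_const. }
  assert (MV := mean_value_0 _ _ _ HG Hr). simpl in MV.
  assert (E : fst (F 0) * fst (F 0) - - snd (F 0) * snd (F 0) = Cmod (F 0) * Cmod (F 0)).
  { replace (Cmod (F 0) * Cmod (F 0)) with (Cmod (F 0) ^ 2) by ring. rewrite Cmod_sqr. ring. }
  rewrite E in MV.
  assert (Hc : forall b, ccont (fun z => Cconj (F 0) * F z)%C (circ r b)).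
  { intros b. eapply holo_ccont; [exact HG|]. simpl. rewrite Cmod_circ; lra. }
  assert (B := cmean_close _ r (RtoC 0) (Cmod (F 0) * M) (proj1 Hr) Hc).
  simpl fst in B. rewrite Rmult_0_r, Rminus_0_r in B. rewrite MV in B.
  assert (B' : Rabs (2 * PI * (Cmod (F 0) * Cmod (F 0))) <= 2 * PI * (Cmod (F 0) * M)).
  { apply B. intros b. replace (Cconj (F 0) * F (circ r b) - 0)%C with (Cconj (F 0) * F (circ r b))%C by ring.
    rewrite Cmod_mult, Cmod_conj. apply Rmult_le_compat_l; [lra|auto]. }
  rewrite Rabs_pos_eq in B'.
  - apply Rmult_le_reg_l in B'; [|lra]. apply Rmult_le_reg_l in B'; auto.
  - apply Rmult_le_pos; nra.
Qed.

Lemma min_modulus F w0 R0 r m : holo (fun z => Cmod (z - w0) < R0) F -> 0 < r < R0 -> 0 < m ->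
  (forall z, Cmod (z - w0) < R0 -> F z <> 0) ->
  (forall z, Cmod (z - w0) = r -> m <= Cmod (F z)) -> m <= Cmod (F w0).
Proof.
  intros HF Hr Hm Hn HB.
  assert (HG : holo (fun z => Cmod z < R0) (fun z => / F (w0 + z))%C).
  { apply holo_inv.
    - apply holo_comp with (2 := HF).
      + apply holo_plus; [apply holo_const|apply holo_id].
      + intros z Hz. replace (w0 + z - w0)%C with z by ring. exact Hz.
    - intros z Hz. apply Hn. replace (w0 + z - w0)%C with z by ring. exact Hz. }
  assert (H0 : F w0 <> 0).
  { apply Hn. replace (w0 - w0)%C with (RtoC 0) by ring. rewrite Cmod_0; lra. }
  assert (H := max_modulus _ _ r (/ m) HG Hr). simpl in H.
  rewrite Cplus_0_r, Cmod_inv in H by auto.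
  assert (P := proj1 (Cmod_gt_0 _) H0).
  rewrite <- (Rinv_inv m), <- (Rinv_inv (Cmod (F w0))).
  apply Rinv_le_contravar; [apply Rinv_0_lt_compat; auto|]. apply H.
  intros b.
  assert (Eb : Cmod (w0 + circ r b - w0) = r).
  { replace (w0 + circ r b - w0)%C with (circ r b) by ring. apply Cmod_circ; lra. }
  assert (Nb : F (w0 + circ r b)%C <> 0) by (apply Hn; lra).
  rewrite Cmod_inv by auto. apply Rinv_le_contravar; auto.
Qed.

(** * Truncated Bessel inequality *)

(** Serves both limit passages: circles growing to the unit circle, and x = cos th tending to 1. *)
Lemma nonneg_at_1 (f : R -> R) : continuity_pt f 1 -> (forall x, 0 < x < 1 -> 0 <= f x) -> 0 <= f 1.
Proof.
  intros Hc H. apply Rnot_lt_le. intros Hlt.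
  destruct (Hc (- f 1)) as [d [Hd Hx]]; [lra|].
  assert (A1 := Rmin_l (d / 2) (1 / 2)). assert (A2 := Rmin_r (d / 2) (1 / 2)).
  assert (A3 : 0 < Rmin (d / 2) (1 / 2)) by (apply Rmin_pos; lra).
  set (y := 1 - Rmin (d / 2) (1 / 2)).
  specialize (H y). specialize (Hx y).
  assert (D : R_dist (f y) (f 1) < - f 1).
  { apply Hx. split.
    - split; [exact I|]. unfold y. lra.
    - simpl. unfold R_dist, y. rewrite Rabs_left; lra. }
  unfold R_dist in D. apply Rabs_def2 in D. unfold y in *. lra.
Qed.

(** * Polynomials as coefficient lists, and their square means *)

Fixpoint peval (s : list C) (z : C) : C :=
  match s with nil => RtoC 0 | c :: s' => (c + z * peval s' z)%C end.

(** The sum of |c_k|^2 x^k, that is the mean of |s|^2 over the circle of radius sqrt x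
    ([Parseval]). *)
Fixpoint pnorm (s : list C) (x : R) : R :=
  match s with nil => 0 | c :: s' => Cmod c ^ 2 + x * pnorm s' x end.

Lemma pnorm_continuous s x : continuity_pt (pnorm s) x.
Proof.
  induction s as [|c s IH]; simpl.
  - apply continuity_pt_const. intros u v. reflexivity.
  - apply (continuity_pt_plus (fun _ => Cmod c * (Cmod c * 1)) (fun x => x * pnorm s x)).
    + apply continuity_pt_const. intros u v. reflexivity.
    + apply (continuity_pt_mult (fun x => x) (pnorm s)); auto. apply derivable_continuous_pt, derivable_pt_id.
Qed.

Lemma peval_holo U s : holo U (peval s).
Proof.
  induction s as [|c s IH]; simpl.
  - apply holo_const.
  - apply (holo_plus U (fun _ => c) (fun z => z * peval s z)%C); [apply holo_const|].
    apply (holo_mult U (fun z => z) (peval s)); auto. apply holo_id.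
Qed.

(** A polynomial with n coefficients grows at most like |z|^(n-1); the extra factor |z| on the left
    avoids the exponent n - 1 and so covers the empty list. *)
Lemma peval_bound s : exists M, 0 <= M /\
  forall z, 1 <= Cmod z -> Cmod (peval s z) * Cmod z <= M * Cmod z ^ length s.
Proof.
  induction s as [|c s [M [HM IH]]]; simpl.
  - exists 0. split; [lra|]. intros z _. rewrite Cmod_0. lra.
  - exists (Cmod c + M). assert (Hc := Cmod_ge_0 c). split; [lra|]. intros z Hz.
    specialize (IH z Hz).
    apply Rle_trans with ((Cmod c + Cmod z * Cmod (peval s z)) * Cmod z).
    + apply Rmult_le_compat_r; [lra|]. rewrite <- Cmod_mult. apply Cmod_triangle.
    + assert (P := pow_R1_Rle _ (length s) Hz).
      assert (Q : 0 <= Cmod c * Cmod z) by (apply Rmult_le_pos; lra). nra.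
Qed.

(** On a circle about 0, conjugation agrees with the holomorphic function r^2 / z. This is what
    makes conj (s(z)) accessible to [mean_value]. *)
Lemma Cconj_circle z r : Cmod z = r -> 0 < r -> Cconj z = (RtoC (r ^ 2) * / z)%C.
Proof.
  intros Hz Hr. assert (Hn : z <> 0) by (apply Cmod_gt_0; lra).
  rewrite <- Hz, RtoC_pow. replace (RtoC (Cmod z) ^ 2)%C with (z * Cconj z)%C.
  - field. auto.
  - rewrite <- Cmod2_conj, RtoC_pow. reflexivity.
Qed.

Lemma Cconj_peval s z : Cconj (peval s z) = peval (map Cconj s) (Cconj z).
Proof.
  induction s as [|c s IH]; simpl.
  - apply C_eq; simpl; ring.
  - rewrite Cplus_conj, Cmult_conj, IH. reflexivity.
Qed.

Lemma Cmod_plus_sqr u v : Cmod (u + v) ^ 2 = Cmod u ^ 2 + 2 * fst (Cconj u * v)%C + Cmod v ^ 2.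
Proof. rewrite !Cmod_sqr. simpl. ring. Qed.

(** In |c + z s(z)|^2 the cross term is 2 Re (conj c z s(z)), holomorphic and zero at 0, so its mean
    vanishes. *)
Lemma Parseval s r : 0 < r ->
  is_RInt (fun b => Cmod (peval s (circ r b)) ^ 2) 0 (2 * PI) (2 * PI * pnorm s (r ^ 2)).
Proof.
  intros Hr. induction s as [|c s IH].
  - simpl pnorm. apply is_RInt_ext with (fun _ => 0).
    + intros b _. simpl peval. rewrite Cmod_0. simpl. ring.
    + evar_last; [apply (@is_RInt_const R_NormedModule)|]. unfold scal; simpl; unfold mult; simpl. ring.
  - set (G := fun z => (Cconj c * (z * peval s z))%C).
    assert (HG : forall U, holo U G).
    { intros U. apply holo_mult; [apply holo_const|]. apply holo_mult; [apply holo_id|apply peval_holo]. }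
    assert (MG : is_RInt (fun b => fst (G (circ r b))) 0 (2 * PI) 0).
    { replace 0 with (cmean G r) at 2.
      - apply (@RInt_correct R_CompleteNormedModule), cmean_ex. intros b.
        apply (holo_ccont (fun _ => True)); auto.
      - rewrite (mean_value_0 G (r + 1) r); [|apply HG|lra]. unfold G. simpl. ring. }
    apply is_RInt_ext with (fun b => plus (plus (Cmod c ^ 2) (scal 2 (fst (G (circ r b)))))
       (scal (r ^ 2) (Cmod (peval s (circ r b)) ^ 2))).
    + intros b _. simpl peval. rewrite Cmod_plus_sqr.
      rewrite Cmod_mult, Cmod_circ, Rpow_mult_distr by lra. reflexivity.
    + evar_last.
      * apply (@is_RInt_plus R_NormedModule); [apply (@is_RInt_plus R_NormedModule)|].
        -- apply (@is_RInt_const R_NormedModule).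
        -- apply (@is_RInt_scal R_NormedModule). exact MG.
        -- apply (@is_RInt_scal R_NormedModule). exact IH.
      * unfold plus, scal; simpl; unfold mult; simpl. ring.
Qed.

(** On |z| = r, |H|^2 = |s|^2 + 2 Re (conj s (H - s)) + |H - s|^2. The middle term has mean zero,
    since conj s has a pole of order below [length s] at 0 when written in r^2 / z, while H - s =
    O(z^(length s)). Dropping the last term compares the means of |s|^2 and |q|^2; then r tends to
    1. *)
Lemma Bessel_truncated H s q del K :
  holo (fun z => Cmod z < 1) H ->
  (forall z, Cmod z < 1 -> Cmod (H z) <= Cmod (peval q z)) ->
  0 < del -> (forall z, Cmod z < del -> Cmod (H z - peval s z)%C <= K * Cmod z ^ length s) ->
  pnorm s 1 <= pnorm q 1.
Proof.
  intros HH Hq Hdel HK. assert (HPI := PI_RGT_0).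
  assert (Main : forall r, 0 < r < 1 -> pnorm s (r ^ 2) <= pnorm q (r ^ 2)).
  { intros r Hr.
    set (D := fun z => peval (map Cconj s) (RtoC (r ^ 2) * / z)%C).
    set (F := fun z => ((H z - peval s z) * D z)%C).
    assert (HF : holo (fun z => 0 < Cmod z < 1) F).
    { apply holo_mult.
      - apply holo_minus; [|apply peval_holo]. apply holo_sub with (2 := HH). intros z Hz; lra.
      - apply (holo_comp _ (fun _ => True) (peval (map Cconj s)) (fun z => RtoC (r ^ 2) * / z)%C); auto.
        + apply holo_mult; [apply holo_const|]. apply holo_inv; [apply holo_id|].
          intros z Hz. apply Cmod_gt_0. lra.
        + apply peval_holo. }
    destruct (peval_bound (map Cconj s)) as [M [HM BM]].
    rewrite length_map in BM.
    assert (Hr2 : 0 < r ^ 2 < 1) by (simpl; nra).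
    set (N := length s) in *.
    assert (HK' : forall z, Cmod z < del -> Cmod (H z - peval s z)%C <= Rabs K * Cmod z ^ N).
    { intros z Hz. eapply Rle_trans; [apply HK; auto|].
      apply Rmult_le_compat_r; [apply pow_le, Cmod_ge_0|apply Rle_abs]. }
    assert (KP := Rabs_pos K).
    assert (HL : forall eps, 0 < eps -> exists d, 0 < d /\
      forall z, 0 < Cmod z < d -> Cmod (F z - 0)%C < eps).
    { intros eps He. set (B := Rabs K * M * / r ^ 2 + 1).
      assert (HB : 0 < B).
      { unfold B. assert (0 < / r ^ 2) by (apply Rinv_0_lt_compat; lra).
        assert (0 <= Rabs K * M) by nra. nra. }
      exists (Rmin (Rmin del (r ^ 2)) (eps / B)). split.
      { repeat apply Rmin_pos; try lra. apply Rdiv_lt_0_compat; lra. }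
      intros z [Hz0 Hz].
      assert (T1 := Rlt_le_trans _ _ _ (Rlt_le_trans _ _ _ Hz (Rmin_l _ _)) (Rmin_l _ _)).
      assert (T2 := Rlt_le_trans _ _ _ (Rlt_le_trans _ _ _ Hz (Rmin_l _ _)) (Rmin_r _ _)).
      assert (T3 := Rlt_le_trans _ _ _ Hz (Rmin_r _ _)).
      apply Rlt_div_r in T3; auto.
      replace (F z - 0)%C with (F z) by ring. unfold F. rewrite Cmod_mult.
      specialize (HK' z T1).
      assert (Hzn : z <> 0) by (apply Cmod_gt_0; auto).
      set (w := (RtoC (r ^ 2) * / z)%C).
      assert (Ew : Cmod w = r ^ 2 / Cmod z).
      { unfold w. rewrite Cmod_mult, Cmod_inv, Cmod_R, Rabs_pos_eq by (auto; lra). reflexivity. }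
      (* The growth bound for [peval] requires |w| >= 1, whence the condition |z| < r^2. *)
      assert (Hw : 1 <= Cmod w).
      { rewrite Ew. apply Rle_div_r; lra. }
      specialize (BM w Hw). change (peval (map Cconj s) w) with (D z) in BM.
      assert (Dz := Cmod_ge_0 (D z)).
      assert (DB : Cmod (D z) * Cmod z ^ N <= M * / r ^ 2 * Cmod z).
      { assert (Pz : 0 < Cmod z ^ N) by (apply pow_lt; auto).
        apply Rmult_le_reg_r with (Cmod w); [lra|].
        apply Rle_trans with (M * Cmod w ^ N * Cmod z ^ N).
        - replace (Cmod (D z) * Cmod z ^ N * Cmod w) with ((Cmod (D z) * Cmod w) * Cmod z ^ N) by ring.
          apply Rmult_le_compat_r; lra.
        - rewrite Rmult_assoc, <- Rpow_mult_distr.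
          replace (Cmod w * Cmod z) with (r ^ 2) by (rewrite Ew; field; lra).
          replace (M * / r ^ 2 * Cmod z * Cmod w) with (M * 1).
          2: { rewrite Ew. field. lra. }
          apply Rmult_le_compat_l; auto.
          rewrite <- (pow1 N). apply pow_incr. lra. }
      apply Rle_lt_trans with (Rabs K * Cmod z ^ N * Cmod (D z)).
      - apply Rmult_le_compat_r; auto.
      - apply Rle_lt_trans with (Rabs K * (M * / r ^ 2 * Cmod z)).
        + replace (Rabs K * Cmod z ^ N * Cmod (D z)) with (Rabs K * (Cmod (D z) * Cmod z ^ N)) by ring.
          apply Rmult_le_compat_l; auto.
        + unfold B in T3. nra. }
    assert (MF := mean_value F 1 (RtoC 0) r HF HL Hr). simpl fst in MF. rewrite Rmult_0_r in MF.
    assert (IF : is_RInt (fun b => fst (F (circ r b))) 0 (2 * PI) (cmean F r)).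
    { apply (@RInt_correct R_CompleteNormedModule), cmean_ex. intros b.
      eapply holo_ccont; [exact HF|]. simpl. rewrite Cmod_circ; lra. }
    rewrite MF in IF.
    assert (Is := Parseval s r (proj1 Hr)). assert (Iq := Parseval q r (proj1 Hr)).
    assert (Pt : forall b, Cmod (peval s (circ r b)) ^ 2 + 2 * fst (F (circ r b))
                   <= Cmod (peval q (circ r b)) ^ 2).
    { intros b.
      assert (Hcb : Cmod (circ r b) = r) by (apply Cmod_circ; lra).
      assert (EF : F (circ r b) = (Cconj (peval s (circ r b)) * (H (circ r b) - peval s (circ r b)))%C).
      { unfold F, D. rewrite Cconj_peval, (Cconj_circle _ r Hcb) by lra. ring. }
      rewrite EF.
      assert (Hq' : Cmod (H (circ r b)) <= Cmod (peval q (circ r b))) by (apply Hq; lra).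
      apply Rle_trans with (Cmod (H (circ r b)) ^ 2).
      2: { apply pow_incr. split; auto using Cmod_ge_0. }
      assert (E := Cmod_plus_sqr (peval s (circ r b)) (H (circ r b) - peval s (circ r b))%C).
      replace (peval s (circ r b) + (H (circ r b) - peval s (circ r b)))%C with (H (circ r b)) in E by ring.
      assert (P := pow2_ge_0 (Cmod (H (circ r b) - peval s (circ r b))%C)). lra. }
    assert (Isum := @is_RInt_plus R_NormedModule _ _ _ _ _ _ Is (@is_RInt_scal R_NormedModule _ _ _ 2 _ IF)).
    assert (Le := is_RInt_le _ _ _ _ _ _ (Rlt_le _ _ (Rmult_lt_0_compat 2 PI Rlt_0_2 HPI)) Isum Iq
      (fun b _ => Pt b)).
    unfold plus, scal in Le; simpl plus in Le; unfold mult in Le; simpl mult in Le.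
    apply Rmult_le_reg_l with (2 * PI); [lra|].
    rewrite Rmult_0_r in Le. change (2 * PI * pnorm s (r ^ 2) + 0 <= 2 * PI * pnorm q (r ^ 2)) in Le. lra. }
  assert (L := nonneg_at_1 (fun x => pnorm q x - pnorm s x)).
  apply Rminus_le_0. apply L.
  - apply continuity_pt_minus; apply pnorm_continuous.
  - intros x Hx. specialize (Main (sqrt x)).
    assert (Hs : 0 < sqrt x < 1).
    { split; [apply sqrt_lt_R0; lra|]. rewrite <- sqrt_1. apply sqrt_lt_1; lra. }
    specialize (Main Hs). rewrite pow2_sqrt in Main by lra. lra.
Qed.

(** * Zeros of the derivative of a univalent function *)

Lemma polar_form z r : Cmod z = r -> exists b, 0 <= b <= 2 * PI /\ z = circ r b.
Proof.
  intros Hz. assert (HPI := PI_RGT_0).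
  destruct (Req_dec r 0) as [E|Hn].
  { exists 0. split; [lra|]. rewrite E in Hz. apply Cmod_eq_0 in Hz. rewrite Hz, E. unfold circ. ring. }
  assert (Hr : 0 < r) by (assert (H := Cmod_ge_0 z); lra).
  destruct z as [u v].
  assert (Hs := Cmod_sqr (u, v)). rewrite Hz in Hs. simpl in Hs.
  assert (Hx : -1 <= u / r <= 1).
  { split; [apply Rle_div_r|apply Rle_div_l]; nra. }
  assert (Hq : sqrt (1 - (u / r)²) = Rabs v / r).
  { replace (1 - (u / r)²) with ((v / r)²).
    - rewrite sqrt_Rsqr_abs. unfold Rdiv. rewrite Rabs_mult, Rabs_inv, (Rabs_pos_eq r); lra.
    - unfold Rsqr. apply Rmult_eq_reg_r with (r * r); [|nra]. field_simplify; [nra|lra|lra]. }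
  assert (Hb := acos_bound (u / r)).
  destruct (Rle_dec 0 v) as [Hv|Hv].
  - exists (acos (u / r)). split; [lra|].
    apply C_eq; simpl; rewrite cos_acos, sin_acos, Hq by auto; rewrite Rabs_pos_eq by auto; field; lra.
  - exists (2 * PI - acos (u / r)). split; [lra|].
    apply C_eq; simpl; rewrite cos_minus, sin_minus, cos_2PI, sin_2PI, cos_acos, sin_acos, Hq by auto;
      rewrite Rabs_left by lra; field; lra.
Qed.

Lemma circle_min F w0 r : 0 < r -> (forall z, Cmod (z - w0) = r -> ccont F z) ->
  (forall z, Cmod (z - w0) = r -> F z <> 0) ->
  exists m, 0 < m /\ forall z, Cmod (z - w0) = r -> m <= Cmod (F z).
Proof.
  intros Hr Hc Hn. assert (HPI := PI_RGT_0).
  assert (E : forall b, Cmod (w0 + circ r b - w0) = r).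
  { intros b. replace (w0 + circ r b - w0)%C with (circ r b) by ring. apply Cmod_circ; lra. }
  destruct (continuity_ab_min (fun b => Cmod (F (w0 + circ r b)%C)) 0 (2 * PI)) as [b0 [Hmin _]]; [lra| |].
  - intros b _ eps He.
    destruct (Hc _ (E b) eps He) as [d [Hd H]].
    destruct (circ_cont r b d Hd) as [d2 [Hd2 H2]].
    exists d2. split; auto. intros y [_ Hy]. simpl in *. unfold R_dist in *.
    assert (H0 : Rabs (r - r) < d2) by (rewrite Rminus_diag, Rabs_R0; auto).
    specialize (H _ (H2 r y H0 Hy)).
    replace (w0 + circ r b + (circ r y - circ r b))%C with (w0 + circ r y)%C in H by ring.
    eapply Rle_lt_trans; [|exact H].
    apply Rabs_le. split.
    + rewrite Cmod_minus_sym. assert (T := Cmod_reverse_triangle (F (w0 + circ r b)%C) (F (w0 + circ r y)%C)). lra.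
    + assert (T := Cmod_reverse_triangle (F (w0 + circ r y)%C) (F (w0 + circ r b)%C)). lra.
  - exists (Cmod (F (w0 + circ r b0)%C)). split; [apply Cmod_gt_0, Hn, E|].
    intros z Hz. destruct (polar_form _ _ Hz) as [b [Hb Ez]].
    replace z with (w0 + circ r b)%C by (rewrite <- Ez; ring). apply Hmin, Hb.
Qed.

(** Coefficients of (f(z) - f(w0)) / (z - w0): the j-th one is the sum over n of a_(j+1+n) w0^n. *)
Definition pdivide (a : nat -> C) (w0 : C) (j : nat) : C := PS (fun n => a (S (j + n))) w0.

Lemma rad1_shift a j : rad1 a -> rad1 (fun n => a (j + n)%nat).
Proof.
  intros Ha. induction j as [|j IH]; auto.
  apply rad1_incr in IH. apply (rad1_ext _ _ (fun n => f_equal a (Nat.add_succ_r j n))). exact IH.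
Qed.

(** The radius rho is kept and only the constant changes, by the factor 1 / (rho - |w0|), so the
    division can be iterated with geometric control. *)
Lemma pdivide_bound a w0 rho A : Cmod w0 < rho -> (forall n, Cmod (a n) * rho ^ n <= A) ->
  forall j, Cmod (pdivide a w0 j) * rho ^ j <= A / (rho - Cmod w0).
Proof.
  intros Hw HA j. assert (H0 := Cmod_ge_0 w0).
  assert (Hq : 0 <= Cmod w0 / rho < 1).
  { split; [apply Rdiv_le_0_compat; lra|apply Rlt_div_l; lra]. }
  assert (Pj : 0 < rho ^ j) by (apply pow_lt; lra).
  apply Rle_div_r; auto.
  replace (A / (rho - Cmod w0) / rho ^ j) with (A / rho ^ S j * / (1 - Cmod w0 / rho)).
  2: { simpl. field. split; [|split]; lra. }
  rewrite <- Series_geom by (rewrite Rabs_pos_eq; lra).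
  rewrite <- Series_scal_l. apply Cmod_Csum_le'.
  - intros n. rewrite Cmod_mult, Cmod_pow.
    assert (Pn : 0 < rho ^ S (j + n)) by (apply pow_lt; lra).
    specialize (HA (S (j + n))). apply Rle_div_r in HA; auto.
    replace (A / rho ^ S j * (Cmod w0 / rho) ^ n) with (A / rho ^ S (j + n) * Cmod w0 ^ n).
    + apply Rmult_le_compat_r; auto. apply pow_le; auto.
    + unfold Rdiv at 3. rewrite Rpow_mult_distr, pow_inv.
      replace (S (j + n)) with (S j + n)%nat by lia. rewrite pow_add. field.
      split; apply pow_nonzero; lra.
  - apply (@ex_series_scal R_AbsRing R_NormedModule), ex_series_geom. rewrite Rabs_pos_eq; lra.
Qed.

Lemma rad1_pdivide a w0 : rad1 a -> Cmod w0 < 1 -> rad1 (pdivide a w0).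
Proof.
  intros Ha Hw r Hr. assert (H0 := Cmod_ge_0 w0).
  set (rho := (1 + Rmax r (Cmod w0)) / 2).
  assert (M1 := Rmax_l r (Cmod w0)). assert (M2 := Rmax_r r (Cmod w0)).
  assert (M3 : Rmax r (Cmod w0) < 1) by (apply Rmax_lub_lt; lra).
  assert (Hrho : r < rho /\ Cmod w0 < rho < 1) by (unfold rho; lra).
  destruct (Ha rho) as [A HA]; [lra|].
  exists (A / (rho - Cmod w0)). intros n.
  eapply Rle_trans; [|apply (pdivide_bound a w0 rho A); [lra|exact HA]].
  apply Rmult_le_compat_l; [apply Cmod_ge_0|]. apply pow_incr. lra.
Qed.

Lemma PS_pdivide a w0 z : rad1 a -> Cmod w0 < 1 -> Cmod z < 1 ->
  PS a z = (PS a w0 + (z - w0) * PS (pdivide a w0) z)%C.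
Proof.
  intros Ha Hw Hz.
  assert (Hd := rad1_pdivide a w0 Ha Hw).
  (* This is the comparison of coefficients in f(z) - f(w0) = (z - w0) times the quotient. *)
  assert (Rec : forall j, a (S j) = (pdivide a w0 j - w0 * pdivide a w0 (S j))%C).
  { intros j. unfold pdivide at 1. rewrite PS_incr; auto.
    - rewrite Nat.add_0_r.
      rewrite (PS_ext (fun n => a (S (j + S n))) (fun n => a (S (S j + n)))).
      + unfold pdivide. ring.
      + intros n. f_equal. lia.
    - apply (rad1_shift a (S j)); auto. }
  rewrite (PS_incr a z), (PS_incr a w0) by auto.
  change (PS (fun n => a (S n)) w0) with (pdivide a w0 0).
  assert (E : PS (fun n => a (S n)) z = (PS (pdivide a w0) z - w0 * PS (fun n => pdivide a w0 (S n)) z)%C).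
  { unfold PS at 2 3. assert (S1 := PS_summable _ z Hd Hz).
    assert (S2 := PS_summable _ z (rad1_incr _ Hd) Hz).
    rewrite <- Csum_scal, <- Csum_minus; auto using summable_scal.
    apply Csum_ext. intros n. rewrite Rec. ring. }
  rewrite E, (PS_incr (pdivide a w0) z) by auto.
  set (X := PS (fun n => pdivide a w0 (S n)) z). set (d0 := pdivide a w0 0). ring.
Qed.

Fixpoint pdivide_iter (a : nat -> C) (w0 : C) (k : nat) : nat -> C :=
  match k with O => a | S k' => pdivide (pdivide_iter a w0 k') w0 end.

Lemma rad1_pdivide_iter a w0 k : rad1 a -> Cmod w0 < 1 -> rad1 (pdivide_iter a w0 k).
Proof. intros Ha Hw. induction k; simpl; auto using rad1_pdivide. Qed.

Lemma PS_pdivide_iter a w0 k z : rad1 a -> Cmod w0 < 1 -> Cmod z < 1 ->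
  (forall j, (j < k)%nat -> PS (pdivide_iter a w0 j) w0 = 0) ->
  PS a z = ((z - w0) ^ k * PS (pdivide_iter a w0 k) z)%C.
Proof.
  intros Ha Hw Hz. induction k as [|k IH]; intros Hj.
  - simpl. ring.
  - rewrite IH by auto.
    rewrite (PS_pdivide (pdivide_iter a w0 k) w0 z), Hj by (auto using rad1_pdivide_iter).
    simpl. ring.
Qed.

(** Divide repeatedly by z - w0. If some quotient is nonzero at w0, the first such gives f(z) = (z -
    w0)^k times a function without zeros nearby. Otherwise this factorisation holds for every k with
    quotients of size O(e^(-k)), e = rho - |w0|, which forces f(z) = 0 for |z - w0| < e. *)
Lemma PS_zero_isolated a w0 : rad1 a -> Cmod w0 < 1 ->
  (exists del, 0 < del /\ forall z, Cmod (z - w0) < del -> PS a z = 0) \/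
  (exists del, 0 < del /\ forall z, 0 < Cmod (z - w0) < del -> PS a z <> 0).
Proof.
  intros Ha Hw. assert (H0 := Cmod_ge_0 w0).
  destruct (classic (exists k, PS (pdivide_iter a w0 k) w0 <> 0)) as [Hex|Hno].
  - right.
    assert (Hmin : exists k, PS (pdivide_iter a w0 k) w0 <> 0 /\
      forall j, (j < k)%nat -> PS (pdivide_iter a w0 j) w0 = 0).
    { destruct Hex as [k0 Hk0]. revert Hk0. induction k0 as [k0 IH] using lt_wf_ind. intros Hk0.
      destruct (classic (exists j, (j < k0)%nat /\ PS (pdivide_iter a w0 j) w0 <> 0)) as [[j [Hj Hj']]|Hn].
      - apply (IH j); auto.
      - exists k0. split; auto. intros j Hj. apply NNPP. intros Hj'. apply Hn. exists j. auto. }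
    destruct Hmin as [k [Hk Hj]].
    assert (Hr := rad1_pdivide_iter a w0 k Ha Hw).
    assert (P := proj1 (Cmod_gt_0 _) Hk).
    destruct (PS_ccont _ w0 Hr Hw (Cmod (PS (pdivide_iter a w0 k) w0)) P) as [d [Hd Hc]].
    exists (Rmin d (1 - Cmod w0)). split; [apply Rmin_pos; lra|].
    intros z [Hz0 Hz].
    assert (T1 := Rlt_le_trans _ _ _ Hz (Rmin_l _ _)).
    assert (T2 := Rlt_le_trans _ _ _ Hz (Rmin_r _ _)).
    assert (Hz1 : Cmod z < 1).
    { assert (T := Cmod_triangle (z - w0) w0). replace (z - w0 + w0)%C with z in T by ring. lra. }
    rewrite (PS_pdivide_iter a w0 k z) by auto.
    apply Cmult_neq_0.
    + apply Cpow_nz. apply Cmod_gt_0; auto.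
    + specialize (Hc _ T1). replace (w0 + (z - w0))%C with z in Hc by ring.
      intros E. rewrite E in Hc. replace (0 - PS (pdivide_iter a w0 k) w0)%C
        with (- PS (pdivide_iter a w0 k) w0)%C in Hc by ring. rewrite Cmod_opp in Hc. lra.
  - left.
    assert (Hall : forall k, PS (pdivide_iter a w0 k) w0 = 0).
    { intros k. apply NNPP. intros H. apply Hno. exists k. exact H. }
    set (rho := (1 + Cmod w0) / 2).
    assert (Hrho : Cmod w0 < rho < 1) by (unfold rho; lra).
    set (e := rho - Cmod w0). assert (He : 0 < e) by (unfold e; lra).
    destruct (Ha rho) as [A HA]; [lra|].
    assert (HB : forall k n, Cmod (pdivide_iter a w0 k n) * rho ^ n <= A / e ^ k).
    { induction k as [|k IH]; intros n.
      - simpl. replace (A / 1) with A by field. apply HA.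
      - simpl pdivide_iter. eapply Rle_trans; [apply (pdivide_bound _ w0 rho (A / e ^ k)); [lra|exact IH]|].
        fold e. right. simpl. field. split; [apply pow_nonzero|]; lra. }
    exists e. split; auto. intros z Hz.
    assert (Hz1 : Cmod z < rho).
    { assert (T := Cmod_triangle (z - w0) w0). replace (z - w0 + w0)%C with z in T by ring. unfold e in Hz. lra. }
    assert (Hzq : 0 <= Cmod z / rho < 1).
    { assert (P := Cmod_ge_0 z). split; [apply Rdiv_le_0_compat; lra|apply Rlt_div_l; lra]. }
    set (G := / (1 - Cmod z / rho)).
    assert (HG : 0 < G) by (apply Rinv_0_lt_compat; lra).
    assert (A0 : 0 <= A).
    { eapply Rle_trans; [|apply (HA O)]. simpl. assert (P := Cmod_ge_0 (a O)). lra. }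
    assert (Bd : forall k, Cmod (PS a z) <= (Cmod (z - w0) / e) ^ k * (A * G)).
    { intros k. rewrite (PS_pdivide_iter a w0 k z) by (auto; lra).
      rewrite Cmod_mult, Cmod_pow.
      replace ((Cmod (z - w0) / e) ^ k * (A * G)) with (Cmod (z - w0) ^ k * (A / e ^ k * G)).
      2: { unfold Rdiv at 2. rewrite Rpow_mult_distr, pow_inv. field. apply pow_nonzero. lra. }
      apply Rmult_le_compat_l; [apply pow_le, Cmod_ge_0|].
      unfold G. rewrite <- Series_geom by (rewrite Rabs_pos_eq; lra). rewrite <- Series_scal_l.
      apply Cmod_Csum_le'.
      - intros n. rewrite Cmod_mult, Cmod_pow.
        assert (Pn : 0 < rho ^ n) by (apply pow_lt; lra).
        specialize (HB k n). apply (Rle_div_r _ _ (rho ^ n)) in HB; auto.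
        replace (A / e ^ k * (Cmod z / rho) ^ n) with (A / e ^ k / rho ^ n * Cmod z ^ n).
        + apply Rmult_le_compat_r; auto. apply pow_le, Cmod_ge_0.
        + replace ((Cmod z / rho) ^ n) with (Cmod z ^ n * / rho ^ n) by (unfold Rdiv; rewrite Rpow_mult_distr, pow_inv; reflexivity). field.
          split; apply pow_nonzero; lra.
      - apply (@ex_series_scal R_AbsRing R_NormedModule), ex_series_geom. rewrite Rabs_pos_eq; lra. }
    assert (Hze : 0 <= Cmod (z - w0) / e < 1).
    { assert (P := Cmod_ge_0 (z - w0)). split; [apply Rdiv_le_0_compat; lra|apply Rlt_div_l; lra]. }
    apply NNPP. intros Hne. apply Cmod_gt_0 in Hne.
    destruct (pow_lt_1_zero (Cmod (z - w0) / e)) with (y := Cmod (PS a z) / (A * G + 1)) as [N HN].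
    + rewrite Rabs_pos_eq; lra.
    + assert (0 <= A * G) by nra. apply Rdiv_lt_0_compat; lra.
    + specialize (HN N (le_n _)). specialize (Bd N).
      assert (HAG : 0 <= A * G) by nra.
      rewrite Rabs_pos_eq in HN by (apply pow_le; lra).
      apply Rlt_div_r in HN; [|lra].
      assert (0 <= (Cmod (z - w0) / e) ^ N) by (apply pow_le; lra). nra.
Qed.

Definition injective_on_disk (F : C -> C) : Prop :=
  forall z w, Cmod z < 1 -> Cmod w < 1 -> F z = F w -> z = w.

(* If f'(w0) = 0, the central difference quotients F_t(w) = (f(w+t) - f(w-t)) / 2t are close to f',
   hence much smaller at w0 than on a circle around w0, and so must vanish somewhere inside. *)
Lemma univalent_deriv_nonzero a w0 : rad1 a ->
  injective_on_disk (PS a) -> Cmod w0 < 1 -> PS (pderiv a) w0 <> 0.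
Proof.
  intros Ha Hinj Hw Hzero. assert (H0 := Cmod_ge_0 w0).
  assert (Hda := rad1_pderiv a Ha).
  set (gap := 1 - Cmod w0). assert (Hgap : 0 < gap) by (unfold gap; lra).
  destruct (PS_zero_isolated (pderiv a) w0 Hda Hw) as [[del [Hdel Hz]]|[del [Hdel Hz]]].
  (* If f' vanishes near w0, f is constant on a short segment, against injectivity. *)
  - set (d := Rmin del gap / 2).
    assert (A1 := Rmin_l del gap). assert (A2 := Rmin_r del gap).
    assert (A3 : 0 < Rmin del gap) by (apply Rmin_pos; auto).
    assert (Hd : 0 < d) by (unfold d; lra).
    assert (In : forall s, 0 <= s <= 1 -> Cmod (w0 + RtoC s * RtoC d) < 1 /\ Cmod (w0 + RtoC s * RtoC d - w0) < del).
    { intros s Hs.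
      assert (E : Cmod (RtoC s * RtoC d) = s * d) by (rewrite <- RtoC_mult, Cmod_R, Rabs_pos_eq; nra).
      assert (T := Cmod_triangle w0 (RtoC s * RtoC d)). rewrite E in T.
      replace (w0 + RtoC s * RtoC d - w0)%C with (RtoC s * RtoC d)%C by ring. rewrite E.
      assert (s * d <= d) by nra. unfold d, gap in *. lra. }
    assert (E := rderiv_zero_const (fun s => PS a (w0 + RtoC s * RtoC d)%C) 0 1 Rle_0_1).
    assert (E' : PS a (w0 + RtoC 0 * RtoC d) = PS a (w0 + RtoC 1 * RtoC d)).
    { apply E. intros s Hs. destruct (In s Hs) as [I1 I2].
      replace (RtoC 0) with (PS (pderiv a) (w0 + RtoC s * RtoC d) * RtoC d)%C by (rewrite Hz by auto; ring).
      apply (rderiv_comp (PS a) (fun s => w0 + RtoC s * RtoC d)%C).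
      - assert (K := rderiv_plus _ _ s _ _ (rderiv_const w0 s) (rderiv_line (RtoC d) s)).
        rewrite Cplus_0_l in K. exact K.
      - apply PS_cdiff; auto. }
    apply Hinj in E'; [|apply In; lra|apply In; lra].
    assert (E2 : RtoC d = 0).
    { replace (RtoC d) with ((w0 + RtoC 1 * RtoC d) - (w0 + RtoC 0 * RtoC d))%C by ring.
      rewrite E'. ring. }
    apply RtoC_inj in E2. lra.
  - set (r := Rmin del gap / 4).
    assert (A1 := Rmin_l del gap). assert (A2 := Rmin_r del gap).
    assert (A3 : 0 < Rmin del gap) by (apply Rmin_pos; auto).
    assert (Hr : 0 < r < del /\ r <= gap / 4) by (unfold r; lra). destruct Hr as [Hr Hrg].
    assert (Tri : forall z s, Cmod (z - w0) <= s -> Cmod z <= Cmod w0 + s).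
    { intros z s Hs. assert (T := Cmod_triangle (z - w0) w0). replace (z - w0 + w0)%C with z in T by ring. lra. }
    destruct (circle_min (PS (pderiv a)) w0 r) as [m [Hm Bm]]; [lra| | |].
    { intros z Hzr. apply PS_ccont; auto. assert (T := Tri z r (Req_le _ _ Hzr)). unfold gap in *. lra. }
    { intros z Hzr. apply Hz. lra. }
    destruct (PS_quad a (Cmod w0 + 3 * gap / 4) Ha) as [K [HK Q]]; [unfold gap; lra|].
    (* This t makes K t <= m / 4: then |F| >= m / 2 on the circle and |F(w0)| <= m / 4, while
       injectivity of f keeps F from vanishing. The minimum modulus principle is contradicted. *)
    set (t := Rmin (gap / 4) (m / (4 * (K + 1)))).
    assert (B1 := Rmin_l (gap / 4) (m / (4 * (K + 1)))).
    assert (B2 := Rmin_r (gap / 4) (m / (4 * (K + 1)))).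
    assert (Ht : 0 < t).
    { apply Rmin_pos; [lra|]. apply Rdiv_lt_0_compat; lra. }
    fold t in B1, B2. apply Rle_div_r in B2; [|lra].
    assert (Ct : Cmod (RtoC t) = t) by (rewrite Cmod_R, Rabs_pos_eq; lra).
    assert (Htn : RtoC t <> 0) by (apply Cmod_gt_0; lra).
    set (F := fun w => (/ (RtoC 2 * RtoC t) * (PS a (w + RtoC t) - PS a (w - RtoC t)))%C).
    assert (In : forall w, Cmod (w - w0) <= gap / 2 ->
       Cmod w <= Cmod w0 + 3 * gap / 4 /\ Cmod (w + RtoC t) <= Cmod w0 + 3 * gap / 4 /\
       Cmod (w - RtoC t) <= Cmod w0 + 3 * gap / 4).
    { intros w Hww. apply Tri in Hww.
      assert (T1 := Cmod_triangle w (RtoC t)). assert (T2 := Cmod_triangle_minus w (RtoC t)).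
      rewrite Ct in T1, T2. lra. }
    assert (Lt1 : Cmod w0 + 3 * gap / 4 < 1) by (unfold gap; lra).
    assert (Close : forall w, Cmod (w - w0) <= gap / 2 -> Cmod (F w - PS (pderiv a) w) <= K * t).
    { intros w Hww. destruct (In w Hww) as [I1 [I2 I3]].
      assert (Q1 := Q w (RtoC t) I1 I2).
      assert (Q2 := Q w (- RtoC t)%C I1 I3).
      rewrite Cmod_opp in Q2. rewrite Ct in Q1, Q2.
      replace (F w - PS (pderiv a) w)%C with (/ (RtoC 2 * RtoC t) *
        ((PS a (w + RtoC t) - PS a w - PS (pderiv a) w * RtoC t)
         - (PS a (w + - RtoC t) - PS a w - PS (pderiv a) w * - RtoC t)))%C.
      2: { unfold F, Cminus. field. auto. }
      rewrite Cmod_mult, Cmod_inv, Cmod_mult, Ct, Cmod_R, Rabs_pos_eq by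
        (try lra; apply Cmult_neq_0; auto; intros E; apply RtoC_inj in E; lra).
      match goal with |- _ * Cmod ?X <= _ => assert (T : Cmod X <= 2 * (K * t ^ 2)) end.
      { eapply Rle_trans; [apply Cmod_triangle_minus|]. lra. }
      apply Rle_trans with (/ (2 * t) * (2 * (K * t ^ 2))).
      - apply Rmult_le_compat_l; auto. apply Rlt_le, Rinv_0_lt_compat; lra.
      - right. field. lra. }
    assert (HF : holo (fun z => Cmod (z - w0) < gap / 2) F).
    { apply holo_mult; [apply holo_const|]. apply holo_minus.
      - apply (holo_comp _ (fun z => Cmod z < 1) (PS a) (fun w => w + RtoC t)%C).
        + apply holo_plus; [apply holo_id|apply holo_const].
        + apply PS_holo; auto.
        + intros z Hzz. destruct (In z (Rlt_le _ _ Hzz)) as [_ [I2 _]]. lra.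
      - apply (holo_comp _ (fun z => Cmod z < 1) (PS a) (fun w => w - RtoC t)%C).
        + apply holo_minus; [apply holo_id|apply holo_const].
        + apply PS_holo; auto.
        + intros z Hzz. destruct (In z (Rlt_le _ _ Hzz)) as [_ [_ I3]]. lra. }
    assert (Bad : m / 2 <= Cmod (F w0)).
    { apply (min_modulus F w0 (gap / 2) r); auto; try lra.
      - intros z Hzz. destruct (In z (Rlt_le _ _ Hzz)) as [_ [I2 I3]]. unfold F.
        apply Cmult_neq_0.
        + intros E. apply (f_equal (Cmult (RtoC 2 * RtoC t))) in E.
          rewrite Cinv_r, Cmult_0_r in E; [apply RtoC_inj in E; lra|].
          apply Cmult_neq_0; auto. intros E2. apply RtoC_inj in E2. lra.
        + intros E. apply Ceq_minus in E. apply Hinj in E; [|lra|lra].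
          assert (E2 : (RtoC 2 * RtoC t)%C = 0).
          { replace (RtoC 2 * RtoC t)%C with ((z + RtoC t) - (z - RtoC t))%C by ring. rewrite E. ring. }
          rewrite <- RtoC_mult in E2. apply RtoC_inj in E2. lra.
      - intros z Hzr. specialize (Bm z Hzr).
        assert (Cl := Close z). rewrite Hzr in Cl. specialize (Cl ltac:(lra)).
        assert (T := Cmod_reverse_triangle (PS (pderiv a) z) (PS (pderiv a) z - F z)%C).
        replace (PS (pderiv a) z - (PS (pderiv a) z - F z))%C with (F z) in T by ring.
        rewrite (Cmod_minus_sym (PS (pderiv a) z)) in T. nra. }
    assert (Cl := Close w0). replace (w0 - w0)%C with (RtoC 0) in Cl by ring. rewrite Cmod_0 in Cl.
    specialize (Cl ltac:(lra)). rewrite Hzero in Cl.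
    replace (F w0 - 0)%C with (F w0) in Cl by ring. nra.
Qed.

(** * Holomorphic lifts through a univalent function *)

(** With k the increment of H, the increment of F(H) is both g' t + o(t) and p k + o(k). Continuity
    of H makes the second expansion available, and p <> 0 allows o(k) to be absorbed. *)
Lemma cdiff_lift (F H : C -> C) (z0 p g' : C) : p <> 0 -> cdiff F (H z0) p -> ccont H z0 ->
  cdiff (fun z => F (H z)) z0 g' -> cdiff H z0 (g' / p)%C.
Proof.
  intros Hp HF Hc HG eps He.
  assert (P := proj1 (Cmod_gt_0 p) Hp). assert (G0 := Cmod_ge_0 g').
  (* From |p| |k| <= (|g'| + e1) |t| + e2 |k| with e1 <= 1 and e2 <= |p| / 2 one gets |k| <= B
     |t|. *)
  set (B := 2 * (1 + Cmod g') / Cmod p).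
  assert (HB : 0 < B) by (apply Rdiv_lt_0_compat; lra).
  set (e1 := Rmin 1 (eps * Cmod p / 2)).
  set (e2 := Rmin (Cmod p / 2) (eps * Cmod p / (2 * B))).
  assert (He1 : 0 < e1) by (apply Rmin_pos; nra).
  assert (He2 : 0 < e2) by (apply Rmin_pos; [lra|apply Rdiv_lt_0_compat; nra]).
  destruct (HF e2 He2) as [d2 [Hd2 K2]].
  destruct (HG e1 He1) as [d1 [Hd1 K1]].
  destruct (Hc d2 Hd2) as [d3 [Hd3 K3]].
  exists (Rmin d1 d3). split; [apply Rmin_pos; auto|]. intros t Ht.
  specialize (K1 t (Rlt_le_trans _ _ _ Ht (Rmin_l _ _))).
  specialize (K3 t (Rlt_le_trans _ _ _ Ht (Rmin_r _ _))).
  specialize (K2 _ K3).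
  replace (H z0 + (H (z0 + t) - H z0))%C with (H (z0 + t)%C) in K2 by ring.
  set (k := (H (z0 + t)%C - H z0)%C) in *.
  set (D := (F (H (z0 + t)%C) - F (H z0))%C) in *.
  assert (Tp := Cmod_ge_0 t). assert (Kp := Cmod_ge_0 k).
  assert (A1 : e1 <= 1) by apply Rmin_l. assert (A2 : e1 <= eps * Cmod p / 2) by apply Rmin_r.
  assert (A3 : e2 <= Cmod p / 2) by apply Rmin_l.
  assert (A4 : e2 <= eps * Cmod p / (2 * B)) by apply Rmin_r.
  apply (Rle_div_r _ _ (2 * B)) in A4; [|lra].
  assert (T : Cmod (p * k - g' * t) <= e1 * Cmod t + e2 * Cmod k).
  { replace (p * k - g' * t)%C with ((D - g' * t) - (D - p * k))%C by ring.
    eapply Rle_trans; [apply Cmod_triangle_minus|]. lra. }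
  assert (Bk : Cmod k <= B * Cmod t).
  { assert (T2 := Cmod_triangle (p * k - g' * t) (g' * t)).
    replace (p * k - g' * t + g' * t)%C with (p * k)%C in T2 by ring.
    rewrite !Cmod_mult in T2. unfold B.
    replace (2 * (1 + Cmod g') / Cmod p * Cmod t) with (2 * (1 + Cmod g') * Cmod t / Cmod p) by (field; lra).
    apply (Rle_div_r _ _ (Cmod p)); auto. nra. }
  replace (k - g' / p * t)%C with ((p * k - g' * t) / p)%C by (field; auto).
  rewrite Cmod_div by auto. apply (Rle_div_l _ _ (Cmod p)); auto.
  assert (e2 * Cmod k <= e2 * (B * Cmod t)) by nra.
  nra.
Qed.

(** If y had no preimage near w0, f - y would have no zero there; yet it is smaller at w0 than on a
    circle around w0, where injectivity keeps f away from f(w0). *)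
Lemma univalent_open a w0 eps : rad1 a -> injective_on_disk (PS a) -> Cmod w0 < 1 -> 0 < eps -> exists eta, 0 < eta /\
  forall y, Cmod (y - PS a w0) < eta -> exists w, Cmod w < 1 /\ Cmod (w - w0) < eps /\ PS a w = y.
Proof.
  intros Ha Hinj Hw He. assert (H0 := Cmod_ge_0 w0).
  set (R0 := Rmin eps (1 - Cmod w0)).
  assert (A1 : R0 <= eps) by apply Rmin_l. assert (A2 : R0 <= 1 - Cmod w0) by apply Rmin_r.
  assert (A3 : 0 < R0) by (apply Rmin_pos; lra).
  assert (In : forall z, Cmod (z - w0) < R0 -> Cmod z < 1).
  { intros z Hz. assert (T := Cmod_triangle (z - w0) w0). replace (z - w0 + w0)%C with z in T by ring. lra. }
  assert (HF : forall y, holo (fun z => Cmod (z - w0) < R0) (fun z => PS a z - y)%C).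
  { intros y. apply holo_minus; [|apply holo_const]. apply holo_sub with (2 := PS_holo a Ha). exact In. }
  destruct (circle_min (fun z => PS a z - PS a w0)%C w0 (R0 / 2)) as [m [Hm Bm]]; [lra| | |].
  { intros z Hz. eapply holo_ccont; [apply HF|]. simpl. lra. }
  { intros z Hz E. apply Ceq_minus in E. apply Hinj in E; auto.
    - rewrite E in Hz. replace (w0 - w0)%C with (RtoC 0) in Hz by ring. rewrite Cmod_0 in Hz. lra.
    - apply In. lra. }
  exists (m / 2). split; [lra|]. intros y Hy. apply NNPP. intros Hno.
  assert (Bad : m / 2 <= Cmod (PS a w0 - y)).
  { apply (min_modulus (fun z => PS a z - y)%C w0 R0 (R0 / 2)); auto; try lra.
    - intros z Hz E. apply Hno. exists z. split; [apply In; auto|]. split; [lra|].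
      apply Ceq_minus. exact E.
    - intros z Hz. specialize (Bm z Hz).
      assert (T := Cmod_reverse_triangle (PS a z - PS a w0) (y - PS a w0)).
      replace (PS a z - PS a w0 - (y - PS a w0))%C with (PS a z - y)%C in T by ring. lra. }
  rewrite Cmod_minus_sym in Bad. lra.
Qed.

(** Openness at h(z) gives g(z + t) a preimage near h(z), and by injectivity that preimage is h(z +
    t). *)
Lemma lift_ccont a g h : rad1 a -> injective_on_disk (PS a) ->
  holo (fun z => Cmod z < 1) g -> (forall z, Cmod z < 1 -> Cmod (h z) < 1) ->
  (forall z, Cmod z < 1 -> PS a (h z) = g z) ->
  forall z, Cmod z < 1 -> ccont h z.
Proof.
  intros Ha Hinj Hg Hh Hgh z Hz eps He.
  destruct (univalent_open a (h z) eps Ha Hinj (Hh z Hz) He) as [eta [Heta Ho]].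
  destruct (holo_ccont _ _ z Hg Hz eta Heta) as [d [Hd Hc]].
  exists (Rmin d (1 - Cmod z)). split; [apply Rmin_pos; lra|]. intros t Ht.
  assert (T1 := Rlt_le_trans _ _ _ Ht (Rmin_l _ _)).
  assert (T2 := Rlt_le_trans _ _ _ Ht (Rmin_r _ _)).
  assert (Hzt : Cmod (z + t) < 1) by (assert (T := Cmod_triangle z t); lra).
  specialize (Hc t T1). rewrite <- (Hgh z Hz) in Hc.
  destruct (Ho _ Hc) as [w [Hw1 [Hw2 Hw3]]].
  rewrite <- (Hgh _ Hzt) in Hw3. apply Hinj in Hw3; auto. rewrite <- Hw3. exact Hw2.
Qed.

Lemma lift_holo a g h : rad1 a -> injective_on_disk (PS a) ->
  holo (fun z => Cmod z < 1) g -> (forall z, Cmod z < 1 -> Cmod (h z) < 1) ->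
  (forall z, Cmod z < 1 -> PS a (h z) = g z) ->
  holo (fun z => Cmod z < 1) h.
Proof.
  intros Ha Hinj Hg Hh Hgh. assert (Hcont := lift_ccont a g h Ha Hinj Hg Hh Hgh).
  destruct Hg as [g' Hg']. exists (fun z => g' z * / PS (pderiv a) (h z))%C. intros z Hz.
  destruct (Hg' z Hz) as [D1 D2].
  assert (Hn : PS (pderiv a) (h z) <> 0) by (apply univalent_deriv_nonzero; auto).
  split.
  - apply cdiff_lift with (PS a); auto.
    + apply PS_cdiff; auto.
    + apply cdiff_ext with g; auto. exists (1 - Cmod z). split; [lra|]. intros t Ht.
      symmetry. apply Hgh. assert (T := Cmod_triangle z t). lra.
  - apply ccont_mult; auto. apply ccont_inv; auto.
    apply ccont_comp; [auto|]. apply PS_ccont; auto. apply rad1_pderiv; auto.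
Qed.

(** * Coefficients of the lift *)

Lemma PS_expand5 a z : rad1 a -> Cmod z < 1 ->
  PS a z = (a 0%nat + z * (a 1%nat + z * (a 2%nat + z * (a 3%nat + z * (a 4%nat +
            z * PS (fun n => a (5 + n)%nat) z)))))%C.
Proof.
  intros Ha Hz.
  rewrite PS_incr by auto. do 2 f_equal.
  rewrite PS_incr by (auto; apply (rad1_shift a 1 Ha)). do 2 f_equal.
  rewrite PS_incr by (auto; apply (rad1_shift a 2 Ha)). do 2 f_equal.
  rewrite PS_incr by (auto; apply (rad1_shift a 3 Ha)). do 2 f_equal.
  rewrite PS_incr by (auto; apply (rad1_shift a 4 Ha)). reflexivity.
Qed.

(* Coefficients of (f(e^{i th} z) + f(e^{-i th} z)) / 2. *)
Definition gcoef (a : nat -> C) (th : R) (n : nat) : C := (a n * RtoC (cos (INR n * th)))%C.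

Lemma rad1_gcoef a th : rad1 a -> rad1 (gcoef a th).
Proof.
  intros Ha r Hr. destruct (Ha r Hr) as [M HM]. exists M. intros n.
  eapply Rle_trans; [|apply (HM n)]. apply Rmult_le_compat_r; [apply pow_le; lra|].
  unfold gcoef. rewrite Cmod_mult, Cmod_R.
  assert (B : Rabs (cos (INR n * th)) <= 1).
  { apply Rabs_le. assert (H := COS_bound (INR n * th)). lra. }
  assert (P := Cmod_ge_0 (a n)). assert (Q := Rabs_pos (cos (INR n * th))). nra.
Qed.

Lemma cis_pow th n : (cis th ^ n)%C = cis (INR n * th).
Proof.
  induction n as [|n IH].
  - simpl. rewrite Rmult_0_l. apply C_eq; simpl; [rewrite cos_0|rewrite sin_0]; reflexivity.
  - rewrite Cpow_S, IH, <- cis_plus, S_INR. f_equal. ring.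
Qed.

(** The second weight is left as 1 - 1/2 to match [convex_on_disk] at t = 1/2. *)
Lemma PS_gcoef a th z : rad1 a -> Cmod z < 1 ->
  PS (gcoef a th) z = (RtoC (1 / 2) * PS a (cis th * z) + RtoC (1 - 1 / 2) * PS a (cis (- th) * z))%C.
Proof.
  intros Ha Hz.
  assert (C1' : forall t, Cmod (cis t * z) < 1) by (intros t; rewrite Cmod_mult, Cmod_cis; lra).
  assert (S1 := PS_summable a _ Ha (C1' th)). assert (S2 := PS_summable a _ Ha (C1' (- th))).
  unfold PS at 2 3. rewrite <- !Csum_scal, <- Csum_plus by auto using summable_scal.
  apply Csum_ext. intros n. rewrite !Cpow_mult_l, !cis_pow. unfold gcoef.
  replace (INR n * - th) with (- (INR n * th)) by ring.
  replace (RtoC (1 - 1 / 2)) with (RtoC (1 / 2)) by (f_equal; field).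
  replace (cis (- (INR n * th))) with (Cconj (cis (INR n * th))).
  2: { unfold cis, Cconj. simpl. rewrite cos_neg, sin_neg. reflexivity. }
  set (e := cis (INR n * th)).
  replace (RtoC (cos (INR n * th))) with (RtoC (1 / 2) * (e + Cconj e))%C.
  - ring.
  - unfold e. apply C_eq; simpl; field.
Qed.

(* With x = cos th, the coefficients of (1 - h(z)/z) / (1 - x) for the lift h of
   (f(e^{i th} z) + f(e^{-i th} z)) / 2; at x = 1 they are the coefficients of 1 + z f''/f'. *)
Definition P1coef (a2 : C) (x : R) : C := (RtoC (1 + x) * a2)%C.
Definition P2coef (a2 a3 : C) (x : R) : C := (RtoC ((1 + x) * x) * (RtoC 3 * a3 - RtoC 2 * a2 * a2))%C.
Definition P3coef (a2 a3 a4 : C) (x : R) : C :=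
  (RtoC (1 + x) * (a4 * RtoC (7 * x * x - 1)
     - a2 * (RtoC (2 * x * x) * (RtoC 3 * a3 - RtoC 2 * a2 * a2) + a2 * a2 * RtoC (x * x - 1))
     - RtoC (3 * x * x) * a3 * a2))%C.

Lemma ccont_near_bound F z : ccont F z -> exists d M, 0 < d /\ 0 <= M /\
  forall t, Cmod t < d -> Cmod (F (z + t)%C) <= M.
Proof.
  intros H. destruct (H 1 Rlt_0_1) as [d [Hd K]]. exists d, (Cmod (F z) + 1).
  assert (P := Cmod_ge_0 (F z)). repeat split; auto; [lra|].
  intros t Ht. specialize (K t Ht).
  assert (T := Cmod_reverse_triangle (F (z + t)%C) (F z)). lra.
Qed.

Lemma holo_near_bound F : holo (fun z => Cmod z < 1) F -> exists d M, 0 < d /\ 0 <= M /\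
  forall z, Cmod z < d -> Cmod (F z) <= M.
Proof.
  intros H. destruct (ccont_near_bound F 0) as [d [M [Hd [HM K]]]].
  - eapply holo_ccont; [exact H|]. simpl. rewrite Cmod_0. lra.
  - exists d, M. repeat split; auto. intros z Hz. rewrite <- (Cplus_0_l z). auto.
Qed.

Ltac holo_tac :=
  lazymatch goal with
  | |- holo _ (fun z => Cplus (@?F z) (@?G z)) => apply (holo_plus _ F G); holo_tac
  | |- holo _ (fun z => Cmult (@?F z) (@?G z)) => apply (holo_mult _ F G); holo_tac
  | |- holo _ (fun z => z) => apply holo_id
  | |- holo _ (fun _ => ?c) => apply holo_const
  | |- _ => auto
  end.

(** The polynomial S found by solving f(S) = g order by order satisfies the equation up to O(z^5),
    and so does h exactly. Since the degree-four parts satisfy f4(h) - f4(S) = (h - S)(1 + Q) with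
    Q(0) = 0, the difference h - S is O(z^5). No expansion of h is presupposed beyond h(z) =
    O(z). *)
Lemma lift_expansion a x h : rad1 a -> a 0%nat = 0 -> a 1%nat = 1 ->
  injective_on_disk (PS a) -> 0 < x < 1 ->
  (forall z, Cmod z < 1 -> Cmod (h z) < 1) ->
  (forall z, Cmod z < 1 -> PS a (h z) = PS (gcoef a (acos x)) z) ->
  exists d K, 0 < d /\ forall z, Cmod z < d ->
    Cmod (h z - z * (RtoC x + RtoC (x - 1) * z * (P1coef (a 2%nat) x + z * (P2coef (a 2%nat) (a 3%nat) x
      + z * P3coef (a 2%nat) (a 3%nat) (a 4%nat) x))))%C <= K * Cmod z ^ 5.
Proof.
  intros Ha Ha0 Ha1 Hinj Hx Hh Hgh.
  assert (Hgr := rad1_gcoef a (acos x) Ha).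
  assert (Hhol := lift_holo a _ h Ha Hinj (PS_holo _ Hgr) Hh Hgh).
  assert (C01 : Cmod 0 < 1) by (rewrite Cmod_0; lra).
  assert (h0 : h 0 = 0).
  { apply Hinj; auto. rewrite Hgh by auto. rewrite !PS_0 by auto. unfold gcoef. rewrite Ha0. ring. }
  set (a2 := a 2%nat). set (a3 := a 3%nat). set (a4 := a 4%nat).
  set (h1 := RtoC x). set (h2 := (RtoC (x - 1) * P1coef a2 x)%C).
  set (h3 := (RtoC (x - 1) * P2coef a2 a3 x)%C). set (h4 := (RtoC (x - 1) * P3coef a2 a3 a4 x)%C).
  set (u := fun z => (h2 + z * (h3 + z * h4))%C).
  set (s := fun z => (h1 + z * u z)%C).
  set (S := fun z => (z * s z)%C).
  (* The explicit cofactor of z^5 in f4(S(z)) - g4(z), written out so that [EqS] is a polynomial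
     identity. *)
  set (E := fun z => (a2 * (RtoC 2 * h1 * h4 + RtoC 2 * h2 * h3 + z * (h3 * h3 + RtoC 2 * h2 * h4)
       + z * z * (RtoC 2 * h3 * h4) + z * z * z * (h4 * h4))
     + a3 * (RtoC 3 * h1 * h1 * (h3 + z * h4) + RtoC 3 * h1 * (u z * u z) + z * (u z * u z * u z))
     + a4 * (u z * (s z * s z * s z + s z * s z * h1 + s z * h1 * h1 + h1 * h1 * h1)))%C).
  set (f4 := fun w => (w + a2 * w * w + a3 * w * w * w + a4 * w * w * w * w)%C).
  (* Here f4(u) - f4(v) = (u - v)(1 + Q) with u = h z and v = S z. *)
  set (Q := fun z => (a2 * (h z + S z) + a3 * (h z * h z + h z * S z + S z * S z)
     + a4 * (h z * h z * h z + h z * h z * S z + h z * S z * S z + S z * S z * S z))%C).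
  set (Rg := PS (fun n => gcoef a (acos x) (5 + n))).
  set (Rf := PS (fun n => a (5 + n)%nat)).
  assert (Hu : forall U, holo U u) by (intros U; unfold u; holo_tac).
  assert (Hs : forall U, holo U s) by (intros U; unfold s; holo_tac).
  assert (HS : forall U, holo U S) by (intros U; unfold S; holo_tac).
  assert (HE : forall U, holo U E) by (intros U; unfold E; holo_tac).
  assert (HQ : holo (fun z => Cmod z < 1) Q) by (unfold Q; holo_tac).
  assert (cth : cos (acos x) = x) by (apply cos_acos; lra).
  assert (c2 : cos (INR 2 * acos x) = 2 * x * x - 1).
  { replace (INR 2 * acos x) with (2 * acos x) by (simpl; ring). rewrite cos_2a_cos, cth. ring. }
  assert (sth : sin (acos x) * sin (acos x) = 1 - x * x).
  { assert (H := sin2_cos2 (acos x)). unfold Rsqr in H. rewrite cth in H. lra. }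
  assert (c3 : cos (INR 3 * acos x) = 4 * x * x * x - 3 * x).
  { replace (INR 3 * acos x) with (2 * acos x + acos x) by (simpl; ring).
    rewrite cos_plus, cos_2a_cos, sin_2a, cth.
    replace (2 * sin (acos x) * x * sin (acos x)) with (2 * x * (sin (acos x) * sin (acos x))) by ring.
    rewrite sth. ring. }
  assert (c4 : cos (INR 4 * acos x) = 8 * x * x * x * x - 8 * x * x + 1).
  { replace (INR 4 * acos x) with (2 * (INR 2 * acos x)) by (simpl; ring).
    rewrite cos_2a_cos, c2. ring. }
  set (g4 := fun z => (z * (h1 + z * (a2 * RtoC (2 * x * x - 1) + z * (a3 * RtoC (4 * x * x * x - 3 * x)
      + z * (a4 * RtoC (8 * x * x * x * x - 8 * x * x + 1))))))%C).
  assert (EqS : forall z, f4 (S z) = (g4 z + z * z * z * z * z * E z)%C).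
  { intros z. unfold f4, S, E, s, u, g4, h1, h2, h3, h4, P1coef, P2coef, P3coef.
    repeat rewrite ?RtoC_plus, ?RtoC_minus, ?RtoC_mult. ring. }
  assert (Eqg : forall z, Cmod z < 1 -> PS (gcoef a (acos x)) z = (g4 z + z * z * z * z * z * Rg z)%C).
  { intros z Hz. rewrite PS_expand5 by auto. fold Rg. unfold gcoef.
    rewrite c2, c3, c4. fold a2 a3 a4. rewrite Ha0, Ha1.
    replace (INR 1 * acos x) with (acos x) by (simpl; ring). rewrite cth. unfold g4, h1. ring. }
  assert (Eqf : forall w, Cmod w < 1 -> PS a w = (f4 w + w * w * w * w * w * Rf w)%C).
  { intros w Hw. rewrite PS_expand5 by auto. fold Rf a2 a3 a4. rewrite Ha0, Ha1. unfold f4. ring. }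
  assert (Key : forall z, Cmod z < 1 -> ((h z - S z) * (1 + Q z))%C =
     (z * z * z * z * z * (Rg z - E z) - h z * h z * h z * h z * h z * Rf (h z))%C).
  { intros z Hz. assert (H := Hgh z Hz). rewrite Eqg, Eqf in H by auto.
    replace ((h z - S z) * (1 + Q z))%C with (f4 (h z) - f4 (S z))%C by (unfold f4, Q; ring).
    rewrite EqS.
    replace (f4 (h z)) with (g4 z + z * z * z * z * z * Rg z - h z * h z * h z * h z * h z * Rf (h z))%C
      by (rewrite <- H; ring).
    ring. }
  assert (HRgE : holo (fun z => Cmod z < 1) (fun z => Rg z - E z)%C).
  { apply holo_minus; auto. apply PS_holo. apply (rad1_shift _ 5 Hgr). }
  assert (HRf : holo (fun z => Cmod z < 1) (fun z => Rf (h z))).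
  { apply (holo_comp _ (fun z => Cmod z < 1) Rf h); auto. apply PS_holo. apply (rad1_shift _ 5 Ha). }
  destruct (holo_near_bound _ HRgE) as [d1 [M1 [Hd1 [HM1 B1]]]].
  destruct (holo_near_bound _ HRf) as [d2 [M2 [Hd2 [HM2 B2]]]].
  assert (Hlip : exists d C0, 0 < d /\ 0 <= C0 /\ forall z, Cmod z < d -> Cmod (h z) <= C0 * Cmod z).
  { destruct Hhol as [h' Hh']. destruct (Hh' 0 C01) as [D _].
    destruct (cdiff_bound _ _ _ D) as [d [Hd B]]. exists d, (1 + Cmod (h' 0)).
    assert (P := Cmod_ge_0 (h' 0)). repeat split; auto; [lra|].
    intros z Hz. specialize (B z Hz). rewrite Cplus_0_l, h0 in B.
    replace (h z - 0)%C with (h z) in B by ring. exact B. }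
  destruct Hlip as [d3 [C0 [Hd3 [HC0 B3]]]].
  assert (HQ0 : Q 0 = 0) by (unfold Q, S; rewrite h0; ring).
  destruct (holo_ccont _ _ 0 HQ C01 (1 / 2)) as [d4 [Hd4 B4]]; [lra|].
  exists (Rmin (Rmin d1 d2) (Rmin (Rmin d3 d4) 1)), (2 * (M1 + C0 ^ 5 * M2)).
  split; [repeat apply Rmin_pos; auto; lra|].
  intros z Hz.
  assert (T12 := Rlt_le_trans _ _ _ Hz (Rmin_l _ _)).
  assert (T345 := Rlt_le_trans _ _ _ Hz (Rmin_r _ _)).
  specialize (B1 z (Rlt_le_trans _ _ _ T12 (Rmin_l _ _))).
  specialize (B2 z (Rlt_le_trans _ _ _ T12 (Rmin_r _ _))).
  assert (T34 := Rlt_le_trans _ _ _ T345 (Rmin_l _ _)).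
  assert (T5 := Rlt_le_trans _ _ _ T345 (Rmin_r _ _)).
  specialize (B3 z (Rlt_le_trans _ _ _ T34 (Rmin_l _ _))).
  specialize (B4 z (Rlt_le_trans _ _ _ T34 (Rmin_r _ _))).
  rewrite Cplus_0_l, HQ0 in B4. replace (Q z - 0)%C with (Q z) in B4 by ring.
  specialize (Key z T5). apply (f_equal Cmod) in Key. rewrite Cmod_mult in Key.
  match goal with |- Cmod ?X <= _ => replace X with (h z - S z)%C end.
  2: { unfold S, s, u, h1, h2, h3, h4. ring. }
  assert (L1 : 1 / 2 <= Cmod (1 + Q z)).
  { assert (T := Cmod_reverse_triangle 1 (- Q z)). rewrite Cmod_opp, Cmod_1 in T.
    replace (1 - - Q z)%C with (1 + Q z)%C in T by ring. lra. }
  assert (Up : Cmod (h z - S z) * Cmod (1 + Q z) <= (M1 + C0 ^ 5 * M2) * Cmod z ^ 5).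
  { rewrite Key. eapply Rle_trans; [apply Cmod_triangle_minus|].
    replace (z * z * z * z * z)%C with (z ^ 5)%C by (simpl; ring).
    replace (h z * h z * h z * h z * h z)%C with (h z ^ 5)%C by (simpl; ring).
    rewrite !Cmod_mult, !Cmod_pow.
    assert (P5 : 0 <= Cmod z ^ 5) by (apply pow_le, Cmod_ge_0).
    assert (Q5 : Cmod (h z) ^ 5 <= C0 ^ 5 * Cmod z ^ 5).
    { rewrite <- Rpow_mult_distr. apply pow_incr. split; auto using Cmod_ge_0. }
    assert (Cmod z ^ 5 * Cmod (Rg z - E z) <= Cmod z ^ 5 * M1) by (apply Rmult_le_compat_l; auto).
    assert (Cmod (h z) ^ 5 * Cmod (Rf (h z)) <= C0 ^ 5 * Cmod z ^ 5 * M2).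
    { apply Rmult_le_compat; auto using Cmod_ge_0. apply pow_le, Cmod_ge_0. }
    lra. }
  assert (P := Cmod_ge_0 (h z - S z)). nra.
Qed.

(** * The Toeplitz inequality *)

Definition convex_on_disk (F : C -> C) : Prop :=
  forall z1 z2 t, Cmod z1 < 1 -> Cmod z2 < 1 -> 0 <= t <= 1 ->
    exists w, Cmod w < 1 /\ F w = (RtoC t * F z1 + RtoC (1 - t) * F z2)%C.

Lemma convex_univalent_lift a th : rad1 a -> convex_on_disk (PS a) ->
  exists h, (forall z, Cmod z < 1 -> Cmod (h z) < 1) /\
    forall z, Cmod z < 1 -> PS a (h z) = PS (gcoef a th) z.
Proof.
  intros Ha Hconv.
  set (Pr := fun z w => Cmod w < 1 /\ PS a w = PS (gcoef a th) z).
  exists (fun z => epsilon (inhabits (RtoC 0)) (Pr z)).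
  assert (H : forall z, Cmod z < 1 -> Pr z (epsilon (inhabits (RtoC 0)) (Pr z))).
  { intros z Hz. apply epsilon_spec.
    destruct (Hconv (cis th * z)%C (cis (- th) * z)%C (1 / 2)) as [w [Hw E]].
    - rewrite Cmod_mult, Cmod_cis; lra.
    - rewrite Cmod_mult, Cmod_cis; lra.
    - lra.
    - exists w. split; auto. rewrite E, PS_gcoef by auto. reflexivity. }
  split; intros z Hz; apply H; auto.
Qed.

(** Up to O(z^5), h(z) = z (1 - e P(z)) with P = 1 + p1 z + p2 z^2 + p3 z^3 and e = 1 - x. The left
    side is thus the square sum of the leading coefficients of q h, and |q h| <= |q| on the disk, so
    [Bessel_truncated] applies. *)
Lemma convex_contraction a x q0 q1 q2 q3 :
  rad1 a -> a 0%nat = 0 -> a 1%nat = 1 -> injective_on_disk (PS a) -> convex_on_disk (PS a) ->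
  0 < x < 1 ->
  let p1 := P1coef (a 2%nat) x in
  let p2 := P2coef (a 2%nat) (a 3%nat) x in
  let p3 := P3coef (a 2%nat) (a 3%nat) (a 4%nat) x in
  let e := RtoC (1 - x) in
  Cmod (q0 - e * q0) ^ 2 + Cmod (q1 - e * (q1 + p1 * q0)) ^ 2
   + Cmod (q2 - e * (q2 + p1 * q1 + p2 * q0)) ^ 2
   + Cmod (q3 - e * (q3 + p1 * q2 + p2 * q1 + p3 * q0)) ^ 2
  <= Cmod q0 ^ 2 + Cmod q1 ^ 2 + Cmod q2 ^ 2 + Cmod q3 ^ 2.
Proof.
  intros Ha Ha0 Ha1 Hinj Hconv Hx p1 p2 p3 e.
  destruct (convex_univalent_lift a (acos x) Ha Hconv) as [h [Hh Hgh]].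
  assert (Hhol := lift_holo a _ h Ha Hinj (PS_holo _ (rad1_gcoef a (acos x) Ha)) Hh Hgh).
  destruct (lift_expansion a x h Ha Ha0 Ha1 Hinj Hx Hh Hgh) as [d [K [Hd HK]]].
  fold p1 p2 p3 in HK.
  set (q := q0 :: q1 :: q2 :: q3 :: nil).
  (* The leading zero is the factor z of h; it gives s the length 5 that matches the O(z^5)
     error. *)
  set (s := RtoC 0 :: (q0 - e * q0)%C :: (q1 - e * (q1 + p1 * q0))%C
     :: (q2 - e * (q2 + p1 * q1 + p2 * q0))%C :: (q3 - e * (q3 + p1 * q2 + p2 * q1 + p3 * q0))%C :: nil).
  (* The cofactor of z^5 lost when the product of q with the polynomial part of h is truncated to
     s. *)
  set (T := fun z => (- e * ((q1 * p3 + q2 * p2 + q3 * p1) + z * (q2 * p3 + q3 * p2) + z * z * (q3 * p3)))%C).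
  assert (HT : holo (fun z => Cmod z < 1) T) by (unfold T; holo_tac).
  destruct (holo_near_bound _ HT) as [d1 [M1 [Hd1 [HM1 B1]]]].
  destruct (holo_near_bound _ (peval_holo _ q)) as [d2 [M2 [Hd2 [HM2 B2]]]].
  assert (B := Bessel_truncated (fun z => peval q z * h z)%C s q (Rmin d (Rmin d1 d2)) (M2 * K + M1)).
  unfold s, q in B. simpl pnorm in B. rewrite Cmod_0 in B.
  match type of B with _ -> _ -> _ -> _ -> ?X => assert (BX : X) end.
  2: { lra. }
  apply B; clear B.
  - apply holo_mult; auto. apply peval_holo.
  - intros z Hz. rewrite Cmod_mult. specialize (Hh z Hz).
    assert (P := Cmod_ge_0 (peval (q0 :: q1 :: q2 :: q3 :: nil) z)). nra.
  - repeat apply Rmin_pos; auto.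
  - intros z Hz.
    assert (T1 := Rlt_le_trans _ _ _ Hz (Rmin_l _ _)).
    assert (T23 := Rlt_le_trans _ _ _ Hz (Rmin_r _ _)).
    specialize (HK z T1).
    specialize (B1 z (Rlt_le_trans _ _ _ T23 (Rmin_l _ _))).
    specialize (B2 z (Rlt_le_trans _ _ _ T23 (Rmin_r _ _))).
    fold q s.
    set (S := (z * (RtoC x + RtoC (x - 1) * z * (p1 + z * (p2 + z * p3))))%C) in *.
    replace (peval q z * h z - peval s z)%C with (peval q z * (h z - S) + z ^ 5 * T z)%C.
    2: { unfold q, s, S, T, e. simpl peval. rewrite RtoC_minus, (RtoC_minus 1 x). simpl Cpow. ring. }
    eapply Rle_trans; [apply Cmod_triangle|]. rewrite !Cmod_mult, Cmod_pow.
    change (length s) with 5%nat.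
    assert (P5 : 0 <= Cmod z ^ 5) by (apply pow_le, Cmod_ge_0).
    assert (Cmod (peval q z) * Cmod (h z - S) <= M2 * (K * Cmod z ^ 5)).
    { apply Rmult_le_compat; auto using Cmod_ge_0. }
    assert (Cmod z ^ 5 * Cmod (T z) <= Cmod z ^ 5 * M1) by (apply Rmult_le_compat_l; auto).
    lra.
Qed.

Lemma Cmod_minus_scal_sqr u y e :
  Cmod (u - RtoC e * y) ^ 2 = Cmod u ^ 2 - 2 * e * fst (Cconj u * y)%C + e ^ 2 * Cmod y ^ 2.
Proof. rewrite !Cmod_sqr. simpl. ring. Qed.

(* The Caratheodory-Toeplitz inequality for 1 + z f''/f', the derivative at th = 0 of the previous
   contraction, where x = cos th. *)
Lemma convex_Toeplitz a q0 q1 q2 q3 :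
  rad1 a -> a 0%nat = 0 -> a 1%nat = 1 -> injective_on_disk (PS a) -> convex_on_disk (PS a) ->
  let p1 := P1coef (a 2%nat) 1 in
  let p2 := P2coef (a 2%nat) (a 3%nat) 1 in
  let p3 := P3coef (a 2%nat) (a 3%nat) (a 4%nat) 1 in
  0 <= fst (Cconj q0 * q0 + Cconj q1 * (q1 + p1 * q0) + Cconj q2 * (q2 + p1 * q1 + p2 * q0)
    + Cconj q3 * (q3 + p1 * q2 + p2 * q1 + p3 * q0))%C.
Proof.
  intros Ha Ha0 Ha1 Hinj Hconv p1 p2 p3.
  set (a2 := a 2%nat) in *. set (a3 := a 3%nat) in *. set (a4 := a 4%nat) in *.
  (* The form as a polynomial in a complex variable in place of x, so that its continuity at 1 is an
     instance of [holo]. *)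
  set (Psi := fun z => (Cconj q0 * q0 + Cconj q1 * (q1 + ((1 + z) * a2) * q0)
    + Cconj q2 * (q2 + ((1 + z) * a2) * q1 + ((1 + z) * z * (RtoC 3 * a3 + RtoC (-2) * a2 * a2)) * q0)
    + Cconj q3 * (q3 + ((1 + z) * a2) * q2 + ((1 + z) * z * (RtoC 3 * a3 + RtoC (-2) * a2 * a2)) * q1
       + ((1 + z) * (a4 * (RtoC 7 * z * z + RtoC (-1)) + RtoC (-1) * (a2 * ((RtoC 2 * z * z) * (RtoC 3 * a3 + RtoC (-2) * a2 * a2)
       + a2 * a2 * (z * z + RtoC (-1)))) + RtoC (-3) * z * z * a3 * a2)) * q0))%C).
  assert (HPsi : holo (fun _ => True) Psi) by (unfold Psi; holo_tac).
  assert (EPsi : forall x, Psi (RtoC x) = (Cconj q0 * q0 + Cconj q1 * (q1 + P1coef a2 x * q0)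
     + Cconj q2 * (q2 + P1coef a2 x * q1 + P2coef a2 a3 x * q0)
     + Cconj q3 * (q3 + P1coef a2 x * q2 + P2coef a2 a3 x * q1 + P3coef a2 a3 a4 x * q0))%C).
  { intros x. unfold Psi, P1coef, P2coef, P3coef.
    repeat rewrite ?RtoC_plus, ?RtoC_minus, ?RtoC_mult.
    replace (RtoC (-2)) with (- RtoC 2)%C by (rewrite <- RtoC_opp; f_equal; lra).
    replace (RtoC (-1)) with (- RtoC 1)%C by (rewrite <- RtoC_opp; f_equal; lra).
    replace (RtoC (-3)) with (- RtoC 3)%C by (rewrite <- RtoC_opp; f_equal; lra).
    ring. }
  unfold p1, p2, p3. rewrite <- EPsi.
  apply (nonneg_at_1 (fun x => fst (Psi (RtoC x)))).
  - intros eps He. destruct (holo_ccont _ _ (RtoC 1) HPsi I eps He) as [d [Hd H]].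
    exists d. split; auto. intros y [_ Hy]. simpl in *. unfold R_dist in *.
    specialize (H (RtoC (y - 1))). rewrite Cmod_R in H. specialize (H Hy).
    replace (RtoC 1 + RtoC (y - 1))%C with (RtoC y) in H by (rewrite RtoC_minus; ring).
    eapply Rle_lt_trans; [|exact H]. apply (re_le_Cmod (Psi (RtoC y) - Psi (RtoC 1))%C).
  - intros x Hx. assert (Ct := convex_contraction a x q0 q1 q2 q3 Ha Ha0 Ha1 Hinj Hconv Hx).
    cbv zeta in Ct. fold a2 a3 a4 in Ct. rewrite !Cmod_minus_scal_sqr in Ct.
    rewrite EPsi. rewrite !(re_plus : forall u v, fst (u + v)%C = fst u + fst v).
    (* The squares |q_k|^2 cancel in [Ct], leaving e^2 times a sum of squares <= 2 e times the form,
       with e = 1 - x > 0. *)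
    match goal with |- 0 <= ?A + ?B + ?D + ?E =>
      assert (2 * (1 - x) * (A + B + D + E) >= 0) end.
    { repeat match type of Ct with context [?e ^ 2 * Cmod ?y ^ 2] =>
        assert (0 <= e ^ 2 * Cmod y ^ 2) by (apply Rmult_le_pos; apply pow2_ge_0);
        set (e ^ 2 * Cmod y ^ 2) in * end.
      lra. }
    nra.
Qed.

(** * Coefficient bounds *)

Lemma fst_Cconj_mult_self u v : fst (Cconj (u - v) * (u + v))%C = Cmod u ^ 2 - Cmod v ^ 2.
Proof. rewrite !Cmod_sqr. simpl. ring. Qed.

(* The Toeplitz form evaluated at q = (1 - z w(z)) v, where 1 + z f''/f' = (1 + z w) / (1 - z w). *)
Lemma Schur_form a c w1 w2 v1 v2 :
  rad1 a -> a 0%nat = 0 -> a 1%nat = 1 -> injective_on_disk (PS a) -> convex_on_disk (PS a) ->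
  a 2%nat = RtoC c -> w1 = (RtoC 3 * a 3%nat - RtoC (3 * c ^ 2))%C ->
  w2 = (RtoC 6 * a 4%nat - RtoC (5 * c) * w1 - RtoC (6 * c ^ 3))%C ->
  c ^ 2 + Cmod (RtoC c * v1 + w1)%C ^ 2 + Cmod (RtoC c * v2 + w1 * v1 + w2)%C ^ 2
    <= 1 + Cmod v1 ^ 2 + Cmod v2 ^ 2.
Proof.
  intros Ha Ha0 Ha1 Hinj Hconv Ha2 Hw1 Hw2.
  set (x3 := (RtoC c * v2 + w1 * v1 + w2)%C). set (x2 := (RtoC c * v1 + w1)%C).
  (* These are the coefficients up to z^3 of (1 - z w) v, v = 1 + v1 z + v2 z^2. Multiplication by 1
     + z f''/f' gives those of (1 + z w) v, so each term is Re (conj (A - B) (A + B)) = |A|^2 -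
     |B|^2, with A a coefficient of v and B one of z w v. *)
  assert (T := convex_Toeplitz a 1 (v1 - RtoC c) (v2 - x2) (RtoC 0 - x3) Ha Ha0 Ha1 Hinj Hconv).
  cbv zeta in T. rewrite Ha2 in T.
  assert (E3 : a 3%nat = (RtoC (1 / 3) * (w1 + RtoC (3 * c ^ 2)))%C).
  { rewrite Hw1. replace (RtoC (3 * c ^ 2)) with (RtoC 3 * RtoC c ^ 2)%C by (rewrite RtoC_mult, RtoC_pow; reflexivity).
    rewrite RtoC_div by lra. field. }
  assert (E4 : a 4%nat = (RtoC (1 / 6) * (w2 + RtoC (5 * c) * w1 + RtoC (6 * c ^ 3)))%C).
  { rewrite Hw2. rewrite RtoC_div by lra. field. }
  match type of T with 0 <= fst (?A + Cconj _ * ?B + Cconj _ * ?D + Cconj _ * ?E)%C =>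
    replace B with (v1 + RtoC c)%C in T; [replace D with (v2 + x2)%C in T; [replace E with (RtoC 0 + x3)%C in T|]|] end.
  - rewrite !(re_plus : forall u v, fst (u + v)%C = fst u + fst v), !fst_Cconj_mult_self in T.
    rewrite Cmod_0, Cmod_R in T. replace (fst (Cconj 1 * 1)%C) with 1 in T by (simpl; ring).
    rewrite (pow2_abs c) in T. lra.
  - rewrite E4, E3. unfold x3, x2, P1coef, P2coef, P3coef. apply C_eq; simpl; field.
  - rewrite E3. unfold x2, P1coef, P2coef. apply C_eq; simpl; field.
  - unfold P1coef. apply C_eq; simpl; field.
Qed.

Lemma Cmod_sqr_0 z : Cmod z ^ 2 <= 0 -> z = 0.
Proof. intros H. apply Cmod_eq_0. assert (P := Cmod_ge_0 z). simpl in H. nra. Qed.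

(** The hypothesis says that multiplication by w, truncated after z^2, is a contraction on vectors
    (1, v1, v2). Eliminating v2 and then v1 by their optimal choices performs two steps of Schur's
    algorithm. For c = 1 the vector (1, 0, 0) already forces the other coefficients to vanish. *)
Lemma Schur_bounds c w1 w2 : 0 <= c <= 1 ->
  (forall v1 v2, c ^ 2 + Cmod (RtoC c * v1 + w1)%C ^ 2 + Cmod (RtoC c * v2 + w1 * v1 + w2)%C ^ 2
    <= 1 + Cmod v1 ^ 2 + Cmod v2 ^ 2) ->
  (c = 1 /\ w1 = 0 /\ w2 = 0) \/
  (c < 1 /\ Cmod w1 <= 1 - c ^ 2 /\
   (1 - c ^ 2) * Cmod (w2 + RtoC (c / (1 - c ^ 2)) * (w1 * w1))%C <= (1 - c ^ 2) ^ 2 - Cmod w1 ^ 2).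
Proof.
  intros Hc H. destruct (Req_dec c 1) as [->|Hc1].
  - left. assert (H0 := H 0 0).
    replace (RtoC 1 * 0 + w1)%C with w1 in H0 by ring.
    replace (RtoC 1 * 0 + w1 * 0 + w2)%C with w2 in H0 by ring.
    rewrite Cmod_0 in H0. assert (P1 := pow2_ge_0 (Cmod w1)). assert (P2 := pow2_ge_0 (Cmod w2)).
    split; auto. split; apply Cmod_sqr_0; lra.
  - right. split; [lra|]. set (s := 1 - c ^ 2). assert (Hs : 0 < s) by (unfold s; nra).
    set (dl := (w2 + RtoC (c / s) * (w1 * w1))%C).
    set (W := Cmod w1 ^ 2).
    assert (K : forall e, W + Cmod (dl + w1 * e)%C ^ 2 <= s ^ 2 + s ^ 2 * Cmod e ^ 2).
    (* Given A, the choice v2 = (c / s) A maximises |c v2 + A|^2 - |v2|^2, with value |A|^2 / s.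
       Centring v1 at (c / s) w1 removes the cross term and leaves e free. *)
    { intros e. set (v1 := (RtoC (c / s) * w1 + e)%C). set (A := (w1 * v1 + w2)%C).
      assert (H1 := H v1 (RtoC (c / s) * A)%C).
      replace (RtoC c * (RtoC (c / s) * A) + w1 * v1 + w2)%C with (RtoC (c * (c / s) + 1) * A)%C in H1.
      2: { unfold A. rewrite RtoC_plus, RtoC_mult. ring. }
      replace (c * (c / s) + 1) with (/ s) in H1 by (unfold s; field; unfold s in Hs; lra).
      rewrite !Cmod_mult, !Rpow_mult_distr, !Cmod_R, !pow2_abs in H1.
      replace (dl + w1 * e)%C with A by (unfold A, v1, dl; ring).
      assert (I1 : Cmod (RtoC c * v1 + w1)%C ^ 2 = Cmod v1 ^ 2 + W / s - s * Cmod e ^ 2).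
      { unfold v1, W. rewrite !Cmod_sqr. simpl. unfold s. field. unfold s in Hs. simpl in Hs. lra. }
      rewrite I1 in H1.
      replace ((/ s) ^ 2 * Cmod A ^ 2) with ((c / s) ^ 2 * Cmod A ^ 2 + Cmod A ^ 2 / s) in H1.
      2: { unfold s. field. unfold s in Hs. lra. }
      apply Rmult_le_reg_l with (/ s); [apply Rinv_0_lt_compat; auto|].
      replace (/ s * (W + Cmod A ^ 2)) with (W / s + Cmod A ^ 2 / s) by (field; lra).
      replace (/ s * (s ^ 2 + s ^ 2 * Cmod e ^ 2)) with (s + s * Cmod e ^ 2) by (field; lra).
      unfold s at 3. lra. }
    assert (K0 := K 0). replace (dl + w1 * 0)%C with dl in K0 by ring.
    rewrite Cmod_0 in K0.
    assert (P2 := pow2_ge_0 (Cmod dl)). assert (Wp : 0 <= W) by apply pow2_ge_0.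
    assert (W1 : Cmod w1 <= s).
    { assert (P := Cmod_ge_0 w1). unfold W in *. simpl in *. nra. }
    split; auto. assert (Dp := Cmod_ge_0 dl).
    destruct (Req_dec W (s ^ 2)) as [E|Hn].
    + assert (Cmod dl = 0) by (simpl in *; nra). fold W. nra.
    + assert (Hg : 0 < s ^ 2 - W) by (simpl in *; nra).
      (* The vector e = k conj(w1) dl maximises |dl + w1 e|^2 - s^2 |e|^2, whose maximum is s^2
         |dl|^2 / (s^2 - W). *)
      set (k := / (s ^ 2 - W)).
      assert (Kk := K (RtoC k * (Cconj w1 * dl))%C).
      replace (dl + w1 * (RtoC k * (Cconj w1 * dl)))%C with (RtoC (1 + k * W) * dl)%C in Kk.
      2: { unfold W. rewrite RtoC_plus, RtoC_mult, RtoC_pow.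
           replace (RtoC (Cmod w1) ^ 2)%C with (w1 * Cconj w1)%C.
           - ring.
           - rewrite <- Cmod2_conj, RtoC_pow. reflexivity. }
      rewrite !Cmod_mult, !Rpow_mult_distr, !Cmod_R, !pow2_abs, Cmod_conj in Kk. fold W in Kk.
      set (D2 := Cmod dl ^ 2) in *.
      assert (I : (1 + k * W) ^ 2 * D2 - s ^ 2 * (k ^ 2 * (W * D2)) = s ^ 2 * D2 * k).
      { unfold k. field. lra. }
      assert (L : s ^ 2 * D2 * k <= s ^ 2 - W) by lra.
      unfold k in L. apply (Rle_div_l _ _ (s ^ 2 - W)) in L; auto.
      fold W. apply Rsqr_incr_0_var; [|lra]. unfold Rsqr, D2 in *. simpl in *. nra.
Qed.

(** Here 3 (a_3 - a_2) = w1 - 3 c (1 - c) and 6 (a_4 - a_3) = w2 + (5 c - 2) w1 - 6 c^2 (1 - c); the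
    triangle inequality does the rest. The parameter is r = |w1| / (1 - c^2), over which the
    quadratic remains to be maximised. *)
Lemma coef_bounds a c :
  rad1 a -> a 0%nat = 0 -> a 1%nat = 1 -> injective_on_disk (PS a) -> convex_on_disk (PS a) ->
  a 2%nat = RtoC c -> 0 <= c <= 1 ->
  3 * Cmod (a 3%nat - a 2%nat)%C <= (1 - c) * (1 + 4 * c) /\
  exists r, 0 <= r <= 1 /\
    6 * Cmod (a 4%nat - a 3%nat)%C <=
      (1 - c) * ((1 + c) * (1 + Rabs (5 * c - 2) * r - (1 - c) * r ^ 2) + 6 * c ^ 2).
Proof.
  intros Ha Ha0 Ha1 Hinj Hconv Ha2 Hc.
  set (w1 := (RtoC 3 * a 3%nat - RtoC (3 * c ^ 2))%C).
  set (w2 := (RtoC 6 * a 4%nat - RtoC (5 * c) * w1 - RtoC (6 * c ^ 3))%C).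
  assert (S := fun v1 v2 => Schur_form a c w1 w2 v1 v2 Ha Ha0 Ha1 Hinj Hconv Ha2 eq_refl eq_refl).
  apply Schur_bounds in S; auto.
  assert (E3 : (RtoC 3 * (a 3%nat - a 2%nat))%C = (w1 - RtoC (3 * c * (1 - c)))%C).
  { rewrite Ha2. unfold w1. apply C_eq; simpl; ring. }
  assert (E4 : (RtoC 6 * (a 4%nat - a 3%nat))%C = (w2 + RtoC (5 * c - 2) * w1 - RtoC (6 * c ^ 2 * (1 - c)))%C).
  { unfold w2, w1. apply C_eq; simpl; ring. }
  assert (M3 : 3 * Cmod (a 3%nat - a 2%nat)%C = Cmod (w1 - RtoC (3 * c * (1 - c)))%C).
  { rewrite <- E3, Cmod_mult, Cmod_R, Rabs_pos_eq; lra. }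
  assert (M4 : 6 * Cmod (a 4%nat - a 3%nat)%C = Cmod (w2 + RtoC (5 * c - 2) * w1 - RtoC (6 * c ^ 2 * (1 - c)))%C).
  { rewrite <- E4, Cmod_mult, Cmod_R, Rabs_pos_eq; lra. }
  rewrite M3, M4.
  destruct S as [[E [-> ->]]|[Hc1 [B1 B2]]].
  - split; [|exists 0; split; [lra|]].
    + rewrite E. replace (0 - RtoC (3 * 1 * (1 - 1)))%C with (RtoC 0) by (apply C_eq; simpl; ring).
      rewrite Cmod_0. lra.
    + rewrite E. replace (0 + RtoC (5 * 1 - 2) * 0 - RtoC (6 * 1 ^ 2 * (1 - 1)))%C with (RtoC 0) by (apply C_eq; simpl; ring).
      rewrite Cmod_0. lra.
  - split.
    + eapply Rle_trans; [apply Cmod_triangle_minus|]. rewrite Cmod_R, Rabs_pos_eq by nra. nra.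
    + set (s := 1 - c ^ 2) in *. assert (Hs : 0 < s) by (unfold s; nra).
      assert (P := Cmod_ge_0 w1).
      exists (Cmod w1 / s). split.
      { split; [apply Rdiv_le_0_compat; auto|apply Rle_div_l; lra]. }
      set (dl := (w2 + RtoC (c / s) * (w1 * w1))%C) in *.
      replace (w2 + RtoC (5 * c - 2) * w1 - RtoC (6 * c ^ 2 * (1 - c)))%C
        with (((dl - RtoC (c / s) * (w1 * w1)) + RtoC (5 * c - 2) * w1) - RtoC (6 * c ^ 2 * (1 - c)))%C
        by (unfold dl; ring).
      eapply Rle_trans; [apply Cmod_triangle_minus|].
      eapply Rle_trans; [apply Rplus_le_compat_r, Cmod_triangle|].
      eapply Rle_trans; [apply Rplus_le_compat_r, Rplus_le_compat_r, Cmod_triangle_minus|].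
      rewrite !Cmod_mult, !Cmod_R.
      assert (Hcs : 0 <= c / s) by (apply Rdiv_le_0_compat; lra).
      rewrite (Rabs_pos_eq (c / s)), (Rabs_pos_eq (6 * c ^ 2 * (1 - c))) by (auto; nra).
      assert (B3 : Cmod dl <= (s ^ 2 - Cmod w1 ^ 2) / s).
      { apply (Rle_div_r _ _ s); lra. }
      set (R := Cmod w1) in *. set (b := Rabs (5 * c - 2)).
      replace ((1 - c) * ((1 + c) * (1 + b * (R / s) - (1 - c) * (R / s) ^ 2) + 6 * c ^ 2))
        with ((s ^ 2 - R ^ 2) / s + c / s * (R * R) + b * R + 6 * c ^ 2 * (1 - c)).
      * lra.
      * unfold s. field. unfold s in Hs. lra.
Qed.

(** A concave quadratic in r with vertex |5 c - 2| / (2 (1 - c)) for c < 1. The vertex reaches r = 1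
    at c = 4/7, which is the threshold p = 8/7: below it the square is completed, above it the
    maximum over [0, 1] is at r = 1. *)
Lemma bound4_le c r : 0 <= c <= 1 -> 0 <= r <= 1 ->
  (1 - c) * ((1 + c) * (1 + Rabs (5 * c - 2) * r - (1 - c) * r ^ 2) + 6 * c ^ 2) <= 6 * bound4 (2 * c).
Proof.
  intros Hc Hr. unfold bound4. destruct (Rlt_dec (2 * c) (8 / 7)) as [L|L].
  - assert (E : 6 * (((2 * c) ^ 3 + 50 * (2 * c) ^ 2 - 64 * (2 * c) + 64) / 192)
      = (1 + c) * ((1 - c) + (5 * c - 2) ^ 2 / 4) + 6 * c ^ 2 * (1 - c)) by field.
    rewrite E. set (b := Rabs (5 * c - 2)).
    replace ((5 * c - 2) ^ 2) with (b ^ 2) by (unfold b; rewrite pow2_abs; reflexivity).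
    assert (0 <= ((1 - c) * r - b / 2) ^ 2) by apply pow2_ge_0.
    assert (0 <= (1 + c) * ((1 - c) * r - b / 2) ^ 2) by (apply Rmult_le_pos; lra).
    replace ((1 + c) * ((1 - c) + b ^ 2 / 4) + 6 * c ^ 2 * (1 - c)) with
      ((1 - c) * ((1 + c) * (1 + b * r - (1 - c) * r ^ 2) + 6 * c ^ 2) + (1 + c) * ((1 - c) * r - b / 2) ^ 2)
      by field.
    lra.
  - rewrite Rabs_pos_eq by lra.
    assert (E : 6 * ((-3 * (2 * c) ^ 3 + 4 * (2 * c) ^ 2 + 6 * (2 * c) - 4) / 12)
      = (1 - c) * ((1 + c) * (1 + (5 * c - 2) * r - (1 - c) * r ^ 2) + 6 * c ^ 2)
        + (1 - c) * (1 + c) * ((1 - r) * ((5 * c - 2) - (1 - c) * (1 + r)))) by field.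
    rewrite E.
    assert (0 <= (1 - r) * ((5 * c - 2) - (1 - c) * (1 + r))) by (apply Rmult_le_pos; nra).
    assert (0 <= (1 - c) * (1 + c) * ((1 - r) * ((5 * c - 2) - (1 - c) * (1 + r)))).
    { apply Rmult_le_pos; auto. nra. }
    lra.
Qed.

(** * The class K in terms of power series *)

Lemma classK_PS a : classK a -> rad1 a /\ a 0%nat = RtoC 0 /\ a 1%nat = RtoC 1 /\
  injective_on_disk (PS a) /\ convex_on_disk (PS a).
Proof.
  intros [H0 [H1 [Han [Hu Hc]]]]. assert (Ha := analytic_rad1 a Han).
  repeat split; auto.
  - intros z w Hz Hw E. apply (Hu z w (PS a z) (PS a w)); auto using series_sum_PS.
  - intros z1 z2 t Hz1 Hz2 Ht.
    destruct (Hc z1 z2 (PS a z1) (PS a z2) t) as [w [s [Hw [Hs E]]]]; auto using series_sum_PS.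
    exists w. split; auto. rewrite <- (series_sum_unique _ _ _ Hs), E.
    apply C_eq; simpl; ring.
Qed.

Lemma PS_classK a : rad1 a -> a 0%nat = 0 -> a 1%nat = 1 ->
  injective_on_disk (PS a) -> convex_on_disk (PS a) -> classK a.
Proof.
  intros Ha H0 H1 Hu Hc. split; [|split; [|split; [|split]]]; auto.
  - apply rad1_analytic; auto.
  - intros z1 z2 s1 s2 Hz1 Hz2 Hs1 Hs2 E.
    rewrite (series_sum_unique _ _ _ Hs1), (series_sum_unique _ _ _ Hs2) in E. apply Hu; auto.
  - intros z1 z2 s1 s2 t Hz1 Hz2 Hs1 Hs2 Ht.
    destruct (Hc z1 z2 t Hz1 Hz2 Ht) as [w [Hw E]].
    exists w, (PS a w). split; auto. split; [apply series_sum_PS; auto|].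
    rewrite (series_sum_unique _ _ _ Hs1), (series_sum_unique _ _ _ Hs2), E. apply C_eq; simpl; ring.
Qed.

Lemma classKp_bounds p a : 0 <= p <= 2 -> classKp p a ->
  Cmod (a 3%nat - a 2%nat)%C <= bound3 p /\ Cmod (a 4%nat - a 3%nat)%C <= bound4 p.
Proof.
  intros Hp [HK H2]. destruct (classK_PS a HK) as [Ha [H0 [H1 [Hu Hc]]]].
  assert (E2 : a 2%nat = RtoC (p / 2)).
  { apply C_eq; [apply (f_equal fst) in H2|apply (f_equal snd) in H2]; simpl in *; lra. }
  destruct (coef_bounds a (p / 2) Ha H0 H1 Hu Hc E2) as [B3 [r [Hr B4]]]; [lra|].
  assert (B4' := bound4_le (p / 2) r ltac:(lra) Hr).
  replace (2 * (p / 2)) with p in B4' by field.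
  split; [|lra]. unfold bound3. nra.
Qed.

(** * A sufficient condition for convexity *)

Lemma lip_continuity_pt (f : R -> R) K x : (forall u v, Rabs (f u - f v) <= K * Rabs (u - v)) ->
  continuity_pt f x.
Proof.
  intros H eps He. assert (KP := Rabs_pos K).
  exists (eps / (1 + Rabs K)). split; [apply Rdiv_lt_0_compat; lra|].
  intros y [_ Hy]. simpl in *. unfold R_dist in *.
  apply Rlt_div_r in Hy; [|lra].
  assert (K1 := Rle_abs K). assert (P := Rabs_pos (y - x)). specialize (H y x). nra.
Qed.

(** Minimisation over the angle, then over the radius, reduces compactness of the disk to that of
    intervals. The Lipschitz bound passes to the minimum over the angle, so the second step has a
    continuous function. *)
Lemma disc_min (V : C -> R) r L : 0 <= r -> 0 <= L ->
  (forall z w, Cmod z <= r -> Cmod w <= r -> Rabs (V z - V w) <= L * Cmod (z - w)) ->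
  exists z0, Cmod z0 <= r /\ forall z, Cmod z <= r -> V z0 <= V z.
Proof.
  intros Hr HL HV. assert (HPI := PI_RGT_0).
  (* Clamping the radius to [0, r] gives functions on the whole line with global Lipschitz
     bounds. *)
  set (cl := fun x => Rmax 0 (Rmin r x)).
  assert (Hcl : forall x, 0 <= cl x <= r).
  { intros x. unfold cl. split; [apply Rmax_l|]. apply Rmax_lub; [auto|apply Rmin_l]. }
  assert (Lcl : forall x y, Rabs (cl x - cl y) <= Rabs (x - y)).
  { intros x y. unfold cl, Rmax, Rmin, Rabs. repeat destruct Rle_dec; repeat destruct Rcase_abs; lra. }
  set (F := fun x b => V (circ (cl x) b)).
  assert (Cc : forall x b, Cmod (circ (cl x) b) <= r).
  { intros x b. rewrite Cmod_circ; apply Hcl. }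
  assert (LF1 : forall x y b, Rabs (F x b - F y b) <= L * Rabs (x - y)).
  { intros x y b. unfold F. eapply Rle_trans; [apply HV; apply Cc|].
    apply Rmult_le_compat_l; auto. unfold circ.
    replace (RtoC (cl x) * cis b - RtoC (cl y) * cis b)%C with (RtoC (cl x - cl y) * cis b)%C
      by (rewrite RtoC_minus; ring).
    rewrite Cmod_mult, Cmod_cis, Cmod_R, Rmult_1_r. apply Lcl. }
  assert (LF2 : forall x b c, Rabs (F x b - F x c) <= (L * (r * 2)) * Rabs (b - c)).
  { intros x b c. unfold F. eapply Rle_trans; [apply HV; apply Cc|].
    rewrite Rmult_assoc. apply Rmult_le_compat_l; auto. unfold circ.
    replace (RtoC (cl x) * cis b - RtoC (cl x) * cis c)%C with (RtoC (cl x) * (cis b - cis c))%C by ring.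
    rewrite Cmod_mult, Cmod_R, Rabs_pos_eq by apply Hcl.
    rewrite Rmult_assoc. destruct (Hcl x). apply Rmult_le_compat; auto using Cmod_ge_0. apply cis_lip. }
  assert (Ex : forall x, exists b, 0 <= b <= 2 * PI /\ forall c, 0 <= c <= 2 * PI -> F x b <= F x c).
  { intros x. destruct (continuity_ab_min (F x) 0 (2 * PI)) as [b [Hb1 Hb2]]; [lra| |].
    - intros c _. apply (lip_continuity_pt _ (L * (r * 2))). apply LF2.
    - exists b. auto. }
  set (B := fun x => epsilon (inhabits 0) (fun b => 0 <= b <= 2 * PI /\ forall c, 0 <= c <= 2 * PI -> F x b <= F x c)).
  assert (HB : forall x, 0 <= B x <= 2 * PI /\ forall c, 0 <= c <= 2 * PI -> F x (B x) <= F x c).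
  { intros x. apply epsilon_spec. apply Ex. }
  assert (Lm : forall x y, Rabs (F x (B x) - F y (B y)) <= L * Rabs (x - y)).
  { assert (One : forall x y, F x (B x) - F y (B y) <= L * Rabs (x - y)).
    { intros x y. destruct (HB x) as [_ H1]. destruct (HB y) as [H2 _].
      specialize (H1 _ H2). assert (H3 := LF1 x y (B y)). assert (H4 := Rle_abs (F x (B y) - F y (B y))). lra. }
    intros x y. apply Rabs_le. assert (O1 := One x y). assert (O2 := One y x).
    rewrite Rabs_minus_sym in O2. lra. }
  destruct (continuity_ab_min (fun x => F x (B x)) 0 r) as [x0 [Hx1 Hx2]]; auto.
  { intros c _. apply (lip_continuity_pt _ L). apply Lm. }
  exists (circ (cl x0) (B x0)). split; [apply Cc|]. intros z Hz.
  destruct (polar_form z (Cmod z) eq_refl) as [b [Hb Ez]].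
  assert (Ecl : cl (Cmod z) = Cmod z).
  { unfold cl. rewrite Rmin_right, Rmax_right; auto using Cmod_ge_0. }
  assert (Hz0 : 0 <= Cmod z <= r) by (split; auto using Cmod_ge_0).
  apply Rle_trans with (F (Cmod z) (B (Cmod z))); [apply Hx1; auto|].
  replace (V z) with (F (Cmod z) b) by (unfold F; rewrite Ecl, <- Ez; reflexivity).
  apply HB; auto.
Qed.

(** The number d encodes the gradient: Re (d v) is the slope in direction v, and at a minimum an
    upper estimate of V suffices. Admissible directions have nonnegative slope, so the gradient
    vanishes inside and is normal to the circle on the boundary. *)
Lemma disc_min_first_order (V : C -> R) z0 r d : Cmod z0 <= r ->
  (forall z, Cmod z <= r -> V z0 <= V z) ->
  (forall eps, 0 < eps -> exists del, 0 < del /\ forall v, Cmod v < del ->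
     V (z0 + v)%C <= V z0 + fst (d * v)%C + eps * Cmod v) ->
  (Cmod z0 < r -> d = 0) /\ snd (d * z0)%C = 0 /\ fst (d * z0)%C <= 0.
Proof.
  intros Hz0 Hmin HV.
  assert (Dir : forall v, (exists t0, 0 < t0 /\ forall t, 0 < t < t0 -> Cmod (z0 + RtoC t * v) <= r) ->
    0 <= fst (d * v)%C).
  { intros v [t0 [Ht0 Hin]]. apply Rnot_lt_le. intros Hneg. assert (Vp := Cmod_ge_0 v).
    set (eps := - fst (d * v)%C / (2 * (1 + Cmod v))).
    assert (He : 0 < eps) by (apply Rdiv_lt_0_compat; lra).
    destruct (HV eps He) as [del [Hdel H]].
    set (t := Rmin (t0 / 2) (del / (2 * (1 + Cmod v)))).
    assert (A1 : t <= t0 / 2) by apply Rmin_l.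
    assert (A2 : t <= del / (2 * (1 + Cmod v))) by apply Rmin_r.
    assert (Ht : 0 < t) by (apply Rmin_pos; [lra|apply Rdiv_lt_0_compat; lra]).
    apply (Rle_div_r _ _ (2 * (1 + Cmod v))) in A2; [|lra].
    assert (Ctv : Cmod (RtoC t * v) = t * Cmod v) by (rewrite Cmod_mult, Cmod_R, Rabs_pos_eq; lra).
    specialize (H (RtoC t * v)%C). rewrite Ctv in H. specialize (H ltac:(nra)).
    specialize (Hin t ltac:(lra)). specialize (Hmin _ Hin).
    replace (fst (d * (RtoC t * v))%C) with (t * fst (d * v)%C) in H by (simpl; ring).
    assert (E : eps * (1 + Cmod v) = - fst (d * v)%C / 2) by (unfold eps; field; lra).
    assert (0 <= t * (fst (d * v)%C + eps * Cmod v)) by lra. nra. }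
  (* At an interior point the steepest descent direction - conj d is admissible, and its slope is -
     |d|^2. *)
  assert (Int : Cmod z0 < r -> d = 0).
  { intros Hlt. assert (D := Dir (- Cconj d)%C). apply Cmod_sqr_0. rewrite Cmod_sqr.
    simpl in *. apply Ropp_le_cancel. rewrite Ropp_0.
    eapply Rle_trans; [apply D|right; ring].
    exists ((r - Cmod z0) / (1 + Cmod d)). assert (Dp := Cmod_ge_0 d).
    split; [apply Rdiv_lt_0_compat; lra|]. intros t Ht.
    destruct Ht as [Ht1 Ht2]. apply (Rlt_div_r _ _ (1 + Cmod d)) in Ht2; [|lra].
    eapply Rle_trans; [apply Cmod_triangle|].
    rewrite Cmod_mult, Cmod_opp, Cmod_conj, Cmod_R, Rabs_pos_eq by lra. nra. }
  split; auto.
  destruct (Rle_lt_or_eq_dec _ _ Hz0) as [Hlt|Heq].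
  { rewrite (Int Hlt). simpl. lra. }
  (* The tangent direction i z0 leaves the disk, so an inward component eps is added; it tends to 0
     at the end. *)
  assert (Tan : forall eps s, 0 < eps -> 0 <= - eps * fst (d * z0)%C - s * snd (d * z0)%C).
  { intros eps s He.
    replace (- eps * fst (d * z0)%C - s * snd (d * z0)%C) with (fst (d * (z0 * ((- eps)%R, s)))%C) by (simpl; ring).
    apply Dir. exists (eps / (eps ^ 2 + s ^ 2)).
    assert (Q : 0 < eps ^ 2 + s ^ 2) by nra.
    split; [apply Rdiv_lt_0_compat; auto|]. intros t [Ht1 Ht2].
    apply (Rlt_div_r _ _ (eps ^ 2 + s ^ 2)) in Ht2; auto.
    replace (z0 + RtoC t * (z0 * ((- eps)%R, s)))%C with (z0 * ((1 - t * eps)%R, (t * s)%R))%C by (apply C_eq; simpl; ring).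
    rewrite Cmod_mult, Heq.
    assert (Cmod (1 - t * eps, t * s) <= 1).
    { apply Rsqr_incr_0_var; [|lra]. unfold Rsqr.
      replace (Cmod (1 - t * eps, t * s) * Cmod (1 - t * eps, t * s)) with (Cmod (1 - t * eps, t * s) ^ 2) by ring.
      rewrite Cmod_sqr. simpl. nra. }
    assert (0 <= r) by (rewrite <- Heq; apply Cmod_ge_0). nra. }
  set (X := fst (d * z0)%C) in *. set (Y := snd (d * z0)%C) in *.
  assert (HX : X <= 0) by (assert (T := Tan 1 0 Rlt_0_1); lra).
  split; auto. apply cond_eq. intros eps He.
  rewrite Rminus_0_r. set (e := eps / (2 * (1 - X))).
  assert (He' : 0 < e) by (apply Rdiv_lt_0_compat; lra).
  assert (Ee : e * (1 - X) = eps / 2) by (unfold e; field; lra).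
  assert (T1 := Tan e 1 He'). assert (T2 := Tan e (-1) He').
  apply Rabs_def1; nra.
Qed.

(** * The derivative as an exponential, and the turning tangent *)

Lemma cexp_opp_r u : (cexp u * cexp (- u))%C = 1.
Proof.
  destruct u as [x y]. assert (E : exp x * exp (- x) = 1).
  { rewrite <- exp_plus, Rplus_opp_r, exp_0. reflexivity. }
  assert (S := sin2_cos2 y). unfold Rsqr in S.
  apply C_eq; simpl; rewrite cos_neg, sin_neg.
  - replace (exp x * cos y * (exp (- x) * cos y) - exp x * sin y * (exp (- x) * - sin y))
      with (exp x * exp (- x) * (sin y * sin y + cos y * cos y)) by ring. rewrite E, S. ring.
  - ring.
Qed.

(* The data of a convex function: 1 + z f''/f' = 1 + z E(z) with E = sum e_n z^n, and f' = sum b_n z^n. *)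
Definition convex_data (e b : nat -> C) : Prop :=
  (forall n, Cmod (e n) <= 2) /\
  (forall z, Cmod z < 1 -> 0 < 1 + fst (z * PS e z)%C) /\
  b 0%nat = 1 /\ (forall n, pderiv b n = csumf (fun k => e k * b (n - k)%nat)%C n).

Lemma rad1_bounded a M : (forall n, Cmod (a n) <= M) -> rad1 a.
Proof.
  intros H r Hr. exists M. intros n. specialize (H n).
  assert (P : 0 <= r ^ n) by (apply pow_le; lra).
  assert (Q : r ^ n <= 1) by (rewrite <- (pow1 n); apply pow_incr; lra).
  assert (S := Cmod_ge_0 (a n)). nra.
Qed.

Lemma rad1_data_e e b : convex_data e b -> rad1 e.
Proof. intros [H _]. apply (rad1_bounded e 2 H). Qed.

Lemma sum_arith n : sum_f_R0 (fun k => 2 * INR (S (n - k))) n = INR (S n) * INR (S (S n)).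
Proof.
  induction n as [|n IH]; [simpl; ring|].
  rewrite decomp_sum by lia. simpl pred.
  change (sum_f_R0 (fun i => 2 * INR (S (S n - S i))) n) with (sum_f_R0 (fun k => 2 * INR (S (n - k))) n).
  rewrite IH, Nat.sub_0_r, !S_INR. ring.
Qed.

(** Induction on the recursion with |e_k| <= 2, using [sum_arith]. Equality is the case f = z / (1 -
    z), where e_k = 2 and b_n = n + 1. *)
Lemma convex_data_bound e b n : convex_data e b -> Cmod (b n) <= INR (S n).
Proof.
  intros [He [_ [Hb0 Hb]]]. induction n as [n IH] using lt_wf_ind.
  destruct n as [|n].
  - rewrite Hb0, Cmod_1. simpl. lra.
  - assert (P : 0 < INR (S n)) by (apply lt_0_INR; lia).
    apply Rmult_le_reg_l with (INR (S n)); auto.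
    replace (INR (S n) * Cmod (b (S n))) with (Cmod (pderiv b n)).
    2: { unfold pderiv. rewrite Cmod_mult, Cmod_R, Rabs_pos_eq; lra. }
    rewrite Hb, <- sum_arith. apply Cmod_csumf_le. intros k Hk. rewrite Cmod_mult.
    apply Rmult_le_compat; auto using Cmod_ge_0. apply IH. lia.
Qed.

Lemma rad1_data_b e b : convex_data e b -> rad1 b.
Proof.
  intros H r Hr. exists (/ (1 - r)). intros n.
  eapply Rle_trans; [|apply (geom_weight r n Hr)].
  apply Rmult_le_compat_r; [apply pow_le; lra|]. apply (convex_data_bound e b n H).
Qed.

Lemma PS_pderiv_pinteg a z : PS (pderiv (pinteg a)) z = PS a z.
Proof. apply PS_ext. apply pderiv_pinteg. Qed.

(** As f'' = E f', the product of f' with exp of minus the primitive of E is constant on the segment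
    from 0 to z, and equals 1 at 0. *)
Lemma data_exp e b z : convex_data e b -> Cmod z < 1 -> PS b z = cexp (PS (pinteg e) z).
Proof.
  intros H Hz. assert (He := rad1_data_e e b H). assert (Hb := rad1_data_b e b H).
  assert (Hi := rad1_pinteg e He).
  set (G := fun s : R => (PS b (RtoC s * z) * cexp (RtoC (-1) * PS (pinteg e) (RtoC s * z)))%C).
  assert (In : forall s, 0 <= s <= 1 -> Cmod (RtoC s * z) < 1).
  { intros s Hs. rewrite Cmod_mult, Cmod_R, Rabs_pos_eq by lra. assert (P := Cmod_ge_0 z). nra. }
  assert (E : G 0 = G 1).
  { apply rderiv_zero_const; [lra|]. intros s Hs. unfold G.
    assert (D1 := rderiv_comp (PS b) (fun s => RtoC s * z)%C s _ _ (rderiv_line z s) (PS_cdiff b _ Hb (In s Hs))).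
    assert (D2 := rderiv_comp (PS (pinteg e)) (fun s => RtoC s * z)%C s _ _ (rderiv_line z s) (PS_cdiff _ _ Hi (In s Hs))).
    assert (D3 := rderiv_mult _ _ s _ _ (rderiv_const (RtoC (-1)) s) D2).
    assert (D4 := rderiv_mult _ _ s _ _ D1 (rderiv_cexp _ s _ D3)). cbv beta in D4.
    rewrite PS_pderiv_pinteg in D4.
    rewrite (PS_ext (pderiv b) (fun n => csumf (fun k => e k * b (n - k)%nat)%C n)) in D4 by apply H.
    rewrite PS_product in D4 by auto.
    match type of D4 with rderiv _ _ ?X => replace X with (RtoC 0) in D4 end; [exact D4|].
    replace (RtoC (-1)) with (- RtoC 1)%C by (rewrite <- RtoC_opp; reflexivity). ring. }
  unfold G in E. rewrite !Cmult_0_l, !Cmult_1_l, !PS_0 in E by auto.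
  destruct H as [_ [_ [Hb0 _]]]. rewrite Hb0 in E. simpl pinteg in E.
  replace (1 * cexp (RtoC (-1) * 0))%C with (RtoC 1) in E.
  2: { rewrite Cmult_0_r, Cmult_1_l. unfold cexp. simpl. rewrite exp_0, cos_0, sin_0. apply C_eq; simpl; ring. }
  set (L := PS (pinteg e) z) in *.
  assert (E2 := cexp_opp_r L).
  replace (RtoC (-1) * L)%C with (- L)%C in E.
  2: { replace (RtoC (-1)) with (- RtoC 1)%C by (rewrite <- RtoC_opp; reflexivity). ring. }
  rewrite <- (Cmult_1_r (PS b z)), <- E2.
  replace (PS b z * (cexp L * cexp (- L)))%C with ((PS b z * cexp (- L)) * cexp L)%C by ring.
  rewrite <- E. ring.
Qed.

Lemma cexp_neq_0 u : cexp u <> 0.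
Proof.
  intros E. assert (H := cexp_opp_r u). rewrite E, Cmult_0_l in H.
  apply (f_equal fst) in H. simpl in H. lra.
Qed.

(** A continuous branch of arg (z f'(z)) at z = r e^{it}, read off from f' = exp of the primitive of
    E. The tangent to the image curve is i z f'(z). *)
Definition tangent_arg (e : nat -> C) (r t : R) : R := t + snd (PS (pinteg e) (circ r t)).

Lemma tangent_arg_derive e r t : rad1 e -> 0 <= r < 1 ->
  is_derive (tangent_arg e r) t (1 + fst (circ r t * PS e (circ r t))%C).
Proof.
  intros He Hr. assert (Hi := rad1_pinteg e He).
  assert (Hc : Cmod (circ r t) < 1) by (rewrite Cmod_circ; lra).
  destruct (rderiv_comp _ (circ r) t _ _ (rderiv_circ_angle r t) (PS_cdiff _ _ Hi Hc)) as [_ D].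
  rewrite PS_pderiv_pinteg in D.
  apply (is_derive_plus (fun t => t) (fun t => snd (PS (pinteg e) (circ r t)))).
  - apply @is_derive_id.
  - evar_last; [exact D|]. unfold circ. simpl. ring.
Qed.

Lemma tangent_arg_increasing e b r s t : convex_data e b -> 0 <= r < 1 -> s < t ->
  tangent_arg e r s < tangent_arg e r t.
Proof.
  intros H Hr Hst. assert (He := rad1_data_e e b H).
  destruct (MVT_gen (tangent_arg e r) s t (fun t => 1 + fst (circ r t * PS e (circ r t))%C)) as [c [_ E]].
  - intros x _. apply tangent_arg_derive; auto.
  - intros x _. apply derivable_continuous_pt.
    exists (1 + fst (circ r x * PS e (circ r x))%C). apply is_derive_Reals, tangent_arg_derive; auto.
  - assert (P : 0 < 1 + fst (circ r c * PS e (circ r c))%C).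
    { apply H. rewrite Cmod_circ; lra. }
    assert (0 < (1 + fst (circ r c * PS e (circ r c))%C) * (t - s)) by (apply Rmult_lt_0_compat; lra). lra.
Qed.

Lemma tangent_arg_period e r t : tangent_arg e r (t + 2 * PI) = tangent_arg e r t + 2 * PI.
Proof.
  unfold tangent_arg. replace (circ r (t + 2 * PI)) with (circ r t); [ring|].
  unfold circ. rewrite cis_plus, cis_2PI. replace (cis 0) with (RtoC 1).
  - ring.
  - unfold cis. rewrite cos_0, sin_0. reflexivity.
Qed.

Lemma data_tangent e b r t : convex_data e b -> 0 <= r < 1 ->
  (circ r t * PS b (circ r t))%C =
  (RtoC (r * exp (fst (PS (pinteg e) (circ r t)))) * cis (tangent_arg e r t))%C.
Proof.
  intros H Hr. rewrite (data_exp e b) by (auto; rewrite Cmod_circ; lra).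
  unfold tangent_arg. rewrite cis_plus. unfold cexp, circ, cis. apply C_eq; simpl; ring.
Qed.

(* The tangent argument increases by exactly 2 pi along a circle. *)
Lemma same_tangent_direction e b z w : convex_data e b -> Cmod z = Cmod w -> 0 < Cmod w < 1 ->
  snd ((z * PS b z) * Cconj (w * PS b w))%C = 0 -> 0 < fst ((z * PS b z) * Cconj (w * PS b w))%C -> z = w.
Proof.
  intros H Hzw Hw Him Hre. set (r := Cmod w) in *.
  assert (Hr : 0 <= r < 1) by lra.
  destruct (polar_form z r Hzw) as [al [Hal Ez]]. destruct (polar_form w r eq_refl) as [be [Hbe Ew]].
  rewrite Ez, Ew in Him, Hre |- *. rewrite !(data_tangent e b) in Him, Hre by auto.
  set (A := r * exp (fst (PS (pinteg e) (circ r al)))) in *.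
  set (B := r * exp (fst (PS (pinteg e) (circ r be)))) in *.
  assert (HA : 0 < A) by (apply Rmult_lt_0_compat; [lra|apply exp_pos]).
  assert (HB : 0 < B) by (apply Rmult_lt_0_compat; [lra|apply exp_pos]).
  set (ta := tangent_arg e r al) in *. set (tb := tangent_arg e r be) in *.
  replace (snd (RtoC A * cis ta * Cconj (RtoC B * cis tb))%C) with (A * B * sin (ta - tb)) in Him
    by (rewrite sin_minus; simpl; ring).
  replace (fst (RtoC A * cis ta * Cconj (RtoC B * cis tb))%C) with (A * B * cos (ta - tb)) in Hre
    by (rewrite cos_minus; simpl; ring).
  assert (HAB : 0 < A * B) by (apply Rmult_lt_0_compat; auto).
  assert (Hs : sin (ta - tb) = 0) by (apply Rmult_integral in Him; destruct Him; lra).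
  assert (Hc : 0 < cos (ta - tb)) by (apply Rmult_lt_reg_l with (A * B); lra).
  assert (Per : forall t, circ r (t + 2 * PI) = circ r t).
  { intros t. unfold circ. rewrite cis_plus, cis_2PI. replace (cis 0) with (RtoC 1); [ring|].
    unfold cis. rewrite cos_0, sin_0. reflexivity. }
  (* Parallel tangents with the same sense differ in argument by a multiple of 2 pi; strictly
     between 0 and 2 pi there is none. *)
  assert (No : forall x, 0 < x < 2 * PI -> sin x = 0 -> cos x <= 0).
  { intros x Hx Hsx. destruct (Rtotal_order x PI) as [L|[->|L]].
    - assert (P := sin_gt_0 x ltac:(lra) L). lra.
    - rewrite cos_PI. lra.
    - assert (P := sin_lt_0 x L ltac:(lra)). lra. }
  assert (Lt : forall s t, s < t -> t < s + 2 * PI ->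
    0 < tangent_arg e r t - tangent_arg e r s < 2 * PI).
  { intros s t H1 H2. assert (I1 := tangent_arg_increasing e b r s t H Hr H1).
    assert (I2 := tangent_arg_increasing e b r t (s + 2 * PI) H Hr H2).
    rewrite tangent_arg_period in I2. lra. }
  destruct (Rtotal_order al be) as [L|[->|L]]; auto.
  - destruct (Rlt_dec be (al + 2 * PI)) as [L2|L2].
    + exfalso. specialize (Lt al be L L2). fold ta tb in Lt.
      replace (ta - tb) with (- (tb - ta)) in Hs, Hc by ring. rewrite sin_neg in Hs. rewrite cos_neg in Hc.
      assert (N := No _ Lt ltac:(lra)). lra.
    (* Both angles range over the closed interval [0, 2 pi], so its two endpoints may represent the
       same point. *)
    + replace be with (al + 2 * PI) by lra. rewrite Per. reflexivity.
  - destruct (Rlt_dec al (be + 2 * PI)) as [L2|L2].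
    + exfalso. specialize (Lt be al L L2). fold ta tb in Lt.
      assert (N := No _ Lt Hs). lra.
    + replace al with (be + 2 * PI) by lra. rewrite Per. reflexivity.
Qed.

(* f maps |z| <= |w| into the half-plane bounded by the tangent at f(w) to the image of the circle |z| = |w|.
   At a minimum point of the distance to that line, the tangents at that point and at f(w) are parallel. *)
Lemma supporting_half_plane e b w : convex_data e b -> 0 < Cmod w < 1 ->
  forall z, Cmod z <= Cmod w ->
   0 <= fst ((PS (pinteg b) w - PS (pinteg b) z) * Cconj (w * PS b w))%C /\
   (fst ((PS (pinteg b) w - PS (pinteg b) z) * Cconj (w * PS b w))%C = 0 -> z = w).
Proof.
  intros H Hw. assert (Hb := rad1_data_b e b H). assert (Hf := rad1_pinteg b Hb).
  set (f := PS (pinteg b)). set (r := Cmod w) in *. set (G := Cconj (w * PS b w)%C).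
  (* The vector w f'(w) is an outward normal at f(w), so V is |G| times the signed distance to the
     tangent there. *)
  set (V := fun z => fst ((f w - f z) * G)%C).
  assert (Hnb : forall z, Cmod z < 1 -> PS b z <> 0).
  { intros z Hz. rewrite (data_exp e b) by auto. apply cexp_neq_0. }
  assert (HG : G <> 0).
  { apply Cmod_gt_0. unfold G. rewrite Cmod_conj. apply Cmod_gt_0.
    apply Cmult_neq_0; [apply Cmod_gt_0, Hw|apply Hnb, Hw]. }
  (* Both claims follow once w is the only possible minimum point, since V w = 0: a minimum exists,
     and any zero of V is then a minimum point. *)
  assert (Uniq : forall z0, Cmod z0 <= r -> (forall z, Cmod z <= r -> V z0 <= V z) -> z0 = w).
  { intros z0 Hz0 Hmin.
    assert (Hz1 : Cmod z0 < 1) by (unfold r in *; lra).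
    set (d := (- (PS b z0 * G))%C).
    assert (Hd : d <> 0).
    { intros E. apply (Cmult_neq_0 _ _ (Hnb z0 Hz1) HG).
      replace (PS b z0 * G)%C with (- d)%C by (unfold d; ring). rewrite E. ring. }
    destruct (disc_min_first_order V z0 r d Hz0 Hmin) as [F1 [F2 F3]].
    - intros eps Heps.
      assert (D := PS_cdiff _ z0 Hf Hz1). rewrite PS_pderiv_pinteg in D. fold f in D.
      assert (GP := Cmod_ge_0 G).
      destruct (D (eps / (1 + Cmod G))) as [del [Hdel K]]; [apply Rdiv_lt_0_compat; lra|].
      exists del. split; auto. intros v Hv. specialize (K v Hv).
      assert (B : Cmod (((f w - f (z0 + v)) * G - (f w - f z0) * G) - d * v)%C <= eps * Cmod v).
      { replace (((f w - f (z0 + v)) * G - (f w - f z0) * G) - d * v)%C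
          with (- ((f (z0 + v) - f z0 - PS b z0 * v) * G))%C by (unfold d; ring).
        rewrite Cmod_opp, Cmod_mult.
        apply Rle_trans with (eps / (1 + Cmod G) * Cmod v * (1 + Cmod G)).
        - apply Rmult_le_compat; auto using Cmod_ge_0; lra.
        - right. field. lra. }
      assert (B2 := Rle_trans _ _ _ (Rle_trans _ _ _ (Rle_abs _) (re_le_Cmod _)) B).
      unfold V, Re in *. simpl in *. lra.
    - destruct (Rle_lt_or_eq_dec _ _ Hz0) as [L|E]; [exfalso; auto|].
      assert (Ed : (d * z0)%C = (- ((z0 * PS b z0) * G))%C) by (unfold d; ring).
      rewrite Ed in F2, F3.
      apply (same_tangent_direction e b z0 w H); auto.
      + fold G. simpl in *. lra.
      + fold G. destruct (Rle_lt_or_eq_dec _ _ F3) as [L|E2]; [simpl in *; lra|].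
        exfalso. assert (Z : (d * z0)%C = 0) by (rewrite Ed; apply C_eq; auto).
        revert Z. apply Cmult_neq_0; auto. apply Cmod_gt_0. lra. }
  destruct (PS_lip _ r Hf) as [L [HL Lip]]; [lra|].
  destruct (disc_min V r (L * Cmod G)) as [z0 [Hz0 Hmin]]; [lra| | |].
  { apply Rmult_le_pos; auto using Cmod_ge_0. }
  { intros z z' Hz Hz'.
    replace (V z - V z') with (fst ((f z' - f z) * G)%C) by (unfold V; simpl; ring).
    eapply Rle_trans; [apply re_le_Cmod|]. rewrite Cmod_mult.
    rewrite Cmod_minus_sym. specialize (Lip z' z Hz' Hz). fold f in Lip.
    assert (P := Cmod_ge_0 G). nra. }
  assert (E := Uniq z0 Hz0 Hmin). subst z0.
  assert (V0 : V w = 0) by (unfold V; simpl; ring).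
  intros z Hz. split.
  - change (0 <= V z). rewrite <- V0. apply Hmin; auto.
  - intros E. change (V z = 0) in E. apply Uniq; auto. intros z' Hz'. rewrite E, <- V0. apply Hmin; auto.
Qed.

(** The point of larger modulus takes the role of w: equal values put f(z) on the supporting line at
    f(w), hence z = w. *)
Lemma convex_data_injective e b : convex_data e b -> injective_on_disk (PS (pinteg b)).
Proof.
  intros H.
  assert (One : forall z w, Cmod z < 1 -> Cmod w < 1 -> Cmod z <= Cmod w ->
    PS (pinteg b) z = PS (pinteg b) w -> z = w).
  { intros z w Hz Hw Hzw E. destruct (Req_dec (Cmod w) 0) as [E0|Hn].
    - assert (Ez : Cmod z = 0) by (assert (P := Cmod_ge_0 z); lra).
      apply Cmod_eq_0 in E0. apply Cmod_eq_0 in Ez. congruence.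
    - assert (P := Cmod_ge_0 w).
      destruct (supporting_half_plane e b w H ltac:(lra) z Hzw) as [_ K]. apply K.
      rewrite E. simpl. ring. }
  intros z w Hz Hw E. destruct (Rle_dec (Cmod z) (Cmod w)) as [L|L].
  - apply One; auto.
  - symmetry. apply One; auto. lra.
Qed.

(* The point of f(|z| <= r) nearest to a convex combination y of two of its points is y itself:
   otherwise it is on the boundary, and y lies strictly beyond the supporting line there. *)
Lemma convex_data_convex e b : convex_data e b -> convex_on_disk (PS (pinteg b)).
Proof.
  intros H z1 z2 t Hz1 Hz2 Ht.
  assert (Hb := rad1_data_b e b H). assert (Hf := rad1_pinteg b Hb).
  set (f := PS (pinteg b)). set (y := (RtoC t * f z1 + RtoC (1 - t) * f z2)%C).
  set (r := Rmax (Cmod z1) (Cmod z2)).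
  assert (R1 : Cmod z1 <= r) by apply Rmax_l. assert (R2 : Cmod z2 <= r) by apply Rmax_r.
  assert (R3 : r < 1) by (apply Rmax_lub_lt; auto).
  assert (R0 : 0 <= r) by (eapply Rle_trans; [apply Cmod_ge_0|exact R1]).
  destruct (PS_lip _ r Hf) as [L [HL Lip]]; [lra|]. fold f in Lip.
  destruct (disc_min (fun z => Cmod (f z - y)%C) r L R0 HL) as [z0 [Hz0 Hmin]].
  { intros z w Hz Hw.
    assert (T1 := Cmod_reverse_triangle (f z - y) (f w - y)).
    assert (T2 := Cmod_reverse_triangle (f w - y) (f z - y)).
    replace (f z - y - (f w - y))%C with (f z - f w)%C in T1 by ring.
    replace (f w - y - (f z - y))%C with (f w - f z)%C in T2 by ring.
    rewrite (Cmod_minus_sym (f w) (f z)) in T2. specialize (Lip w z Hw Hz).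
    apply Rabs_le. lra. }
  assert (Hz01 : Cmod z0 < 1) by lra.
  exists z0. split; auto. apply Ceq_minus. fold y. apply NNPP. intros HA.
  set (A := (f z0 - y)%C) in *.
  (* The derivative of |f(z) - y|^2 at z0 in direction v is Re (d v). *)
  set (d := (RtoC 2 * (Cconj A * PS b z0))%C).
  assert (Hd : d <> 0).
  { apply Cmult_neq_0; [intros E; apply RtoC_inj in E; lra|]. apply Cmult_neq_0.
    - apply Cmod_gt_0. rewrite Cmod_conj. apply Cmod_gt_0. exact HA.
    - rewrite (data_exp e b) by auto. apply cexp_neq_0. }
  destruct (disc_min_first_order (fun z => Cmod (f z - y)%C ^ 2) z0 r d Hz0) as [F1 [F2 F3]].
  - intros z Hz. apply pow_incr. split; auto using Cmod_ge_0.
  - intros eps Heps.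
    assert (D := PS_cdiff _ z0 Hf Hz01). rewrite PS_pderiv_pinteg in D. fold f in D.
    assert (AP := Cmod_ge_0 A).
    destruct (D (eps / (4 * (1 + Cmod A)))) as [del [Hdel K]]; [apply Rdiv_lt_0_compat; lra|].
    destruct (cdiff_bound _ _ _ D) as [del2 [Hdel2 K2]].
    set (B := 1 + Cmod (PS b z0)) in *.
    assert (HB : 0 < B) by (unfold B; assert (P := Cmod_ge_0 (PS b z0)); lra).
    exists (Rmin (Rmin del del2) (eps / (2 * (B * B)))). split.
    { repeat apply Rmin_pos; auto. apply Rdiv_lt_0_compat; nra. }
    intros v Hv.
    assert (V1 := Rlt_le_trans _ _ _ (Rlt_le_trans _ _ _ Hv (Rmin_l _ _)) (Rmin_l _ _)).
    assert (V2 := Rlt_le_trans _ _ _ (Rlt_le_trans _ _ _ Hv (Rmin_l _ _)) (Rmin_r _ _)).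
    assert (V3 := Rlt_le_trans _ _ _ Hv (Rmin_r _ _)).
    apply (Rlt_div_r _ _ (2 * (B * B))) in V3; [|nra].
    specialize (K v V1). specialize (K2 v V2).
    set (D1 := (f (z0 + v)%C - f z0)%C) in *.
    replace (f (z0 + v)%C - y)%C with (A + D1)%C by (unfold A, D1; ring).
    rewrite Cmod_plus_sqr.
    assert (X1 : fst (Cconj A * (D1 - PS b z0 * v))%C <= eps / 4 * Cmod v).
    { eapply Rle_trans; [apply Rle_abs|]. eapply Rle_trans; [apply re_le_Cmod|].
      rewrite Cmod_mult, Cmod_conj.
      apply Rle_trans with ((1 + Cmod A) * (eps / (4 * (1 + Cmod A)) * Cmod v)).
      - apply Rmult_le_compat; auto using Cmod_ge_0; lra.
      - right. field. lra. }
    assert (X2 : 2 * fst (Cconj A * D1)%C = fst (d * v)%C + 2 * fst (Cconj A * (D1 - PS b z0 * v))%C).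
    { unfold d. simpl. ring. }
    assert (X3 : Cmod D1 ^ 2 <= (B * Cmod v) ^ 2) by (apply pow_incr; split; auto using Cmod_ge_0).
    assert (VP := Cmod_ge_0 v).
    assert (X4 : (B * Cmod v) ^ 2 <= eps / 2 * Cmod v) by (simpl; nra).
    fold A. lra.
  - destruct (Rle_lt_or_eq_dec _ _ Hz0) as [Lt|E]; [auto|].
    assert (Hr : 0 < r).
    { destruct (Req_dec r 0) as [E0|]; [|lra]. exfalso. apply HA. unfold A, y.
      assert (Z : forall z, Cmod z <= r -> z = 0).
      { intros z Hz. apply Cmod_eq_0. assert (P := Cmod_ge_0 z). lra. }
      rewrite (Z z0), (Z z1), (Z z2) by lra. rewrite RtoC_minus. ring. }
    assert (Hn : (d * z0)%C <> 0) by (apply Cmult_neq_0; auto; apply Cmod_gt_0; lra).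
    assert (F4 : fst (d * z0)%C < 0).
    { destruct (Rle_lt_or_eq_dec _ _ F3) as [Lt|E2]; auto. exfalso. apply Hn. apply C_eq; auto. }
    assert (Hz0' : 0 < Cmod z0 < 1) by lra.
    destruct (supporting_half_plane e b z0 H Hz0' z1) as [S1 _]; [lra|].
    destruct (supporting_half_plane e b z0 H Hz0' z2) as [S2 _]; [lra|].
    fold f in S1, S2.
    assert (Comb : fst (A * Cconj (z0 * PS b z0))%C =
      t * fst ((f z0 - f z1) * Cconj (z0 * PS b z0))%C + (1 - t) * fst ((f z0 - f z2) * Cconj (z0 * PS b z0))%C).
    { unfold A, y. simpl. ring. }
    assert (Ed : fst (d * z0)%C = 2 * fst (A * Cconj (z0 * PS b z0))%C) by (unfold d; simpl; ring).
    assert (0 <= t * fst ((f z0 - f z1) * Cconj (z0 * PS b z0))%C) by (apply Rmult_le_pos; lra).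
    assert (0 <= (1 - t) * fst ((f z0 - f z2) * Cconj (z0 * PS b z0))%C) by (apply Rmult_le_pos; lra).
    lra.
Qed.

Lemma convex_data_classK e b : convex_data e b -> classK (pinteg b).
Proof.
  intros H. apply PS_classK.
  - apply rad1_pinteg, (rad1_data_b e b H).
  - reflexivity.
  - simpl. destruct H as [_ [_ [-> _]]]. apply C_eq; simpl; field.
  - apply (convex_data_injective e b H).
  - apply (convex_data_convex e b H).
Qed.

(** * Extremal functions *)

Lemma Cmod_unit_pow eta n : Cmod eta = 1 -> Cmod (eta ^ n) = 1.
Proof. intros H. rewrite Cmod_pow, H. apply pow1. Qed.

(** With w = eta z the series gives X = w / (1 - w), and 1 + 2 X = (1 + w) / (1 - w) has positive
    real part. The relation X (1 - w) = w is used instead of the quotient. *)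
Lemma half_plane_kernel eta z : Cmod eta = 1 -> Cmod z < 1 ->
  0 < 1 + 2 * fst (z * PS (fun k => eta ^ S k)%C z)%C.
Proof.
  intros He Hz.
  set (a := fun k => (eta ^ S k)%C).
  assert (Ha : rad1 a) by (apply (rad1_bounded a 1); intros n; right; apply Cmod_unit_pow; auto).
  set (X := (z * PS a z)%C). set (w := (eta * z)%C).
  assert (Hw : Cmod w < 1) by (unfold w; rewrite Cmod_mult, He; lra).
  assert (E : (X * (1 - w))%C = w).
  { assert (R : PS a z = (eta + z * (eta * PS a z))%C).
    { rewrite (PS_incr a z) at 1 by auto. unfold a at 1. rewrite Cpow_1_r. do 2 f_equal.
      unfold PS. rewrite <- Csum_scal by (apply PS_summable; auto).
      apply Csum_ext. intros n. unfold a. simpl Cpow. ring. }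
    unfold X, w. replace (z * PS a z * (1 - eta * z))%C with (z * (PS a z - z * (eta * PS a z)))%C by ring.
    rewrite R at 1. ring. }
  assert (Hw2 : fst w ^ 2 + snd w ^ 2 < 1).
  { rewrite <- (pow1 2). apply Cmod_lt_sqr; auto. }
  clearbody X w.
  assert (E1 := f_equal fst E). assert (E2 := f_equal snd E). simpl in E1, E2.
  assert (K : (1 + 2 * fst X) * ((1 - fst w) ^ 2 + snd w ^ 2) = 1 - (fst w ^ 2 + snd w ^ 2)).
  { set (x := fst X) in *. set (y := snd X) in *. set (u := fst w) in *. set (v := snd w) in *.
    replace ((1 + 2 * x) * ((1 - u) ^ 2 + v ^ 2)) with
      ((1 - u) ^ 2 + v ^ 2 + 2 * ((x * (1 + - u) - y * (0 + - v)) * (1 - u) - (x * (0 + - v) + y * (1 + - u)) * v)) by ring.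
    rewrite E1, E2. ring. }
  assert (P : 0 <= (1 - fst w) ^ 2 + snd w ^ 2) by nra.
  assert (Q : 0 < (1 + 2 * fst X) * ((1 - fst w) ^ 2 + snd w ^ 2)) by lra.
  nra.
Qed.

(* Coefficients of (P(z) - 1) / z, where P is the Herglotz integral of the measure with mass m at -1
   and mass (1 - m) / 2 at e^{i psi} and at e^{-i psi}. *)
Definition atoms (m psi : R) (k : nat) : C :=
  RtoC (2 * (m * (-1) ^ S k + (1 - m) * cos (INR (S k) * psi))).

Lemma atoms_bound m psi k : 0 <= m <= 1 -> Cmod (atoms m psi k) <= 2.
Proof.
  intros Hm. unfold atoms. rewrite Cmod_R, Rabs_mult, (Rabs_pos_eq 2) by lra.
  assert (T := Rabs_triang (m * (-1) ^ S k) ((1 - m) * cos (INR (S k) * psi))).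
  rewrite !Rabs_mult, (Rabs_pos_eq m), (Rabs_pos_eq (1 - m)), pow_1_abs in T by lra.
  assert (B := COS_bound (INR (S k) * psi)). apply Rabs_le in B. nra.
Qed.

Lemma atoms_positive m psi z : 0 <= m <= 1 -> Cmod z < 1 -> 0 < 1 + fst (z * PS (atoms m psi) z)%C.
Proof.
  intros Hm Hz.
  set (g := fun eta k => (eta ^ S k)%C : C).
  assert (U1 : Cmod (RtoC (-1)) = 1) by (rewrite Cmod_R, Rabs_left; lra).
  assert (Hg : forall eta, Cmod eta = 1 -> summable (fun n => g eta n * z ^ n)%C).
  { intros eta He. apply PS_summable; auto. apply (rad1_bounded _ 1). intros n. right. apply Cmod_unit_pow; auto. }
  (* One kernel for each atom; the factors 2 m and 1 - m are twice the masses. *)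
  assert (E : PS (atoms m psi) z = (RtoC (2 * m) * PS (g (RtoC (-1))) z
    + (RtoC (1 - m) * PS (g (cis psi)) z + RtoC (1 - m) * PS (g (cis (- psi))) z))%C).
  { unfold PS. assert (G1 := Hg _ U1). assert (G2 := Hg _ (Cmod_cis psi)). assert (G3 := Hg _ (Cmod_cis (- psi))).
    rewrite <- !Csum_scal by auto.
    rewrite <- !Csum_plus by auto using summable_scal, summable_plus.
    apply Csum_ext. intros n. unfold g, atoms. rewrite !cis_pow.
    replace (INR (S n) * - psi) with (- (INR (S n) * psi)) by ring.
    rewrite <- RtoC_pow. set (t := INR (S n) * psi). set (o := (-1) ^ S n).
    assert (E : RtoC (2 * (m * o + (1 - m) * cos t)) =
       (RtoC (2 * m) * RtoC o + (RtoC (1 - m) * cis t + RtoC (1 - m) * cis (- t)))%C).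
    { apply C_eq; simpl; rewrite cos_neg, sin_neg; ring. }
    rewrite E. ring. }
  assert (K1 := half_plane_kernel _ z U1 Hz).
  assert (K2 := half_plane_kernel _ z (Cmod_cis psi) Hz).
  assert (K3 := half_plane_kernel _ z (Cmod_cis (- psi)) Hz).
  rewrite E. fold (g (RtoC (-1))) in K1. fold (g (cis psi)) in K2. fold (g (cis (- psi))) in K3.
  replace (1 + fst (z * (RtoC (2 * m) * PS (g (RtoC (-1))) z
    + (RtoC (1 - m) * PS (g (cis psi)) z + RtoC (1 - m) * PS (g (cis (- psi))) z)))%C)
  with (m * (1 + 2 * fst (z * PS (g (RtoC (-1))) z)%C)
     + (1 - m) / 2 * (1 + 2 * fst (z * PS (g (cis psi)) z)%C)
     + (1 - m) / 2 * (1 + 2 * fst (z * PS (g (cis (- psi))) z)%C)) by (simpl; field).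
  set (A := 1 + 2 * fst (z * PS (g (RtoC (-1))) z)%C) in *.
  set (B := 1 + 2 * fst (z * PS (g (cis psi)) z)%C) in *.
  set (D := 1 + 2 * fst (z * PS (g (cis (- psi))) z)%C) in *.
  destruct (Req_dec m 0) as [->|Hn]; [lra|].
  assert (0 < m * A) by (apply Rmult_lt_0_compat; lra).
  assert (0 <= (1 - m) / 2 * B) by (apply Rmult_le_pos; lra).
  assert (0 <= (1 - m) / 2 * D) by (apply Rmult_le_pos; lra).
  lra.
Qed.

(** Course-of-values recursion for f'' = E f'. The list holds b_n, ..., b_0, newest first, so its
    k-th entry is the b_(n-k) of the Cauchy product. *)
Fixpoint deriv_coefs (e : nat -> C) (n : nat) : list C :=
  match n with
  | O => RtoC 1 :: nil
  | S p => (csumf (fun k => e k * nth k (deriv_coefs e p) 0)%C p / RtoC (INR (S p)))%C :: deriv_coefs e p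
  end.

Definition deriv_coef (e : nat -> C) (n : nat) : C := nth 0 (deriv_coefs e n) 0.

Lemma nth_deriv_coefs e n k : (k <= n)%nat -> nth k (deriv_coefs e n) 0 = deriv_coef e (n - k).
Proof.
  revert k. induction n as [|n IH]; intros k Hk.
  - replace k with 0%nat by lia. reflexivity.
  - destruct k as [|k]; [reflexivity|]. apply IH. lia.
Qed.

Lemma deriv_coef_rec e n : pderiv (deriv_coef e) n = csumf (fun k => e k * deriv_coef e (n - k)%nat)%C n.
Proof.
  unfold pderiv. change (deriv_coef e (S n)) with
    (csumf (fun k => e k * nth k (deriv_coefs e n) 0)%C n / RtoC (INR (S n)))%C.
  rewrite (csumf_ext _ (fun k => e k * deriv_coef e (n - k)%nat)%C).
  - field. apply RtoC_INR_neq.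
  - intros k Hk. rewrite nth_deriv_coefs by auto. reflexivity.
Qed.

Lemma atoms_data m psi b : 0 <= m <= 1 -> b 0%nat = RtoC 1 ->
  (forall n, pderiv b n = csumf (fun k => atoms m psi k * b (n - k)%nat)%C n) ->
  convex_data (atoms m psi) b.
Proof.
  intros Hm Hb0 Hb. split; [|split; [|split]]; auto.
  - intros n. apply atoms_bound; auto.
  - intros z Hz. apply atoms_positive; auto.
Qed.

Lemma cos_3a t : cos (3 * t) = 4 * cos t ^ 3 - 3 * cos t.
Proof.
  replace (3 * t) with (2 * t + t) by ring. rewrite cos_plus, cos_2a_cos, sin_2a.
  assert (S := sin2_cos2 t). unfold Rsqr in S.
  replace (2 * sin t * cos t * sin t) with (2 * cos t * (sin t * sin t)) by ring.
  replace (sin t * sin t) with (1 - cos t * cos t) by lra. ring.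
Qed.

(** With u = cos psi the e_k are Chebyshev polynomials of u combined with the mass at -1. Three
    steps of the recursion give b_1, b_2, b_3, and a_n = b_(n-1) / n. *)
Lemma atoms_extremal m u : 0 <= m <= 1 -> -1 <= u <= 1 ->
  let e0 := 2 * ((1 - m) * u - m) in
  let e1 := 2 * (m + (1 - m) * (2 * u ^ 2 - 1)) in
  let e2 := 2 * ((1 - m) * (4 * u ^ 3 - 3 * u) - m) in
  exists a, classK a /\ a 2%nat = RtoC (e0 / 2) /\ a 3%nat = RtoC ((e0 ^ 2 + e1) / 6) /\
    a 4%nat = RtoC ((e0 * (e0 ^ 2 + e1) / 2 + e1 * e0 + e2) / 12).
Proof.
  intros Hm Hu e0 e1 e2.
  set (psi := acos u). set (e := atoms m psi). set (b := deriv_coef e).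
  assert (Hd : convex_data e b).
  { apply atoms_data; auto. intros n. apply deriv_coef_rec. }
  exists (pinteg b). split; [apply (convex_data_classK e b Hd)|].
  assert (cu : cos psi = u) by (apply cos_acos; lra).
  assert (E0 : e 0%nat = RtoC e0).
  { unfold e, atoms, e0. f_equal. simpl INR. rewrite Rmult_1_l, cu. simpl. ring. }
  assert (E1 : e 1%nat = RtoC e1).
  { unfold e, atoms, e1. f_equal. replace (INR 2 * psi) with (2 * psi) by (simpl; ring).
    rewrite cos_2a_cos, cu. simpl. ring. }
  assert (E2 : e 2%nat = RtoC e2).
  { unfold e, atoms, e2. f_equal. replace (INR 3 * psi) with (3 * psi) by (simpl; ring).
    rewrite cos_3a, cu. simpl. ring. }
  destruct Hd as [_ [_ [B0 Rec]]]. clearbody b e. clear psi cu.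
  assert (R0 := Rec 0%nat). assert (R1 := Rec 1%nat). assert (R2 := Rec 2%nat).
  rewrite csumf_0 in R0. rewrite csumf_S, csumf_0 in R1. rewrite !csumf_S, csumf_0 in R2.
  unfold pderiv in R0, R1, R2.
  change (0 - 0)%nat with 0%nat in R0.
  change (1 - 0)%nat with 1%nat in R1. change (1 - 1)%nat with 0%nat in R1.
  change (2 - 0)%nat with 2%nat in R2. change (2 - 1)%nat with 1%nat in R2. change (2 - 2)%nat with 0%nat in R2.
  rewrite E0, B0 in R0. rewrite E0, E1, B0 in R1. rewrite E0, E1, E2, B0 in R2.
  assert (B1 : b 1%nat = RtoC e0).
  { replace (b 1%nat) with (RtoC (INR 1) * b 1%nat)%C by (simpl; ring). rewrite R0. ring. }
  rewrite B1 in R1, R2.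
  assert (B2 : b 2%nat = RtoC ((e0 ^ 2 + e1) / 2)).
  { replace (b 2%nat) with (RtoC (/ 2) * (RtoC (INR 2) * b 2%nat))%C.
    - rewrite R1. apply C_eq; simpl; field.
    - apply C_eq; simpl; field. }
  rewrite B2 in R2.
  assert (B3 : b 3%nat = RtoC ((e0 * (e0 ^ 2 + e1) / 2 + e1 * e0 + e2) / 3)).
  { replace (b 3%nat) with (RtoC (/ 3) * (RtoC (INR 3) * b 3%nat))%C.
    - rewrite R2. apply C_eq; simpl; field.
    - apply C_eq; simpl; field. }
  unfold pinteg. rewrite B1, B2, B3. repeat split; rewrite <- RtoC_div by (simpl; lra); f_equal; simpl; field.
Qed.

(** * The functions L_phi *)

Lemma sum_f_R0_rev g n : sum_f_R0 (fun k => g (n - k)%nat) n = sum_f_R0 g n.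
Proof.
  induction n as [|n IH]; [reflexivity|].
  rewrite decomp_sum by lia. simpl pred.
  change (sum_f_R0 (fun i => g (S n - S i)%nat) n) with (sum_f_R0 (fun k => g (n - k)%nat) n).
  rewrite IH, Nat.sub_0_r. simpl. ring.
Qed.

(** By 2 cos A sin B = sin (B + A) + sin (B - A) every term contributes sin ((n + 2) phi), and the
    remaining parts cancel under k -> n - k. This is the recursion f'' = E f' for L_phi', up to the
    factor sin phi. *)
Lemma strip_recursion phi n : sum_f_R0 (fun k => 2 * cos (INR (S k) * phi) * sin (INR (S (n - k)) * phi)) n
  = INR (S n) * sin (INR (S (S n)) * phi).
Proof.
  set (g := fun k => sin ((INR (n - k) - INR k) * phi)).
  assert (G0 : sum_f_R0 g n = 0).
  { assert (E : sum_f_R0 g n = sum_f_R0 (fun k => g k * -1) n).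
    { rewrite <- sum_f_R0_rev at 1. apply sum_eq. intros k Hk. unfold g.
      replace (n - (n - k))%nat with k by lia.
      replace ((INR k - INR (n - k)) * phi) with (- ((INR (n - k) - INR k) * phi)) by ring.
      rewrite sin_neg. ring. }
    rewrite <- scal_sum in E. lra. }
  rewrite (sum_eq _ (fun k => sin (INR (S (S n)) * phi) + g k)).
  - rewrite plus_sum, sum_cte, G0. ring.
  - intros k Hk. unfold g.
    replace (INR (S (S n)) * phi) with (INR (S (n - k)) * phi + INR (S k) * phi).
    2: { rewrite <- Rmult_plus_distr_r, <- plus_INR. do 2 f_equal. lia. }
    replace ((INR (n - k) - INR k) * phi) with (INR (S (n - k)) * phi - INR (S k) * phi).
    2: { rewrite !S_INR. ring. }
    rewrite sin_plus, sin_minus. ring.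
Qed.

Lemma csumf_RtoC g n : csumf (fun k => RtoC (g k)) n = RtoC (sum_f_R0 g n).
Proof. apply C_eq; simpl; [reflexivity|]. apply sum_eq_R0. reflexivity. Qed.

(** L_phi belongs to the measure with mass 1/2 at each of e^{i phi} and e^{-i phi}, that is m =
    0. *)
Lemma Lcoef_classK phi : sin phi <> 0 -> classK (Lcoef phi).
Proof.
  intros Hs.
  set (b := fun n : nat => RtoC (sin (INR (S n) * phi) / sin phi)).
  replace (Lcoef phi) with (pinteg b).
  - apply (convex_data_classK (atoms 0 phi)). apply atoms_data; [lra| |].
    + unfold b. f_equal. simpl. rewrite Rmult_1_l. field. auto.
    + intros n. unfold pderiv, b.
      rewrite (csumf_ext _ (fun k => RtoC (2 * cos (INR (S k) * phi) * sin (INR (S (n - k)) * phi) * / sin phi))).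
      * rewrite csumf_RtoC, <- RtoC_mult, <- scal_sum, strip_recursion. f_equal. field. auto.
      * intros k _. unfold atoms. rewrite <- RtoC_mult. f_equal. unfold Rdiv. ring.
  - apply functional_extensionality. intros [|n]; [reflexivity|].
    unfold pinteg, b, Lcoef. rewrite <- RtoC_div by (apply not_0_INR; lia).
    change Defs.RtoC with RtoC. f_equal. field. split; [auto|apply not_0_INR; lia].
Qed.

Lemma Lcoef_values c : -1 < c < 1 -> let L := Lcoef (acos c) in
  classK L /\ L 2%nat = RtoC c /\ L 3%nat = RtoC ((4 * c ^ 2 - 1) / 3) /\ L 4%nat = RtoC (2 * c ^ 3 - c).
Proof.
  intros Hc L. set (phi := acos c) in *.
  assert (cp : cos phi = c) by (apply cos_acos; lra).
  assert (sp : sin phi * sin phi = 1 - c * c).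
  { assert (H := sin2_cos2 phi). unfold Rsqr in H. rewrite cp in H. lra. }
  assert (Hs : sin phi <> 0) by (intros E; rewrite E in sp; nra).
  assert (s2 : sin (2 * phi) = 2 * c * sin phi) by (rewrite sin_2a, cp; ring).
  assert (c2 : cos (2 * phi) = 2 * c ^ 2 - 1) by (rewrite cos_2a_cos, cp; ring).
  split; [apply Lcoef_classK; auto|].
  unfold L, Lcoef. change Defs.RtoC with RtoC. repeat split; f_equal.
  - replace (INR 2) with 2 by (simpl; ring). rewrite s2. field. auto.
  - replace (INR 3) with 3 by (simpl; ring). replace (3 * phi) with (2 * phi + phi) by ring.
    rewrite sin_plus, s2, c2, cp. field. auto.
  - replace (INR 4) with 4 by (simpl; ring). replace (4 * phi) with (2 * (2 * phi)) by ring.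
    rewrite sin_2a, s2, c2. field. auto.
Qed.

(** * Sharpness and maximisation over p *)

Lemma classK_classKp a c : classK a -> a 2%nat = RtoC (c / 2) -> classKp c a.
Proof. intros H E. split; auto. rewrite E. apply C_eq; simpl; field. Qed.

Lemma Cmod_RtoC_minus x y : Cmod (RtoC x - RtoC y)%C = Rabs (x - y).
Proof. rewrite <- RtoC_minus, Cmod_R. reflexivity. Qed.

(** Two atoms at e^{i psi} and e^{-i psi} with cos psi = p / 2, for which a_3 - a_2 = - [bound3 p].
    Working with the measure includes p = 2, where the formula of [Lcoef] has sin psi = 0 in the
    denominator. *)
Lemma bound3_attained p : 0 <= p <= 2 ->
  exists a, classKp p a /\ Cmod (a 3%nat - a 2%nat)%C = bound3 p.
Proof.
  intros Hp. destruct (atoms_extremal 0 (p / 2)) as [a [HK [A2 [A3 _]]]]; [lra|lra|].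
  exists a. split.
  - apply classK_classKp; auto. rewrite A2. f_equal. field.
  - rewrite A2, A3, Cmod_RtoC_minus. unfold bound3.
    match goal with |- Rabs ?X = ?Y => replace X with (- Y) by field end.
    rewrite Rabs_Ropp. apply Rabs_pos_eq. nra.
Qed.

(* For p < 8/7 the extremal w has Schur parameters c, (2 - 5c) / (2 (1 - c)), -1 with c = p / 2;
   the atoms below are the solutions of z w(z) = 1. *)
Lemma bound4_attained p : 0 <= p <= 2 ->
  exists a, classKp p a /\ Cmod (a 4%nat - a 3%nat)%C = bound4 p.
Proof.
  intros Hp. unfold bound4. destruct (Rlt_dec p (8 / 7)) as [L|L].
  - destruct (atoms_extremal ((8 - 7 * p) / (16 - 3 * p)) (1 - 3 * p / 8)) as [a [HK [A2 [A3 A4]]]].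
    { split; [apply Rdiv_le_0_compat; lra|]. apply Rle_div_l; lra. }
    { lra. }
    exists a. split.
    + apply classK_classKp; auto. rewrite A2. f_equal. field. lra.
    + rewrite A3, A4, Cmod_RtoC_minus.
      match goal with |- Rabs ?X = ?Y => replace X with (- Y) by (field; lra) end.
      rewrite Rabs_Ropp. apply Rabs_pos_eq.
      assert (0 <= p ^ 3) by (apply pow_le; lra). nra.
  (* The maximum in [bound4_le] is now at r = 1, and the two-atom function has w1 = - (1 - c^2). *)
  - destruct (atoms_extremal 0 (p / 2)) as [a [HK [A2 [A3 A4]]]]; [lra|lra|].
    exists a. split.
    + apply classK_classKp; auto. rewrite A2. f_equal. field.
    + rewrite A3, A4, Cmod_RtoC_minus.
      match goal with |- Rabs ?X = ?Y => replace X with (- Y) by field end.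
      rewrite Rabs_Ropp. apply Rabs_pos_eq.
      replace ((-3 * p ^ 3 + 4 * p ^ 2 + 6 * p - 4) / 12) with ((2 - p) * (3 * p ^ 2 + 2 * p - 2) / 12) by field.
      assert (0 <= (2 - p) * (3 * p ^ 2 + 2 * p - 2)) by (apply Rmult_le_pos; nra). lra.
Qed.

(** The difference of the two sides is (p - 3/4)^2 / 3; the maximum at p = 3/4 corresponds to cos
    phi = 3/8. *)
Lemma bound3_max p : bound3 p <= 25 / 48.
Proof. unfold bound3. assert (H := pow2_ge_0 (p - 3 / 4)). lra. Qed.

Lemma bound4_max p : 0 <= p <= 2 -> bound4 p <= (35 * sqrt 70 - 49) / 729.
Proof.
  intros Hp. set (s := sqrt 70).
  assert (Hs : s * s = 70) by (apply sqrt_sqrt; lra).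
  assert (S0 : 0 <= s) by apply sqrt_pos.
  assert (S1 : 8.366 < s < 8.367) by nra.
  unfold bound4. destruct (Rlt_dec p (8 / 7)) as [L|L].
  (* On this branch the value is at most 64 / 192 = 1/3, just below the claimed 0.3344... *)
  - assert (p * (p ^ 2 + 50 * p - 64) <= 0) by nra. nra.
  (* The positive root of - 9 p^2 + 8 p + 6, the critical point of the cubic branch; it is a double
     root of the difference. *)
  - set (q := (4 + s) / 9).
    assert (E : (35 * s - 49) / 729 - (-3 * p ^ 3 + 4 * p ^ 2 + 6 * p - 4) / 12
      = (p - q) ^ 2 * (3 * p + 6 * q - 4) / 12).
    { unfold q. assert (s3 : s ^ 3 = 70 * s) by (simpl; nra).
      assert (s2 : s ^ 2 = 70) by (simpl; lra).
      field_simplify. rewrite ?s3, ?s2. field. }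
    assert (0 <= (p - q) ^ 2 * (3 * p + 6 * q - 4)).
    { apply Rmult_le_pos; [apply pow2_ge_0|]. unfold q. lra. }
    lra.
Qed.

(* [Cmod] and [Csub] below are those of [Defs]; they are convertible to Coquelicot's. *)
Import Pilot.Defs.

Theorem theorem3 :
  (forall p, 0 <= p <= 2 ->
     (forall a, classKp p a ->
        Cmod (Csub (a 3%nat) (a 2%nat)) <= bound3 p /\
        Cmod (Csub (a 4%nat) (a 3%nat)) <= bound4 p) /\
     (exists a, classKp p a /\ Cmod (Csub (a 3%nat) (a 2%nat)) = bound3 p) /\
     (exists a, classKp p a /\ Cmod (Csub (a 4%nat) (a 3%nat)) = bound4 p)) /\
  (forall a, classKplus a -> Cmod (Csub (a 3%nat) (a 2%nat)) <= 25 / 48) /\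
  (let L := Lcoef (acos (3 / 8)) in
     classKplus L /\ Cmod (Csub (L 3%nat) (L 2%nat)) = 25 / 48) /\
  (forall a, classKplus a ->
     Cmod (Csub (a 4%nat) (a 3%nat)) <= (35 * sqrt 70 - 49) / 729) /\
  (let L := Lcoef (acos ((4 + sqrt 70) / 18)) in
     classKplus L /\ Cmod (Csub (L 4%nat) (L 3%nat)) = (35 * sqrt 70 - 49) / 729).
Proof.
  repeat split.
  - apply (classKp_bounds p); auto.
  - apply (classKp_bounds p); auto.
  - apply bound3_attained; auto.
  - apply bound4_attained; auto.
  - intros a [p [Hp Ha]]. eapply Rle_trans; [apply (classKp_bounds p); eauto|apply bound3_max].
  - destruct (Lcoef_values (3 / 8)) as [HK [L2 _]]; [lra|].
    (* For L_phi, p = 2 a_2 = 2 cos phi. *)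
    exists (3 / 4). split; [lra|]. apply classK_classKp; auto. rewrite L2. f_equal. field.
  - destruct (Lcoef_values (3 / 8)) as [_ [L2 [L3 _]]]; [lra|].
    etransitivity; [apply (f_equal2 (fun u v => Coquelicot.Complex.Cmod (u - v)%C) L3 L2)|].
    rewrite Cmod_RtoC_minus, Rabs_left; lra.
  - intros a [p [Hp Ha]]. eapply Rle_trans; [apply (classKp_bounds p); eauto|apply bound4_max; auto].
  - set (s := sqrt 70).
    assert (Hs : s * s = 70) by (apply sqrt_sqrt; lra).
    assert (S0 : 0 <= s) by apply sqrt_pos.
    assert (S1 : 8.366 < s < 8.367) by nra.
    destruct (Lcoef_values ((4 + s) / 18)) as [HK [L2 _]]; [lra|].
    exists ((4 + s) / 9). split; [lra|]. apply classK_classKp; auto. rewrite L2. f_equal. field.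
  - set (s := sqrt 70).
    assert (Hs : s * s = 70) by (apply sqrt_sqrt; lra).
    assert (S0 : 0 <= s) by apply sqrt_pos.
    assert (S1 : 8.366 < s < 8.367) by nra.
    destruct (Lcoef_values ((4 + s) / 18)) as [_ [_ [L3 L4]]]; [lra|].
    etransitivity; [apply (f_equal2 (fun u v => Coquelicot.Complex.Cmod (u - v)%C) L4 L3)|].
    rewrite Cmod_RtoC_minus.
    match goal with |- Rabs ?X = ?Y => replace X with (- Y) end.
    + rewrite Rabs_Ropp. apply Rabs_pos_eq. lra.
    + assert (s3 : s ^ 3 = 70 * s) by (simpl; nra).
      assert (s2 : s ^ 2 = 70) by (simpl; lra).
      field_simplify. rewrite ?s3, ?s2. field.
Qed.
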